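(* Let $B$ be the open unit ball of $\mathbb{R}^3$ centered at the origin $o$. Let $0<\mu<\pi^2$, let $K_0>0$ and $\eta\ge 0$ be constants, and suppose that $K(x)=K_0-\eta\bigl(|x|+|x|^2\bigr)$ is a non-negative function on $B$ (so $K(o)=K_0$). Then the problem $$-\Delta u=K(x)u^5+\mu u\ \text{ in } B,\qquad u>0\ \text{ in } B,\qquad u=0\ \text{ on }\partial B$$ admits a solution if and only if $$\frac{\eta}{16\pi K_0}<g_\mu^{B}(o,o),$$ where $g_\mu^B$ is the regular part of the Green's function of $-\Delta-\mu$ on $B$ with zero Dirichlet boundary condition.
   Context: Here $|x|$ is the Euclidean norm on $\mathbb{R}^3$. For $0<\mu<\pi^2$ (note that $\pi^2$ is the first Dirichlet eigenvalue of $-\Delta$ on $B$), the Green's function $G_\mu^B(x,y)$ is the solution of $-\Delta_x G_\mu^B(\cdot,y)-\mu G_\mu^B(\cdot,y)=\delta_y$ in $B$, $G_\mu^B(\cdot,y)=0$ on $\partial B$. Its regular part is defined by $G_\mu^B(x,y)=\frac{1}{4\pi|x-y|}+g_\mu^B(x,y)$, where $g_\mu^B$ is extended continuously to the diagonal. A known explicit value is $$g_\mu^B(o,o)=-\frac{\sqrt{\mu}\,\cos(\sqrt{\mu})}{4\pi\sin(\sqrt{\mu})}.$$ A solution is understood as a classical solution $u\in C^2(\bar B)$; since $K$ is Lipschitz on $\bar B$, by standard elliptic regularity this is equivalent to a positive weak solution $u\in H_0^1(B)$. *)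

(* Defs.v *)
From HB Require Import structures.
From mathcomp Require Import all_boot all_order all_algebra.
From mathcomp Require Import all_classical all_reals all_analysis.

Set Implicit Arguments.
Unset Strict Implicit.
Unset Printing Implicit Defensive.

Import Order.TTheory GRing.Theory Num.Theory.
Import numFieldNormedType.Exports.

Local Open Scope classical_set_scope.
Local Open Scope ring_scope.

(* The library's norm on 'rV[R]_3 is the sup norm: it is used here only through
   the topology and the derivatives, which do not depend on the choice of a
   norm. *)
Definition enorm (R : realType) (x : 'rV[R]_3) : R :=
  Num.sqrt (\sum_(i < 3) x ord0 i ^+ 2).

Definition uball (R : realType) : set 'rV[R]_3 := [set x | enorm x < 1].
Definition ucball (R : realType) : set 'rV[R]_3 := [set x | enorm x <= 1].
Definition usphere (R : realType) : set 'rV[R]_3 := [set x | enorm x = 1].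
Arguments uball R : clear implicits.
Arguments ucball R : clear implicits.
Arguments usphere R : clear implicits.

Definition ebase (R : realType) (i : 'I_3) : 'rV[R]_3 := delta_mx ord0 i.
Arguments ebase R i : clear implicits.

Definition partial (R : realType) (i : 'I_3) (f : 'rV[R]_3 -> R) :
  'rV[R]_3 -> R := fun x => 'D_(ebase R i) f x.

Definition laplacian (R : realType) (f : 'rV[R]_3 -> R) (x : 'rV[R]_3) : R :=
  \sum_(i < 3) partial i (partial i f) x.

(* f, a priori meaningful on the open ball only, extends continuously to the
   closed ball. *)
Definition extends_to_ucball (R : realType) (f : 'rV[R]_3 -> R) : Prop :=
  exists2 h : 'rV[R]_3 -> R,
    {within ucball R, continuous h} & forall x, uball R x -> h x = f x.

(* u is in C^2 of the closed unit ball: u is continuous there, and its partial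
   derivatives of order 1 and 2 exist in the open ball and extend continuously
   to the closed ball. *)
Definition C2_ucball (R : realType) (u : 'rV[R]_3 -> R) : Prop :=
  [/\ {within ucball R, continuous u},
      forall i x, uball R x -> derivable u x (ebase R i),
      forall i j x, uball R x -> derivable (partial i u) x (ebase R j),
      forall i, extends_to_ucball (partial i u)
    & forall i j, extends_to_ucball (partial j (partial i u))].

Definition is_solution (R : realType) (K : 'rV[R]_3 -> R) (mu : R)
    (u : 'rV[R]_3 -> R) : Prop :=
  [/\ C2_ucball u,
      forall x, uball R x -> - laplacian u x = K x * u x ^+ 5 + mu * u x,
      forall x, uball R x -> 0 < u x
    & forall x, usphere R x -> u x = 0].

Definition smooth (R : realType) (f : 'rV[R]_3 -> R) : Prop :=
  forall s : seq 'I_3,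
    continuous (foldr (@partial R) f s) /\
    forall i x, derivable (foldr (@partial R) f s) x (ebase R i).

Definition test_function (R : realType) (phi : 'rV[R]_3 -> R) : Prop :=
  smooth phi /\
  exists C : set 'rV[R]_3,
    [/\ compact C, C `<=` uball R & forall x, ~ C x -> phi x = 0].

(* Three-dimensional Lebesgue measure is the threefold product of the measure on
   the line; row3 transports it from R * R * R to 'rV[R]_3. *)
Definition row3 (R : realType)
    (p : measurableTypeR R * measurableTypeR R * measurableTypeR R) :
  'rV[R]_3 := \row_(i < 3) [:: p.1.1; p.1.2; p.2]`_i.

Definition lebesgue3 (R : realType) :=
  ((@lebesgue_measure R \x @lebesgue_measure R) \x @lebesgue_measure R)%E.
Arguments lebesgue3 R : clear implicits.

Definition integrable_on_uball (R : realType) (f : 'rV[R]_3 -> R) : Prop :=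
  (lebesgue3 R).-integrable (@row3 R @^-1` uball R)
    (fun p => (f (row3 p))%:E).

Definition int_uball (R : realType) (f : 'rV[R]_3 -> R) : R :=
  \int[lebesgue3 R]_(p in @row3 R @^-1` uball R) f (row3 p).

(* For each pole y in the open ball: - Delta G(., y) - mu G(., y) = delta_y in
   the sense of distributions, and G(., y), continuous on the closed ball away
   from y, vanishes on the unit sphere.  The value of G y y is irrelevant. *)
Definition is_green (R : realType) (mu : R)
    (G : 'rV[R]_3 -> 'rV[R]_3 -> R) : Prop :=
  forall y, uball R y ->
  [/\ {within ucball R `\ y, continuous (fun x => G x y)},
      integrable_on_uball (fun x => G x y),
      forall phi, test_function phi ->
        int_uball (fun x => G x y * (- laplacian phi x - mu * phi x)) = phi y
    & forall x, usphere R x -> G x y = 0].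

Definition is_green_regular_part (R : realType) (mu : R)
    (g : 'rV[R]_3 -> 'rV[R]_3 -> R) : Prop :=
  exists G : 'rV[R]_3 -> 'rV[R]_3 -> R,
  [/\ is_green mu G,
      forall x y, uball R x -> uball R y -> x != y ->
        G x y = (4 * pi * enorm (x - y))^-1 + g x y
    & forall y, uball R y ->
        {for (y, y), continuous (fun p : 'rV[R]_3 * 'rV[R]_3 => g p.1 p.2)}].

(* Main.v *)
(* Put w = sqrt mu.

   Testing the equation of G(., o) with radial functions that vanish near o, cut off at scale
   delta, compares G(., o) with Gam(r) = (cos (w r) / (4 pi) + g(o,o) sin (w r) / w) / r, which
   solves the same equation away from o: the difference is o(1) at o, so the cutoff costs nothing
   as delta tends to 0 and the radial mean of the difference vanishes near the sphere; as
   G(., o) = 0 on the sphere, Gam(1) = 0.  Hence g(o,o) = - w cos w / (4 pi sin w), and the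
   condition on eta reads eta < - 4 K0 w cot w.

   As K decreases with |x|, a positive solution is radial by moving planes.  Let v = r u(r),
   s1 = sin (w r) / w and s2 = cos (w r) + beta s1.  If W1, W2 are the Wronskians of v with s1, s2,
   then E = W1 W2 + K r^2 s1 s2 u^6 / 3 has a derivative that involves only u.  For
   beta = - w cot w <= eta / (4 K0) it is strictly monotone although it vanishes at 0 and at 1,
   where s2 = 0: there is no solution.

   If eta < - 4 K0 w cot w, let U_A be the radial solution with U_A(0) = A.  For small A it is
   positive on [0, 1] by Sturm comparison.  For large A, choose beta strictly between eta / (4 K0)
   and - w cot w, so that s2 has its first zero r0 in (0, 1).  If U_A were positive on [0, 1), E
   would increase near 0, up to at least c A^-2 at distance A^-2 of 0; then U_A = O(1/A) away from
   0, so that E varies by O(A^-6) from there to r0, where E <= 0: a contradiction.  Hence U_A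
   vanishes before 1, and by continuity in A some positive U_A vanishes exactly at 1. *)

From HB Require Import structures.
Require Import Defs.
From mathcomp Require Import all_boot all_order all_algebra.
From mathcomp Require Import all_classical all_reals all_analysis.
From mathcomp Require Import measurable_realfun.
From mathcomp Require Import ring lra.
Import Order.TTheory GRing.Theory Num.Theory.
Import numFieldNormedType.Exports.
Local Open Scope classical_set_scope.
Local Open Scope ring_scope.

(** * Calculus on the line *)

(** The threshold is the sign of one coefficient: E' is r u^6 times a function that starts like (4
    K0 beta - eta) r^2 / 3 at 0, while s2 vanishes at 1 exactly for beta = - w cot w = 4 pi g(o,o).

    The bound U_A = O(1/A) away from 0 is obtained without rescaling. For w = beta = eta = 0 the
    entire solutions have u^-2 affine in r^2. In general (s1 / v)^2, seen as a function of (s1 /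
    s2)^2, is convex where E >= 0, so the growth that it acquires at distance A^-2 of the origin
    persists up to a fixed distance.

    The Green's function enters only through a distributional equation, and G(., o) is not known to
    be radial or smooth. Hence the test functions are explicit radial ones, the only integration by
    parts is the divergence theorem for fields k(|x|) x supported in a shell, done one coordinate at
    a time by Fubini, and volumes are estimated with boxes instead of polar coordinates. *)

Section DerivativeRules.
Context {R : realType} {V : normedModType R}.
Implicit Types (f g : V -> R) (x v : V).

Lemma der_eq {f x v a b} : is_derive x v f a -> a = b -> is_derive x v f b.
Proof. by move=> ? <-. Qed.

Lemma der_cst (c : R) x v : is_derive x v (fun=> c) 0.
Proof. exact: is_derive_cst. Qed.

Lemma derD f g x v a b : is_derive x v f a -> is_derive x v g b ->
  is_derive x v (fun y => f y + g y) (a + b).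
Proof. exact: is_deriveD. Qed.

Lemma derN f x v a : is_derive x v f a -> is_derive x v (fun y => - f y) (- a).
Proof. exact: is_deriveN. Qed.

Lemma derM f g x v a b : is_derive x v f a -> is_derive x v g b ->
  is_derive x v (fun y => f y * g y) (f x * b + g x * a).
Proof. exact: is_deriveM. Qed.

Lemma derX f n x v a : is_derive x v f a ->
  is_derive x v (fun y => f y ^+ n) (n%:R * f x ^+ n.-1 * a).
Proof.
move=> df; have -> : (fun y => f y ^+ n) = f ^+ n by rewrite exprfctE.
exact: is_deriveX.
Qed.

Lemma derV f x v a : f x != 0 -> is_derive x v f a ->
  is_derive x v (fun y => (f y)^-1) (- (f x) ^- 2 * a).
Proof.
move=> f0 [df <-]; apply: DeriveDef; first exact: derivableV.
exact: deriveV.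
Qed.

End DerivativeRules.

Section DerivativeComposition.
Context {R : realType}.

(** Restricted to the line [h *: v + x], both derivatives become derivatives at 0 of functions of
    one real variable, where the one-dimensional chain rule applies. *)
Lemma der_comp {V : normedModType R} (g : R -> R) (f : V -> R) x v a b :
  is_derive x v f a -> is_derive (f x) 1 g b ->
  is_derive x v (fun y => g (f y)) (b * a).
Proof.
move=> [df dfE] dg.
pose k h := f (h *: v + x).
have dk : is_derive (0 : R) 1 k a.
  apply: DeriveDef; first exact: (@derivable1P _ _ _ f x v).1.
  rewrite -dfE /derive; set g1 := fun h => h^-1 *: _; set g2 := fun h => h^-1 *: _.
  suff -> : g1 = g2 by [].
  by apply/funext => h; rewrite /g1 /g2 /= /k addr0 scale0r add0r [_%:A]mulr1.
have k0 : k 0 = f x by rewrite /k scale0r add0r.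
have := @is_derive1_comp R g k 0 b a; rewrite k0 => /(_ dg dk) [dc dcE].
apply: DeriveDef; first exact: (@derivable1P _ _ _ (fun y => g (f y)) x v).2.
rewrite -dcE /derive; set g1 := fun h => h^-1 *: _; set g2 := fun h => h^-1 *: _.
suff -> : g1 = g2 by [].
by apply/funext => h; rewrite /g1 /g2 /= /k addr0 scale0r add0r [_%:A]mulr1.
Qed.

Lemma der_id (x : R) : is_derive x 1 (fun y => y) 1.
Proof. exact: is_derive_id. Qed.

Lemma der_sin {V : normedModType R} (f : V -> R) x v a : is_derive x v f a ->
  is_derive x v (fun y => sin (f y)) (cos (f x) * a).
Proof. by move=> df; apply: (der_comp sin f) => //; exact: is_derive_sin. Qed.

Lemma der_cos {V : normedModType R} (f : V -> R) x v a : is_derive x v f a ->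
  is_derive x v (fun y => cos (f y)) (- sin (f x) * a).
Proof. by move=> df; apply: (der_comp cos f) => //; exact: is_derive_cos. Qed.

Lemma der_expR {V : normedModType R} (f : V -> R) x v a : is_derive x v f a ->
  is_derive x v (fun y => expR (f y)) (expR (f x) * a).
Proof. by move=> df; apply: (der_comp expR f). Qed.

Lemma der_continuous (f : R -> R) (x a : R) :
  is_derive x 1 f a -> {for x, continuous f}.
Proof. by move=> [df _]; exact/differentiable_continuous/derivable1_diffP. Qed.

End DerivativeComposition.

(** Reads a derivative off the syntax of the function. Derivatives of abstract functions come from
    the context, which is why they are introduced before each call. [der] leaves only the comparison
    of the computed derivative with the expected one; [der0] also leaves the side conditions that
    denominators do not vanish. *)
Ltac der_step := lazymatch goal with
  | |- is_derive _ _ (fun y => y) _ => notypeclasses refine (der_id _)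
  | |- is_derive _ _ (fun _ => ?c) _ => notypeclasses refine (der_cst c _ _)
  | |- is_derive _ _ (fun y => sin (@?f y)) _ =>
      notypeclasses refine (der_sin f _ _ _ _)
  | |- is_derive _ _ (fun y => cos (@?f y)) _ =>
      notypeclasses refine (der_cos f _ _ _ _)
  | |- is_derive _ _ (fun y => expR (@?f y)) _ =>
      notypeclasses refine (der_expR f _ _ _ _)
  | |- is_derive _ _ (fun y => @?f y + @?g y) _ =>
      notypeclasses refine (derD f g _ _ _ _ _ _)
  | |- is_derive _ _ (fun y => - @?f y) _ =>
      notypeclasses refine (derN f _ _ _ _)
  | |- is_derive _ _ (fun y => @?f y * @?g y) _ =>
      notypeclasses refine (derM f g _ _ _ _ _ _)
  | |- is_derive _ _ (fun y => @?f y ^+ ?n) _ =>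
      notypeclasses refine (derX f n _ _ _ _)
  | |- is_derive _ _ (fun y => (@?f y)^-1) _ =>
      notypeclasses refine (derV f _ _ _ _ _)
  | |- is_derive _ _ _ _ => eassumption
  end.
Ltac der := notypeclasses refine (der_eq _ _); [solve [repeat der_step] | cbv beta].
Ltac der0 := notypeclasses refine (der_eq _ _); [repeat der_step | cbv beta].

Section Monotonicity.
Context {R : realType}.
Implicit Types (f df : R -> R).

Lemma continuous_within f (A : set R) :
  (forall x, A x -> {for x, continuous f}) -> {within A, continuous f}.
Proof.
move=> cf; apply/subspace_continuousP => x Ax.
exact: cvg_within_filter (cf x Ax).
Qed.

Lemma mean_value f df a b : a < b ->
  (forall x, a <= x <= b -> {for x, continuous f}) ->
  (forall x, a < x < b -> is_derive x 1 f (df x)) ->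
  exists2 c, a < c < b & f b - f a = df c * (b - a).
Proof.
move=> ab cf dfP; have dfP' x : x \in `]a, b[%R -> is_derive x 1 f (df x).
  by rewrite in_itv /= => /dfP.
have cf' : {within `[a, b], continuous f}.
  by apply: continuous_within => x; rewrite /= in_itv /= => /cf.
have [c cab E] := MVT ab dfP' cf'.
by exists c; first by move: cab; rewrite in_itv.
Qed.

Lemma deriv_ge0_le f df a b : a <= b ->
  (forall x, a <= x <= b -> {for x, continuous f}) ->
  (forall x, a < x < b -> is_derive x 1 f (df x)) ->
  (forall x, a < x < b -> 0 <= df x) -> f a <= f b.
Proof.
rewrite le_eqVlt => /predU1P[->//|ab] cf dfP df0.
have [c cab E] := mean_value _ _ _ _ ab cf dfP.
by rewrite -subr_ge0 E mulr_ge0 ?df0// subr_ge0 ltW.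
Qed.

Lemma deriv_gt0_lt f df a b : a < b ->
  (forall x, a <= x <= b -> {for x, continuous f}) ->
  (forall x, a < x < b -> is_derive x 1 f (df x)) ->
  (forall x, a < x < b -> 0 < df x) -> f a < f b.
Proof.
move=> ab cf dfP df0.
have [c cab E] := mean_value _ _ _ _ ab cf dfP.
by rewrite -subr_gt0 E mulr_gt0 ?df0// subr_gt0.
Qed.

Lemma deriv_le0_ge f df a b : a <= b ->
  (forall x, a <= x <= b -> {for x, continuous f}) ->
  (forall x, a < x < b -> is_derive x 1 f (df x)) ->
  (forall x, a < x < b -> df x <= 0) -> f b <= f a.
Proof.
move=> ab cf dfP df0; rewrite -lerN2.
apply: (deriv_ge0_le (fun x => - f x) (fun x => - df x)) => //.
- by move=> x /cf; exact: continuousN.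
- by move=> x /dfP; exact: derN.
- by move=> x /df0; rewrite oppr_ge0.
Qed.

Lemma deriv_lt0_gt f df a b : a < b ->
  (forall x, a <= x <= b -> {for x, continuous f}) ->
  (forall x, a < x < b -> is_derive x 1 f (df x)) ->
  (forall x, a < x < b -> df x < 0) -> f b < f a.
Proof.
move=> ab cf dfP df0; rewrite -ltrN2.
apply: (deriv_gt0_lt (fun x => - f x) (fun x => - df x)) => //.
- by move=> x /cf; exact: continuousN.
- by move=> x /dfP; exact: derN.
- by move=> x /df0; rewrite oppr_gt0.
Qed.

(** [h1] vanishes at the minimum, so [h2 < 0] would make [h1] negative just to the right of 0, and
    [h] would drop below [h 0]. *)
Lemma second_derivative_min (h h1 : R -> R) (h2 e : R) : 0 < e ->
  (forall t : R, `|t| < e -> is_derive t 1 h (h1 t)) ->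
  is_derive (0 : R) 1 h1 h2 -> (forall t : R, `|t| < e -> h 0 <= h t) -> 0 <= h2.
Proof.
move=> e0 dh dh1 hmin.
have h10 : h1 0 = 0.
  have h0 : is_derive (0 : R) 1 h 0.
    apply: (@derive1_at_min R h (- e) e 0).
    - by rewrite ge0_cp// ltW.
    - by move=> t; rewrite in_itv/= -ltr_norml => /dh [].
    - by rewrite in_itv/= oppr_lt0 e0.
    - by move=> t; rewrite in_itv/= -ltr_norml => /hmin.
  have h0' : is_derive (0 : R) 1 h (h1 0) by apply: dh; rewrite normr0.
  by case: h0' => _ <-; case: h0.
rewrite leNgt; apply/negP => h20.
have [dh1x dh1E] := dh1.
have : (fun t : R => t^-1 *: ((h1 \o shift 0) (t *: 1) - h1 0)) @ 0^' --> h2.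
  by rewrite -dh1E; exact: dh1x.
move/cvgr_lt => /(_ 0 h20).
rewrite near_withinE => -[d d0 /= dP].
pose m := Num.min d e / 2.
have mm : 0 < Num.min d e by rewrite lt_min d0 e0.
have m0 : 0 < m by rewrite divr_gt0.
have md : m < d.
  by apply: (@lt_le_trans _ _ (Num.min d e)); [rewrite /m; lra|rewrite ge_min lexx].
have me : m < e.
  by apply: (@lt_le_trans _ _ (Num.min d e)); [rewrite /m; lra|rewrite ge_min lexx orbT].
have : h m < h 0.
  apply: (deriv_lt0_gt h h1) => //.
  - move=> x /andP[x0 xm]; apply: der_continuous (dh x _).
    by rewrite ger0_norm// (le_lt_trans xm).
  - move=> x /andP[x0 xm]; apply: dh.
    by rewrite gtr0_norm// (lt_trans xm).
  - move=> x /andP[x0 xm].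
    have := dP x; rewrite /ball_ /= sub0r normrN gtr0_norm// => /(_ (lt_trans xm md)).
    by move=> /(_ (lt0r_neq0 x0)); rewrite addr0 [_%:A]mulr1 h10 subr0 [_ *: _]/(_ * _) pmulr_rlt0// invr_gt0.
by apply/negP; rewrite -leNgt; apply: hmin; rewrite gtr0_norm.
Qed.

End Monotonicity.

Section ContinuityRules.
Context {R : realType} {T : topologicalType}.
Implicit Types (f g : T -> R) (x : T).

Lemma cont_cst (c : R) x : {for x, continuous (fun=> c)}.
Proof. exact: cvg_cst. Qed.

Lemma contD f g x : {for x, continuous f} -> {for x, continuous g} ->
  {for x, continuous (fun y => f y + g y)}.
Proof. exact: continuousD. Qed.

Lemma contN f x : {for x, continuous f} -> {for x, continuous (fun y => - f y)}.
Proof. exact: continuousN. Qed.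

Lemma contM f g x : {for x, continuous f} -> {for x, continuous g} ->
  {for x, continuous (fun y => f y * g y)}.
Proof. exact: continuousM. Qed.

Lemma contX f n x : {for x, continuous f} -> {for x, continuous (fun y => f y ^+ n)}.
Proof.
move=> cf; elim: n => [|n IH]; first exact: cvg_cst.
have <- : (fun y => f y * f y ^+ n) = (fun y => f y ^+ n.+1).
  by apply/funext => y; rewrite exprS.
exact: contM.
Qed.

Lemma contV f x : f x != 0 -> {for x, continuous f} ->
  {for x, continuous (fun y => (f y)^-1)}.
Proof. exact: cvgV. Qed.

Lemma cont_comp (g : R -> R) f x : {for x, continuous f} ->
  {for f x, continuous g} -> {for x, continuous (fun y => g (f y))}.
Proof. exact: continuous_comp. Qed.

Lemma cont_sin f x : {for x, continuous f} -> {for x, continuous (fun y => sin (f y))}.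
Proof. by move=> cf; apply: (cont_comp sin) => //; exact: continuous_sin. Qed.

Lemma cont_cos f x : {for x, continuous f} -> {for x, continuous (fun y => cos (f y))}.
Proof. by move=> cf; apply: (cont_comp cos) => //; exact: continuous_cos. Qed.

Lemma cont_expR f x : {for x, continuous f} ->
  {for x, continuous (fun y => expR (f y))}.
Proof. by move=> cf; apply: (cont_comp expR) => //; exact: continuous_expR. Qed.

Lemma cont_max f g x : {for x, continuous f} -> {for x, continuous g} ->
  {for x, continuous (fun y => Num.max (f y) (g y))}.
Proof. exact: continuous_max. Qed.

Lemma cont_min f g x : {for x, continuous f} -> {for x, continuous g} ->
  {for x, continuous (fun y => Num.min (f y) (g y))}.
Proof. exact: continuous_min. Qed.

Lemma cont_abs f x : {for x, continuous f} ->
  {for x, continuous (fun y => `|f y|)}.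
Proof. by move=> cf; exact: cvg_norm. Qed.

Lemma cont_sum n (f : 'I_n -> T -> R) x : (forall i, {for x, continuous (f i)}) ->
  {for x, continuous (fun y => \sum_(i < n) f i y)}.
Proof.
elim: n f => [|n IH] f cf.
  have <- : (fun=> 0 : R) = (fun y => \sum_(i < 0) f i y).
    by apply/funext => y; rewrite big_ord0.
  exact: cont_cst.
have <- : (fun y => \sum_(i < n) f (widen_ord (leqnSn n) i) y + f ord_max y) =
    (fun y => \sum_(i < n.+1) f i y).
  by apply/funext => y; rewrite big_ord_recr.
by apply: contD => //; exact: IH.
Qed.

Lemma contZ (V : normedModType R) f (g : T -> V) x :
  {for x, continuous f} -> {for x, continuous g} ->
  {for x, continuous (fun y => f y *: g y)}.
Proof. by move=> cf cg; exact: cvgZ. Qed.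

Lemma contDv (V : normedModType R) (f g : T -> V) x :
  {for x, continuous f} -> {for x, continuous g} ->
  {for x, continuous (fun y => f y + g y)}.
Proof. by move=> cf cg; exact: cvgD. Qed.

Lemma cont_compT (U : topologicalType) (g : U -> R) (f : T -> U) x :
  {for x, continuous f} -> {for f x, continuous g} ->
  {for x, continuous (fun y => g (f y))}.
Proof. exact: continuous_comp. Qed.

Lemma cont_id (x : T) : {for x, continuous (fun y : T => y)}.
Proof. exact: cvg_id. Qed.

End ContinuityRules.

Section NearComparison.
Context {R : realType}.

Lemma near_lt (T : topologicalType) (f : T -> R) (x : T) (c : R) :
  {for x, continuous f} -> f x < c -> \forall y \near x, f y < c.
Proof. by move=> + fx; move=> /cvgr_lt /(_ c fx). Qed.

Lemma near_gt (T : topologicalType) (f : T -> R) (x : T) (c : R) :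
  {for x, continuous f} -> c < f x -> \forall y \near x, c < f y.
Proof. by move=> + fx; move=> /cvgr_gt /(_ c fx). Qed.

Lemma cont_eps (T : topologicalType) (f : T -> R) (x : T) :
  (forall e : R, 0 < e -> \forall y \near x, `|f x - f y| <= e) ->
  {for x, continuous f}.
Proof. by move=> h; apply/cvgrPdist_le => e /h. Qed.

Lemma eps_cont (T : topologicalType) (f : T -> R) (x : T) : {for x, continuous f} ->
  forall e : R, 0 < e -> \forall y \near x, `|f x - f y| <= e.
Proof. by move=> cf e e0; have /cvgrPdist_le/(_ e e0) := cf. Qed.

End NearComparison.

Ltac cont_step := lazymatch goal with
  | |- prop_for _ (inPhantom (continuous (fun y => y))) => notypeclasses refine (cont_id _)
  | |- prop_for _ (inPhantom (continuous (fun _ => ?c))) => notypeclasses refine (cont_cst c _)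
  | |- prop_for _ (inPhantom (continuous (fun y => sin (@?f y)))) =>
      notypeclasses refine (cont_sin f _ _)
  | |- prop_for _ (inPhantom (continuous (fun y => cos (@?f y)))) =>
      notypeclasses refine (cont_cos f _ _)
  | |- prop_for _ (inPhantom (continuous (fun y => expR (@?f y)))) =>
      notypeclasses refine (cont_expR f _ _)
  | |- prop_for _ (inPhantom (continuous (fun y => Num.max (@?f y) (@?g y)))) =>
      notypeclasses refine (cont_max f g _ _ _)
  | |- prop_for _ (inPhantom (continuous (fun y => Num.min (@?f y) (@?g y)))) =>
      notypeclasses refine (cont_min f g _ _ _)
  | |- prop_for _ (inPhantom (continuous (fun y => `|@?f y|))) =>
      notypeclasses refine (cont_abs f _ _)
  | |- prop_for _ (inPhantom (continuous (fun y => @?f y + @?g y))) =>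
      notypeclasses refine (contD f g _ _ _)
  | |- prop_for _ (inPhantom (continuous (fun y => - @?f y))) =>
      notypeclasses refine (contN f _ _)
  | |- prop_for _ (inPhantom (continuous (fun y => @?f y * @?g y))) =>
      notypeclasses refine (contM f g _ _ _)
  | |- prop_for _ (inPhantom (continuous (fun y => @?f y ^+ ?n))) =>
      notypeclasses refine (contX f n _ _)
  | |- prop_for _ (inPhantom (continuous (fun y => (@?f y)^-1))) =>
      notypeclasses refine (contV f _ _ _)
  end.
Ltac cont :=
  try lazymatch goal with
  | |- continuous_at ?x ?f => change {for x, continuous f}
  end;
  repeat cont_step; try assumption.

(** * The Pohozaev functional *)

Section Pohozaev.
Context {R : realType}.

Definition s1 (w r : R) := sin (w * r) / w.
Definition s1' (w r : R) := cos (w * r).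
Definition s2 (w beta r : R) := cos (w * r) + beta * (sin (w * r) / w).
Definition s2' (w beta r : R) := beta * cos (w * r) - w * sin (w * r).
Definition Krad (K0 eta r : R) := K0 - eta * (r + r ^+ 2).

(* With [v = r U], so that [U r + r * U1 r = v' r], these are the Wronskians of [v] with the
   solutions [s1], [s2] of [f'' + w^2 f = 0]. *)
Definition wronsk1 (w : R) (U U1 : R -> R) r := s1 w r * (U r + r * U1 r) - s1' w r * (r * U r).
Definition wronsk2 (w beta : R) (U U1 : R -> R) r :=
  s2 w beta r * (U r + r * U1 r) - s2' w beta r * (r * U r).

(* Pohozaev functional of the radial equation for the multiplier [2 s1 s2]; its derivative
   involves [U] only, not [U1]. *)
Definition energy (w beta K0 eta : R) (U U1 : R -> R) r :=
  wronsk1 w U U1 r * wronsk2 w beta U U1 r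
  + Krad K0 eta r * r ^+ 2 * s1 w r * s2 w beta r * U r ^+ 6 / 3.

(** With p = s1 s2 this is 4/3 K (r p' - p) + r K' p / 3. As p = r + beta r^2 + O(r^3), it behaves
    like (4 K0 beta - eta) r^2 / 3 at 0. *)
Definition defect (w beta K0 eta r : R) :=
  4 / 3 * Krad K0 eta r *
    (r * (s1' w r * s2 w beta r + s1 w r * s2' w beta r) - s1 w r * s2 w beta r)
  - eta * r * (1 + 2 * r) * (s1 w r * s2 w beta r) / 3.

Definition radial_solution (w K0 eta : R) (U U1 : R -> R) (a b : R) := forall r : R, a < r < b ->
  is_derive r 1 U (U1 r) /\
  is_derive r 1 U1 (- 2 * U1 r / r - (Krad K0 eta r * U r ^+ 5 + w ^+ 2 * U r)).

Lemma der_s1 (w r : R) : w != 0 -> is_derive r 1 (s1 w) (s1' w r).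
Proof. by move=> w0; rewrite /s1 /s1'; der; field. Qed.

Lemma der_s1' (w r : R) : w != 0 -> is_derive r 1 (s1' w) (- w ^+ 2 * s1 w r).
Proof. by move=> w0; rewrite /s1 /s1'; der; field. Qed.

Lemma der_s2 (w beta r : R) : w != 0 -> is_derive r 1 (s2 w beta) (s2' w beta r).
Proof. by move=> w0; rewrite /s2 /s2'; der; field. Qed.

Lemma der_s2' (w beta r : R) : w != 0 ->
  is_derive r 1 (s2' w beta) (- w ^+ 2 * s2 w beta r).
Proof. by move=> w0; rewrite /s2 /s2'; der; field. Qed.

Lemma der_Krad (K0 eta r : R) :
  is_derive r 1 (Krad K0 eta) (- eta * (1 + 2 * r)).
Proof. by rewrite /Krad; der; rewrite /=; ring. Qed.

Section Derivatives.
Context (w beta K0 eta : R) (U U1 : R -> R) (a b r : R).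
Context (w0 : w != 0) (r0 : r != 0) (rab : a < r < b).
Context (sol : radial_solution w K0 eta U U1 a b).

Lemma der_wronsk1 : is_derive r 1 (wronsk1 w U U1)
  (- r * s1 w r * Krad K0 eta r * U r ^+ 5).
Proof.
have [dU dU1] := sol _ rab; have d1 := der_s1 _ r w0; have d2 := der_s1' _ r w0.
by rewrite /wronsk1; der; field.
Qed.

Lemma der_wronsk2 : is_derive r 1 (wronsk2 w beta U U1)
  (- r * s2 w beta r * Krad K0 eta r * U r ^+ 5).
Proof.
have [dU dU1] := sol _ rab.
have d1 := der_s2 _ beta r w0; have d2 := der_s2' _ beta r w0.
by rewrite /wronsk2; der; field.
Qed.

(** The derivative of W1 W2 is - r K U^5 (s1 W2 + s2 W1), whose part in [U1] is - 2 K r^2 s1 s2 U^5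
    U1. The derivative of U^6 / 3 cancels it, which fixes the factor 1/3. *)
Lemma der_energy : is_derive r 1 (energy w beta K0 eta U U1)
  (r * U r ^+ 6 * defect w beta K0 eta r).
Proof.
have [dU dU1] := sol _ rab.
have d1 := der_s1 _ r w0; have d2 := der_s2 _ beta r w0.
have d3 := der_wronsk1; have d4 := der_wronsk2; have d5 := der_Krad K0 eta r.
rewrite /energy /defect; der.
by rewrite /wronsk1 /wronsk2 /=; field.
Qed.

End Derivatives.
End Pohozaev.

Section RadialNonexistence.
Context {R : realType}.

Lemma s1_gt0 (w r : R) : 0 < w -> w < pi -> 0 < r <= 1 -> 0 < s1 w r.
Proof.
move=> w0 wpi /andP[r0 r1]; rewrite divr_gt0// sin_gt0_pi// mulr_gt0//=.
by rewrite (le_lt_trans _ wpi)// ler_piMr// ltW.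
Qed.

Lemma s1_tangent (w r : R) : 0 < w -> w < pi -> 0 < r <= 1 ->
  r * s1' w r <= s1 w r.
Proof.
move=> w0 wpi /andP[r0 r1]; have wn0 := lt0r_neq0 w0.
rewrite -subr_ge0; pose f x := s1 w x - x * s1' w x.
have df (x : R) : is_derive x 1 f (w ^+ 2 * x * s1 w x).
  have d1 := der_s1 _ x wn0; have d2 := der_s1' _ x wn0.
  by rewrite /f; der; ring.
have -> : 0 = f 0 by rewrite /f /s1 mulr0 sin0 !mul0r subr0.
apply: (deriv_ge0_le f (fun x => w ^+ 2 * x * s1 w x)) => //; first exact: ltW.
- by move=> x _; exact: der_continuous (df x).
- move=> x /andP[x0 xr]; have sx : 0 < s1 w x by apply: s1_gt0 => //; rewrite x0 (le_trans (ltW xr)).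
  by rewrite mulr_ge0 ?(ltW sx)// mulr_ge0 ?sqr_ge0// ltW.
Qed.

Lemma cont_s1 (w r : R) : w != 0 -> {for r, continuous (s1 w)}.
Proof. by move=> w0; apply: der_continuous (der_s1 _ _ w0). Qed.

Lemma cont_s1' (w r : R) : w != 0 -> {for r, continuous (s1' w)}.
Proof. by move=> w0; apply: der_continuous (der_s1' _ _ w0). Qed.

Lemma cont_s2 (w beta r : R) : w != 0 -> {for r, continuous (s2 w beta)}.
Proof. by move=> w0; apply: der_continuous (der_s2 _ _ _ w0). Qed.

Lemma cont_s2' (w beta r : R) : w != 0 -> {for r, continuous (s2' w beta)}.
Proof. by move=> w0; apply: der_continuous (der_s2' _ _ _ w0). Qed.

(** [U1] enters the Wronskians only through [s * U1 s]. Asking for the continuity of this product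
    lets the lemma apply at 0 to the shooting solutions, for which [cont_rvol1] provides it. *)
Lemma cont_wronsk1 (w : R) (U U1 : R -> R) (r : R) : w != 0 ->
  {for r, continuous U} -> {for r, continuous (fun s : R => s * U1 s)} ->
  {for r, continuous (wronsk1 w U U1)}.
Proof.
move=> w0 cU cU1; have c1 := cont_s1 _ r w0; have c2 := cont_s1' _ r w0.
have cV := contD U _ r cU cU1.
by rewrite /wronsk1; apply: contD; [exact: contM|cont].
Qed.

Lemma cont_energy (w beta K0 eta : R) (U U1 : R -> R) (r : R) : w != 0 ->
  {for r, continuous U} -> {for r, continuous (fun s : R => s * U1 s)} ->
  {for r, continuous (energy w beta K0 eta U U1)}.
Proof.
move=> w0 cU cU1; rewrite /energy /wronsk2 /Krad.
have c1 := cont_s1 _ r w0; have cW := cont_wronsk1 w U U1 r w0 cU cU1.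
have c3 := cont_s2 _ beta r w0; have c4 := cont_s2' _ beta r w0.
have cV := contD U _ r cU cU1.
apply: contD; first apply: contM; [exact: cW| |by cont].
by apply: contD; [exact: contM|cont].
Qed.

Lemma no_radial_solution (w K0 eta : R) (U U1 : R -> R) :
  0 < w -> w < pi -> 0 < K0 -> 0 <= eta -> 2 * eta <= K0 ->
  4 * K0 * (- (w * cos w / sin w)) <= eta ->
  (forall r, {for r, continuous U}) -> (forall r, {for r, continuous U1}) ->
  radial_solution w K0 eta U U1 0 1 ->
  (forall r, 0 < r < 1 -> 0 < U r) -> U 1 = 0 -> False.
Proof.
move=> w0 wpi K00 eta0 etaK; set beta := - _ => betaP cU cU1 sol Upos U10.
have wn0 := lt0r_neq0 w0.
have sw : 0 < sin w by rewrite sin_gt0_pi// w0.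
have E0 : energy w beta K0 eta U U1 0 = 0.
  by rewrite /energy /wronsk1 /s1 mulr0 sin0; ring.
have E1 : energy w beta K0 eta U U1 1 = 0.
  have s20 : s2 w beta 1 = 0.
    by rewrite /s2 /beta mulr1; field; rewrite wn0 gt_eqF.
  by rewrite /energy /wronsk2 U10 s20; ring.
suff : energy w beta K0 eta U U1 1 < energy w beta K0 eta U U1 0.
  by rewrite E0 E1 ltxx.
apply: (deriv_lt0_gt _ (fun r => r * U r ^+ 6 * defect w beta K0 eta r)) => //.
- by move=> r _; apply: cont_energy => //; cont; exact: cU1.
- move=> r r01; apply: (der_energy _ _ _ _ _ _ _ _ _ _ _ r01 sol) => //.
  by move: r01 => /andP[/lt0r_neq0].
move=> r r01; have /andP[r0 r1] := r01.
rewrite pmulr_rlt0 ?mulr_gt0 ?exprn_gt0 ?Upos//.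
have s1p : 0 < s1 w r by apply: s1_gt0 => //; rewrite r0 ltW.
have tan := s1_tangent w r w0 wpi (ltac:(by rewrite r0 ltW)).
have s2E : s2 w beta r = sin (w * (1 - r)) / sin w.
  rewrite /s2 /beta mulrBr mulr1 sinB; field.
  by rewrite wn0 gt_eqF.
have s2p : 0 < s2 w beta r.
  rewrite s2E divr_gt0// sin_gt0_pi// mulr_gt0 ?subr_gt0//=.
  by rewrite (lt_trans _ wpi)// gtr_pMr// gtrBl.
(* The logarithmic derivative of [s2] equals [beta] at 0 and is smaller afterwards. This strictness
   makes the energy strictly decreasing even in the borderline case 4 K0 beta = eta. *)
have slope : s2' w beta r < beta * s2 w beta r.
  rewrite -subr_gt0.
  have -> : beta * s2 w beta r - s2' w beta r = (beta ^+ 2 + w ^+ 2) * s1 w r.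
    by rewrite /s2 /s2' /s1; field.
  by rewrite mulr_gt0// ltr_wpDl ?sqr_ge0// exprn_gt0.
have Kp : 0 < Krad K0 eta r.
  rewrite /Krad; have : r ^+ 2 < 1 by rewrite expr_lt1// ltW.
  have [->|en0] := eqVneq eta 0; first by rewrite mul0r subr0.
  have : 0 < eta by rewrite lt_neqAle eq_sym en0.
  nra.
have KK : Krad K0 eta r <= K0.
  by rewrite /Krad gerBl mulr_ge0// addr_ge0 ?sqr_ge0// ltW.
(* For [beta <= 0] the left side is nonpositive; otherwise K is at most K0 and the hypothesis on
   [beta] applies. *)
have Kb : 4 * Krad K0 eta r * beta <= eta * (1 + 2 * r).
  have [b0|b0] := leP beta 0.
    by apply: (@le_trans _ _ 0); [nra|rewrite mulr_ge0//; lra].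
  by apply: (@le_trans _ _ eta); [nra|rewrite ler_peMr//; lra].
rewrite /defect.
have h1 : r * s1' w r * s2 w beta r <= s1 w r * s2 w beta r.
  by rewrite ler_wpM2r// ltW.
have h2 : r * s1 w r * s2' w beta r < r * s1 w r * (beta * s2 w beta r).
  by rewrite ltr_pM2l// mulr_gt0.
have h3 : r * (s1' w r * s2 w beta r + s1 w r * s2' w beta r) - s1 w r * s2 w beta r
    < r * s1 w r * (beta * s2 w beta r) by lra.
have h4 : 4 / 3 * Krad K0 eta r *
    (r * (s1' w r * s2 w beta r + s1 w r * s2' w beta r) - s1 w r * s2 w beta r) <
    4 / 3 * Krad K0 eta r * (r * s1 w r * (beta * s2 w beta r)).
  by rewrite ltr_pM2l// mulr_gt0.
have h5 : (4 * Krad K0 eta r * beta) * (r * s1 w r * s2 w beta r) <=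
    eta * (1 + 2 * r) * (r * s1 w r * s2 w beta r).
  by have q := mulr_gt0 (mulr_gt0 r0 s1p) s2p; rewrite ler_wpM2r// ltW.
rewrite subr_lt0; apply: (lt_le_trans h4); move: h5; lra.
Qed.

End RadialNonexistence.

(** * Euclidean space *)

Section Euclidean.
Context {R : realType}.
Notation V := 'rV[R]_3.
Implicit Types (x y a e : V) (t : R).

Definition dot x y : R := \sum_(i < 3) x ord0 i * y ord0 i.

Lemma dotC x y : dot x y = dot y x.
Proof. by apply: eq_bigr => i _; rewrite mulrC. Qed.

Lemma dotDl x y z : dot (x + y) z = dot x z + dot y z.
Proof. by rewrite -big_split; apply: eq_bigr => i _; rewrite mxE mulrDl. Qed.

Lemma dotZl t x y : dot (t *: x) y = t * dot x y.
Proof. by rewrite /dot big_distrr; apply: eq_bigr => i _; rewrite mxE -mulrA. Qed.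

Lemma dotDr x y z : dot x (y + z) = dot x y + dot x z.
Proof. by rewrite dotC dotDl !(dotC x). Qed.

Lemma dotZr t x y : dot x (t *: y) = t * dot x y.
Proof. by rewrite dotC dotZl dotC. Qed.

Lemma dotNl x y : dot (- x) y = - dot x y.
Proof. by rewrite -scaleN1r dotZl mulN1r. Qed.

Lemma dotNr x y : dot x (- y) = - dot x y.
Proof. by rewrite dotC dotNl dotC. Qed.

Lemma dot0l x : dot 0 x = 0.
Proof. by rewrite -[0 in LHS](scale0r 0) dotZl mul0r. Qed.

Lemma dot_ge0 x : 0 <= dot x x.
Proof. by apply: sumr_ge0 => i _; rewrite -expr2 sqr_ge0. Qed.

Definition dotE := (dotDl, dotDr, dotNl, dotNr, dotZl, dotZr, dot0l).

Lemma dotBB x y : dot (x - y) (x - y) = dot x x - 2 * dot x y + dot y y.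
Proof. by rewrite !dotE (dotC y x); ring. Qed.

Lemma dot_subC x y : dot (x - y) (x - y) = dot (y - x) (y - x).
Proof. by rewrite -opprB dotNl dotNr opprK. Qed.

Lemma dot_eq0 x : dot x x = 0 -> x = 0.
Proof.
move=> /eqP; rewrite psumr_eq0; last by move=> i _; rewrite -expr2 sqr_ge0.
move=> /allP x0; apply/rowP => i; rewrite mxE.
by have := x0 i (mem_index_enum _); rewrite /= mulf_eq0 orbb => /eqP.
Qed.

Lemma dot_ebase x (i : 'I_3) : dot x (ebase R i) = x ord0 i.
Proof.
rewrite /dot (bigD1 i)//= big1 ?addr0; last first.
  by move=> j ji; rewrite mxE (negbTE ji) andbF mulr0.
by rewrite mxE !eqxx mulr1.
Qed.

Lemma dot_ebase2 (i : 'I_3) : dot (ebase R i) (ebase R i) = 1.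
Proof. by rewrite dot_ebase mxE !eqxx. Qed.

Lemma enorm_sq x : enorm x ^+ 2 = dot x x.
Proof.
rewrite /enorm sqr_sqrtr; last by apply: sumr_ge0 => i _; rewrite sqr_ge0.
by apply: eq_bigr => i _; rewrite expr2.
Qed.

Lemma enormE x : enorm x = Num.sqrt (dot x x).
Proof. by rewrite -enorm_sq sqrtr_sqr ger0_norm// sqrtr_ge0. Qed.

Lemma enorm_ge0 x : 0 <= enorm x. Proof. exact: sqrtr_ge0. Qed.

Lemma uballE x : uball R x <-> dot x x < 1.
Proof. by rewrite -enorm_sq expr_lt1 ?enorm_ge0. Qed.

Lemma ucballE x : ucball R x <-> dot x x <= 1.
Proof. by rewrite -enorm_sq expr_le1 ?enorm_ge0. Qed.

Lemma usphereE x : usphere R x <-> dot x x = 1.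
Proof.
rewrite -enorm_sq; split; first by move=> /= ->; rewrite expr1n.
by move=> h; apply: (pexpIrn (n:=2)) => //; rewrite ?nnegrE ?enorm_ge0 ?expr1n.
Qed.

Lemma enormZ t x : enorm (t *: x) = `|t| * enorm x.
Proof.
by rewrite !enormE !dotE mulrA -expr2 sqrtrM ?sqr_ge0// sqrtr_sqr.
Qed.

Lemma cauchy_schwarz x y : dot x y ^+ 2 <= dot x x * dot y y.
Proof.
have [/dot_eq0 ->|y0] := eqVneq (dot y y) 0; first by rewrite dotC !dot0l expr0n mulr0.
have yy : 0 < dot y y by rewrite lt_neqAle eq_sym y0 dot_ge0.
have := dot_ge0 (dot y y *: x - dot x y *: y).
rewrite !dotE (dotC y x) => h.
have : 0 <= dot y y * (dot x x * dot y y - dot x y ^+ 2) by move: h; nra.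
by rewrite pmulr_rge0// subr_ge0.
Qed.

Lemma cont_coord (i : 'I_3) x : {for x, continuous (fun y : V => y ord0 i)}.
Proof. exact: coord_continuous. Qed.

Lemma cont_dot x y : {for x, continuous (fun z => dot z y)}.
Proof.
by apply: cont_sum => i; apply: contM; [exact: cont_coord|exact: cont_cst].
Qed.

Lemma cont_dot2 x : {for x, continuous (fun z => dot z z)}.
Proof. by apply: cont_sum => i; apply: contM; exact: cont_coord. Qed.

Lemma cont_enorm x : {for x, continuous (@enorm R)}.
Proof.
have -> : @enorm R = fun z => Num.sqrt (dot z z) by apply/funext => z; rewrite enormE.
apply: (cont_comp Num.sqrt); first exact: cont_dot2.
exact: sqrt_continuous.
Qed.

Lemma open_uball : open (uball R).
Proof.
have -> : uball R = (fun z => dot z z) @^-1` [set t : R | t < 1].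
  by apply/seteqP; split => x /=; rewrite uballE.
apply: open_comp; last exact: open_lt.
by move=> x _; exact: cont_dot2.
Qed.

Lemma abs_coord_le x (i : 'I_3) : `|x ord0 i| <= enorm x.
Proof.
rewrite -(@ler_pXn2r _ 2) ?nnegrE ?enorm_ge0// real_normK ?num_real// enorm_sq.
rewrite /dot (bigD1 i)//= expr2 lerDl.
by apply: sumr_ge0 => m _; rewrite -expr2 sqr_ge0.
Qed.

Lemma norm_le_enorm x : `|x| <= enorm x.
Proof.
rewrite [leLHS]/Num.Def.normr /= mx_normrE; apply: bigmax_le => [|[j k] _]; first exact: enorm_ge0.
by rewrite (ord1 j); exact: abs_coord_le.
Qed.

Lemma norm_ebase (i : 'I_3) : `|ebase R i| <= 1.
Proof.
rewrite [leLHS]/Num.Def.normr /= mx_normrE; apply: bigmax_le => // -[j k] _.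
by rewrite mxE; case: (_ && _); rewrite ?normr1 ?normr0.
Qed.

Lemma compact_ucball : compact (ucball R).
Proof.
apply: bounded_closed_compact.
  exists 1; split => // M M1 x x1; apply: le_trans (ltW M1).
  exact: le_trans (norm_le_enorm x) x1.
have -> : ucball R = (fun z => dot z z) @^-1` [set t : R | t <= 1].
  by apply/seteqP; split => x /=; rewrite ucballE.
apply: closed_comp; last exact: closed_le.
by move=> x _; exact: cont_dot2.
Qed.

(** The two difference quotients are the same function of [h]; this moves every directional
    derivative to a derivative on the real line and back. *)
Lemma is_derive_line (f : V -> R) x a t d :
  is_derive (x + t *: a) a f d <-> is_derive t 1 (fun s => f (x + s *: a)) d.
Proof.
have E : (fun h : R => h^-1 *: ((f \o shift (x + t *: a)) (h *: a) - f (x + t *: a))) =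
    (fun h : R => h^-1 *: (((fun s => f (x + s *: a)) \o shift t) (h *: 1)
       - f (x + t *: a))).
  apply/funext => h /=; congr (_ *: (f _ - _)).
  by rewrite [_%:A]mulr1 scalerDl addrCA.
split=> -[D1 D2]; apply: DeriveDef.
- by move: D1; rewrite /derivable E.
- by move: D2; rewrite /derive E.
- by move: D1; rewrite /derivable E.
- by move: D2; rewrite /derive E.
Qed.

End Euclidean.

Section DirectionalDerivative.
Context {R : realType}.
Notation V := 'rV[R]_3.

Definition C1_uball (f : V -> R) := forall i x, uball R x ->
  derivable f x (ebase R i) /\ {for x, continuous (partial i f)}.

(** The mean value theorem on one coordinate segment. The base point [y] may differ from [x] while
    the partial derivative is taken at [x], so that such steps can be chained. *)
Lemma partial_step (f : V -> R) (x : V) i (eps : R) : C1_uball f -> uball R x ->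
  0 < eps -> exists2 d, 0 < d & forall (y : V) (s : R), `|y - x| + `|s| < d ->
  `|f (y + s *: ebase R i) - f y - s * partial i f x| <= eps * `|s|.
Proof.
move=> cf ux e0.
have [dfx cfx] := cf i x ux.
have : nbhs x (uball R `&` [set z | `|partial i f x - partial i f z| < eps]).
  apply: filterI; first exact: (open_nbhs_nbhs (conj open_uball ux)).
  by have /cvgrPdist_lt/(_ eps e0) := cfx.
move=> /nbhs_ballP[d /= d0 dP]; exists d => // y s ysd.
have seg (t : R) : `|t| <= `|s| -> (uball R `&` [set z | `|partial i f x - partial i f z| < eps])
    (y + t *: ebase R i).
  move=> ts; apply: dP; rewrite -ball_normE /= distrC addrAC.
  apply: le_lt_trans (ler_normD _ _) _; apply: le_lt_trans ysd; rewrite lerD2l.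
  by rewrite normrZ (le_trans _ ts)// ler_piMr// norm_ebase.
pose h (t : R) := f (y + t *: ebase R i).
have dh (t : R) : `|t| <= `|s| -> is_derive t 1 h (partial i f (y + t *: ebase R i)).
  move=> /seg[ut _]; apply/is_derive_line.
  by have [+ _] := cf i _ ut => /derivableP.
have h0 : h 0 = f y by rewrite /h scale0r addr0.
have fin (c : R) : `|c| <= `|s| -> h s - h 0 = partial i f (y + c *: ebase R i) * s ->
    `|f (y + s *: ebase R i) - f y - s * partial i f x| <= eps * `|s|.
  move=> /seg[_ /= /ltW]; rewrite distrC => cx; rewrite h0 {1}/h => ->.
  by rewrite (mulrC s) -mulrBl normrM ler_wpM2r.
have [s0|s0|->] := ltgtP s 0; last first.
- by rewrite scale0r addr0 subrr mul0r subr0 normr0 mulr0.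
- have ch (t : R) : 0 <= t <= s -> {for t, continuous h}.
    by move=> /andP[t0 ts]; apply: der_continuous (dh t _); rewrite !ger0_norm// ltW.
  have dh' (t : R) : 0 < t < s -> is_derive t 1 h (partial i f (y + t *: ebase R i)).
    by move=> /andP[t0 ts]; apply: dh; rewrite !ger0_norm// ltW.
  have [c /andP[c0 cs] E] := mean_value _ _ _ _ s0 ch dh'.
  by apply: (fin c); [rewrite !ger0_norm// ltW|rewrite E subr0].
- have ch (t : R) : s <= t <= 0 -> {for t, continuous h}.
    by move=> /andP[t0 ts]; apply: der_continuous (dh t _); rewrite !ler0_norm ?lerN2// ltW.
  have dh' (t : R) : s < t < 0 -> is_derive t 1 h (partial i f (y + t *: ebase R i)).
    by move=> /andP[t0 ts]; apply: dh; rewrite !ler0_norm ?lerN2// ltW.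
  have [c /andP[c0 cs] E] := mean_value _ _ _ _ s0 ch dh'.
  apply: (fin c); first by rewrite !ler0_norm ?lerN2// ltW.
  by rewrite -opprB E sub0r mulrN opprK.
Qed.

Lemma row3_expand (a : V) : a = a ord0 0 *: ebase R 0 + a ord0 1 *: ebase R 1
  + a ord0 2 *: ebase R 2.
Proof.
apply/rowP => j; rewrite !mxE; case: j => -[|[|[|//]]] p /=;
  rewrite ?mulr1 ?mulr0 ?addr0 ?add0r //; congr (a _ _); exact: val_inj.
Qed.

Lemma sum3E (F : 'I_3 -> R) : \sum_(i < 3) F i = F 0 + F 1 + F 2.
Proof.
rewrite !big_ord_recl big_ord0 addr0 addrA.
by congr (_ + F _ + F _); exact: val_inj.
Qed.

(** Continuity of the partial derivatives lets the increment along [a] be split into three steps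
    along the axes, through [y1] and [y2], each estimated by [partial_step]. *)
Lemma is_derive_dir (f : V -> R) (x a : V) : C1_uball f -> uball R x ->
  is_derive x a f (\sum_(i < 3) a ord0 i * partial i f x).
Proof.
move=> cf ux.
suff h : (fun h : R => h^-1 *: ((f \o shift x) (h *: a) - f x)) @ 0^'
    --> \sum_(i < 3) a ord0 i * partial i f x.
  by apply: DeriveDef; [apply/cvg_ex; eexists; exact: h|exact: cvg_lim h].
apply/cvgrPdist_le => eps e0.
(* [A] exceeds the sum of the moduli of the coordinates: it shares [eps] among the three errors, and
   [|h| A < d] keeps all intermediate points in range. *)
pose A := 1 + `|a ord0 0| + `|a ord0 1| + `|a ord0 2|.
have A1 : 1 <= A by rewrite /A -!addrA lerDl !addr_ge0.
have A0 : 0 < A by apply: lt_le_trans A1.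
have eA : 0 < eps / A by rewrite divr_gt0.
have [d0 d00 P0] := partial_step f x 0 _ cf ux eA.
have [d1 d10 P1] := partial_step f x 1 _ cf ux eA.
have [d2 d20 P2] := partial_step f x 2 _ cf ux eA.
pose d := Num.min d0 (Num.min d1 d2).
have dpos : 0 < d by rewrite !lt_min d00 d10 d20.
near=> h.
have hn0 : h != 0 by near: h; exact: nbhs_dnbhs_neq.
have hd : `|h| * A < d.
  rewrite -ltr_pdivlMr//; near: h.
  by apply: dnbhs0_lt; rewrite divr_gt0.
pose y1 := x + (h * a ord0 0) *: ebase R 0.
pose y2 := y1 + (h * a ord0 1) *: ebase R 1.
have E3 : h *: a + x = y2 + (h * a ord0 2) *: ebase R 2.
  by rewrite [in LHS](row3_expand a) /y2 /y1 !scalerDr !scalerA addrC !addrA.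
have nz t i : `|(h * t) *: ebase R i| <= `|h| * `|t|.
  by rewrite normrZ normrM ler_piMr ?mulr_ge0// norm_ebase.
have {}P0 := P0 x (h * a ord0 0).
have {}P1 := P1 y1 (h * a ord0 1).
have {}P2 := P2 y2 (h * a ord0 2).
have hh := normr_ge0 h.
have dist1 : `|y1 - x| <= `|h| * `|a ord0 0| by rewrite /y1 addrAC subrr add0r nz.
have dist2 : `|y2 - x| <= `|h| * `|a ord0 0| + `|h| * `|a ord0 1|.
  rewrite /y2 addrAC; apply: le_trans (ler_normD _ _) _.
  by rewrite lerD// nz.
move: hd; rewrite /A !mulrDr mulr1 => hd.
have ha0 : 0 <= `|h| * `|a ord0 0| by rewrite mulr_ge0.
have ha1 : 0 <= `|h| * `|a ord0 1| by rewrite mulr_ge0.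
have ha2 : 0 <= `|h| * `|a ord0 2| by rewrite mulr_ge0.
have {}P0 := P0 (ltac:(apply: (lt_le_trans _ (_ : d <= d0)); [
  rewrite subrr normr0 normrM; move: hh hd ha0 ha1 ha2; clear; lra|by rewrite ge_min lexx])).
have {}P1 := P1 (ltac:(apply: (lt_le_trans _ (_ : d <= d1)); [
  rewrite normrM; move: hh hd ha0 ha1 ha2 dist1; clear; lra|by rewrite !ge_min lexx orbT])).
have {}P2 := P2 (ltac:(apply: (lt_le_trans _ (_ : d <= d2)); [
  rewrite normrM; move: hh hd ha0 ha1 ha2 dist2; clear; lra|by rewrite !ge_min lexx !orbT])).
rewrite /= E3.
have -> : \sum_(i < 3) a ord0 i * partial i f x =
    a ord0 0 * partial 0 f x + a ord0 1 * partial 1 f x + a ord0 2 * partial 2 f x.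
  exact: sum3E.
have hpos : 0 < `|h| by rewrite normr_gt0.
rewrite -(ler_pM2l hpos).
have -> : `|h| * `|a ord0 0 * partial 0 f x + a ord0 1 * partial 1 f x
    + a ord0 2 * partial 2 f x
    - h^-1 *: (f (y2 + (h * a ord0 2) *: ebase R 2) - f x)| =
  `|(f (y2 + (h * a ord0 2) *: ebase R 2) - f y2 - h * a ord0 2 * partial 2 f x)
   + (f y2 - f y1 - h * a ord0 1 * partial 1 f x)
   + (f y1 - f x - h * a ord0 0 * partial 0 f x)|.
  have scE (r t : R) : r *: t = r * t by [].
  rewrite scE -normrM -normrN; congr `| _ |.
  move: hn0 (f (y2 + _)) (f y2) (f y1) (f x) (partial 0 f x) (partial 1 f x) (partial 2 f x).
  by clear => hn0 u3 u2 u1 u0 q0 q1 q2; field.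
apply: le_trans (ler_normD _ _) _.
apply: le_trans (lerD (le_trans (ler_normD _ _) (lerD P2 P1)) P0) _.
rewrite !normrM -!mulrDr.
have -> : eps / A * (`|h| * (`|a ord0 2| + `|a ord0 1| + `|a ord0 0|)) =
  `|h| * eps * ((`|a ord0 2| + `|a ord0 1| + `|a ord0 0|) / A) by field; rewrite gt_eqF.
rewrite ler_piMr ?mulr_ge0 ?(ltW e0)// ler_pdivrMr// mul1r /A; clear; lra.
Unshelve. all: by end_near. Qed.

End DirectionalDerivative.

Section LaplacianAtPoint.
Context {R : realType}.
Notation V := 'rV[R]_3.

(** A Laplacian at a single point, asking only for second derivatives along the three coordinate
    lines through it. This is all that the test at a minimum uses, and it adds up freely over
    solutions, reflected solutions and barriers. *)
Definition lap_at (F : V -> R) (x : V) (L : R) :=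
  exists2 d : 'I_3 -> R, \sum_(i < 3) d i = L &
  forall i, exists2 g : R -> R,
    (exists2 e : R, 0 < e & forall t : R, `|t| < e ->
      is_derive t 1 (fun s => F (x + s *: ebase R i)) (g t)) &
    is_derive (0 : R) 1 g (d i).

Lemma lap_atD F G x L M : lap_at F x L -> lap_at G x M ->
  lap_at (fun y => F y + G y) x (L + M).
Proof.
move=> [d <- dP] [d' <- dP']; exists (fun i => d i + d' i); first exact: big_split.
move=> i; have [g [e e0 eP] g2] := dP i; have [g' [e' e'0 eP'] g2'] := dP' i.
exists (fun t => g t + g' t); last exact: derD.
exists (Num.min e e'); first by rewrite lt_min e0.
by move=> t; rewrite lt_min => /andP[te te']; apply: derD; [exact: eP|exact: eP'].
Qed.

Lemma lap_atZ F c x L : lap_at F x L -> lap_at (fun y => c * F y) x (c * L).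
Proof.
move=> [d <- dP]; exists (fun i => c * d i); first by rewrite big_distrr.
move=> i; have [g [e e0 eP] g2] := dP i.
exists (fun t => c * g t); last by der; rewrite mulr0 addr0.
by exists e => // t te; have dF := eP t te; der; rewrite mulr0 addr0.
Qed.

Lemma lap_at_cst c x : lap_at (fun=> c) x 0.
Proof.
exists (fun=> 0); first by rewrite big1.
move=> i; exists (fun=> 0); last exact: der_cst.
by exists 1 => // t _; exact: der_cst.
Qed.

Lemma nbhs_line (P : set V) (x a : V) : nbhs x P ->
  exists2 e : R, 0 < e & forall t : R, `|t| < e -> P (x + t *: a).
Proof.
move=> /nbhs_ballP[d /= d0 dP]; have a1 : 0 < 1 + `|a| by rewrite ltr_wpDr.
exists (d / (1 + `|a|)); first by rewrite divr_gt0.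
move=> t; rewrite ltr_pdivlMr// => td; apply: dP.
rewrite -ball_normE /= opprD addrA subrr sub0r normrN normrZ.
by apply: le_lt_trans td; rewrite ler_wpM2l// lerDr.
Qed.

Lemma lap_at_min F x L : lap_at F x L -> (\forall y \near x, F x <= F y) -> 0 <= L.
Proof.
move=> [d <- dP] Fmin; apply: sumr_ge0 => i _.
have [g [e e0 eP] g2] := dP i.
have [e' e'0 eP'] := nbhs_line _ x (ebase R i) Fmin.
apply: (second_derivative_min (fun s => F (x + s *: ebase R i)) g (d i) (Num.min e e')).
- by rewrite lt_min e0.
- by move=> t; rewrite lt_min => /andP[te _]; exact: eP.
- by move=> t; rewrite lt_min scale0r addr0 => /andP[_ te]; exact: eP'.
Qed.

(** The Laplacian of exp(phi) is exp(phi) (|grad phi|^2 + Lap phi), with grad phi = [v] and Lap phi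
    = 6 al. Gaussians around [q] and exponentials in the direction [e] are treated together because
    the barriers below are made of both. *)
Lemma lap_at_exp (al be c : R) (q e x : V) :
  let v := (2 * al) *: (x - q) + be *: e in
  lap_at (fun y => expR (al * dot (y - q) (y - q) + be * dot y e + c)) x
   (expR (al * dot (x - q) (x - q) + be * dot x e + c) * (dot v v + 6 * al)).
Proof.
move=> v; set E := expR _.
exists (fun i => E * (v ord0 i ^+ 2 + 2 * al)).
  rewrite -big_distrr /= big_split /= sumr_const cardT size_enum_ord.
  by congr (_ * (_ + _)); rewrite -mulr_natr; ring.
move=> i; pose a t := al * dot (x - q) (x - q) + be * dot x e + c + t * v ord0 i + al * t ^+ 2.
have aE : (fun s => expR (al * dot (x + s *: ebase R i - q) (x + s *: ebase R i - q) +
    be * dot (x + s *: ebase R i) e + c)) = fun s : R => expR (a s).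
  apply/funext => s; congr expR; rewrite /a [x + _ - q]addrAC /v; move: (x - q) => z.
  have -> : dot (z + s *: ebase R i) (z + s *: ebase R i) =
      dot z z + 2 * s * z ord0 i + s ^+ 2.
    rewrite !dotE !(dotC (ebase R i)) dot_ebase2 !dot_ebase. ring.
  rewrite !dotE (dotC (ebase R i)) dot_ebase 2!mxE [in RHS]mxE; ring.
exists (fun t : R => expR (a t) * (v ord0 i + 2 * al * t)).
  exists 1 => // t _; rewrite aE /a; der; rewrite /=; ring.
rewrite /a; der; rewrite /E !mul0r expr0n /= mulr0 !addr0.
ring.
Qed.

End LaplacianAtPoint.

Section Reflection.
Context {R : realType}.
Notation V := 'rV[R]_3.

Definition C2_uball (u : V -> R) := C1_uball u /\ forall i, C1_uball (partial i u).

Lemma extends_continuous (f : V -> R) x :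
  extends_to_ucball f -> uball R x -> {for x, continuous f}.
Proof.
move=> [h ch hf] ux.
have nx : \forall y \near x, uball R y.
  exact: (open_nbhs_nbhs (conj open_uball ux)).
have ucx : ucball R x by apply/ucballE/ltW/uballE.
move/subspace_continuousP : ch => /(_ x ucx) ch.
rewrite /prop_for /continuous_at -(hf x ux) => A /ch nA.
have {}nA : \forall y \near x, ucball R y -> A (h y) by exact: nA.
suff : \forall y \near x, A (f y) by [].
apply: filterS2 nx nA => y uy /= hA; rewrite -(hf y uy); apply: hA.
by apply/ucballE/ltW/uballE.
Qed.

Lemma C2_ucball_uball (u : V -> R) : C2_ucball u -> C2_uball u.
Proof.
move=> [_ d1 d2 e1 e2]; split=> [i x ux|i j x ux]; split.
- exact: d1.
- exact: extends_continuous.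
- exact: d2.
- exact: extends_continuous.
Qed.

(** The last hypothesis is the orthogonality of the matrix [b], in the form that contracts the
    Hessian of [u] to its trace. *)
Lemma lap_at_isometry (u : V -> R) (s : V -> V) (b : 'I_3 -> V) (x : V) :
  C2_uball u -> uball R (s x) ->
  (forall i (t : R), s (x + t *: ebase R i) = s x + t *: b i) ->
  (forall j k, \sum_(i < 3) b i ord0 j * b i ord0 k = (j == k)%:R) ->
  lap_at (fun y => u (s y)) x (laplacian u (s x)).
Proof.
move=> [c1 c2] usx sl bo.
exists (fun i => \sum_(j < 3) b i ord0 j * \sum_(k < 3) b i ord0 k * partial k (partial j u) (s x)).
  rewrite exchange_big /=; apply: eq_bigr => j _.
  under eq_bigr do rewrite big_distrr /=.
  rewrite exchange_big /=.
  under eq_bigr => k _.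
    under eq_bigr do rewrite mulrA.
    rewrite -big_distrl /= bo; over.
  rewrite (bigD1 j)//= eqxx mul1r big1 ?addr0// => k kj.
  by rewrite eq_sym (negbTE kj) mul0r.
move=> i; exists (fun t : R => \sum_(j < 3) b i ord0 j * partial j u (s x + t *: b i)).
  have [e e0 eP] := nbhs_line _ (s x) (b i) (open_nbhs_nbhs (conj open_uball usx)).
  exists e => // t te; have -> : (fun s0 => u (s (x + s0 *: ebase R i))) =
     fun s0 => u (s x + s0 *: b i) by apply/funext => s0; rewrite sl.
  by apply/is_derive_line; apply: is_derive_dir => //; exact: eP.
have D j : is_derive (0 : R) 1 (fun t => b i ord0 j * partial j u (s x + t *: b i))
    (b i ord0 j * \sum_(k < 3) b i ord0 k * partial k (partial j u) (s x)).
  have E : s x + (0 : R) *: b i = s x by rewrite scale0r addr0.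
  have usx' : uball R (s x + (0 : R) *: b i) by rewrite E.
  have /is_derive_line dj := is_derive_dir (partial j u) _ (b i) (c2 j) usx'.
  by der; rewrite mulr0 addr0 E.
have <- : \sum_(j < 3) (fun t : R => b i ord0 j * partial j u (s x + t *: b i)) =
  (fun t : R => \sum_(j < 3) b i ord0 j * partial j u (s x + t *: b i)).
  by apply/funext => t; rewrite fct_sumE.
exact: is_derive_sum.
Qed.

Lemma lap_at_self (u : V -> R) (x : V) :
  C2_uball u -> uball R x -> lap_at u x (laplacian u x).
Proof.
move=> cu ux; apply: (lap_at_isometry u id (ebase R)) => // j k.
under eq_bigr do rewrite [ebase R _ _ j]mxE [ebase R _ _ k]mxE /=.
rewrite (bigD1 j)//= eqxx mul1r big1 ?addr0; first by rewrite eq_sym.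
by move=> i ij; rewrite eq_sym (negbTE ij) mul0r.
Qed.

(** For a unit vector [e], the reflection in the plane of equation [dot x e = l]. *)
Definition refl (e : V) (l : R) (x : V) : V := x + (2 * (l - dot x e)) *: e.

Lemma lap_at_refl (u : V -> R) (e : V) (l : R) (x : V) : dot e e = 1 ->
  C2_uball u -> uball R (refl e l x) ->
  lap_at (fun y => u (refl e l y)) x (laplacian u (refl e l x)).
Proof.
move=> e1 cu usx.
pose b i : V := ebase R i - (2 * dot (ebase R i) e) *: e.
apply: (lap_at_isometry u (refl e l) b) => //.
  move=> i t; rewrite /refl /b !dotE; apply/rowP => j; rewrite !mxE; ring.
move=> j k.
have bs (i m : 'I_3) : b i ord0 m = b m ord0 i.
  rewrite /b !mxE !(dotC _ e) !dot_ebase (eq_sym m i) /=; ring.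
transitivity (dot (b j) (b k)).
  by apply: eq_bigr => i _; rewrite (bs i j) (bs i k).
rewrite /b !dotE e1 !(dotC e) dot_ebase mxE eqxx /=.
rewrite eq_sym; ring.
Qed.

(** For 0 < l < x.e the image is strictly closer to the origin: reflected caps stay in the ball, and
    the coefficient K, which decreases with |x|, is not smaller there. *)
Lemma refl_dot e l x : dot e e = 1 ->
  dot (refl e l x) (refl e l x) = dot x x - 4 * l * (dot x e - l).
Proof. by move=> e1; rewrite /refl !dotE e1 (dotC e x); ring. Qed.

End Reflection.

(** * Moving planes *)

Section ContinuousExtension.
Context {R : realType}.
Notation V := 'rV[R]_3.

Lemma within_comp (T S : topologicalType) (U : topologicalType) (A : set T) (f : T -> U)
    (p : S -> T) : {within A, continuous f} -> continuous p -> (forall y, A (p y)) ->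
  continuous (f \o p).
Proof.
move=> /subspace_continuousP cf cp Ap x W /(cf _ (Ap x)) nW.
have {}nW : \forall y \near p x, A y -> W (f y) by exact: nW.
suff : \forall y \near x, W (f (p y)) by [].
have {}nW : \forall y \near x, A (p y) -> W (f (p y)) by exact: (cp x _ nW).
by apply: filterS nW => y /(_ (Ap y)).
Qed.

(** The radial retraction onto the closed ball. Composing with it replaces a function continuous on
    the closed ball by one continuous on the whole space, so that compactness and limit arguments
    need no relative topology. *)
Definition ball_proj (x : V) : V := (Num.max 1 (enorm x))^-1 *: x.

Lemma ball_proj_in x : ucball R (ball_proj x).
Proof.
rewrite /ucball /= /ball_proj enormZ.
have m1 : 0 < Num.max 1 (enorm x) by rewrite lt_max ltr01.
rewrite gtr0_norm ?invr_gt0// mulrC ler_pdivrMr// mul1r.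
by rewrite le_max lexx orbT.
Qed.

Lemma ball_proj_id x : ucball R x -> ball_proj x = x.
Proof. by move=> x1; rewrite /ball_proj max_l// invr1 scale1r. Qed.

Lemma cont_ball_proj : continuous ball_proj.
Proof.
move=> x.
have c : {for x, continuous (fun z : V => (Num.max 1 (enorm z))^-1)}.
  apply: contV; first by rewrite gt_eqF// lt_max ltr01.
  by apply: cont_max; [exact: cont_cst|exact: cont_enorm].
by apply: (contZ _ _ _ _ c); exact: cont_id.
Qed.

Lemma extend_continuous (u : V -> R) : {within ucball R, continuous u} ->
  exists2 v : V -> R, continuous v & forall x, ucball R x -> v x = u x.
Proof.
move=> cu; exists (u \o ball_proj).
  exact: (within_comp _ _ _ _ _ _ cu cont_ball_proj ball_proj_in).
by move=> x /ball_proj_id /= ->.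
Qed.

Lemma compact_min (A : set V) (f : V -> R) : compact A -> A !=set0 -> continuous f ->
  exists2 c, A c & forall x, A x -> f c <= f x.
Proof.
move=> cA A0 cf.
have [c cin cmin] := compact_EVT_min A0 cA (continuous_subspaceT cf).
by exists c; [exact: set_mem|move=> x Ax; apply: cmin; exact: mem_set].
Qed.

Lemma compact_ball_closed (A : set V) : closed A -> compact (ucball R `&` A).
Proof.
by move=> cA; apply: compact_closedI => //; exact: compact_ucball.
Qed.

Lemma closed_le_cont (f : V -> R) (c : R) : continuous f -> closed [set x | f x <= c].
Proof. by move=> cf; apply: (@closed_comp _ _ f [set t | t <= c]) => // ; exact: closed_le. Qed.

Lemma cont_refl2 (e : V) (z : V * R) :
  {for z, continuous (fun z : V * R => refl e z.2 z.1)}.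
Proof.
have c2 : {for z, continuous (fun z : V * R => z.2)} by exact: cvg_snd.
have c1 : {for z, continuous (fun z : V * R => z.1)} by exact: cvg_fst.
have cd : {for z, continuous (fun z : V * R => 2 * (z.2 - dot z.1 e))}.
  by cont; apply: (cont_compT _ (fun y => dot y e) _ _ c1); exact: cont_dot.
have cr : {for z, continuous (fun z : V * R => (2 * (z.2 - dot z.1 e)) *: e)}.
  by apply: (contZ V _ (fun=> e) _ cd); exact: cst_continuous.
exact: (contDv V _ _ _ c1 cr).
Qed.

Lemma cont_refl_level (e x : V) (l : R) :
  {for l, continuous (fun t : R => refl e t x)}.
Proof.
have cd : {for l, continuous (fun t : R => 2 * (t - dot x e))} by cont.
have cr : {for l, continuous (fun t : R => (2 * (t - dot x e)) *: e)}.
  by apply: (contZ V _ (fun=> e) _ cd); exact: cst_continuous.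
exact: (contDv V (fun=> x) _ _ (@cst_continuous _ _ x l) cr).
Qed.

End ContinuousExtension.

Section MovingPlanes.
Context {R : realType} (mu K0 eta : R) (K : 'rV[R]_3 -> R) (u v : 'rV[R]_3 -> R).
Context (mu0 : 0 < mu) (K00 : 0 < K0) (eta0 : 0 <= eta).
Context (KE : forall x, uball R x -> K x = K0 - eta * (enorm x + enorm x ^+ 2)).
Context (K_ge0 : forall x, uball R x -> 0 <= K x).
Context (cu : C2_uball u) (cv : continuous v) (vE : forall x, ucball R x -> v x = u x).
Context (eqn : forall x, uball R x -> - laplacian u x = K x * u x ^+ 5 + mu * u x).
Context (upos : forall x, uball R x -> 0 < u x).
Context (ubd : forall x, usphere R x -> u x = 0).
Notation V := 'rV[R]_3.

Let vball x : uball R x -> v x = u x.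
Proof. by move=> /uballE/ltW/ucballE; exact: vE. Qed.

Let v_ge0 x : ucball R x -> 0 <= v x.
Proof.
move=> ux; rewrite vE//; move: ux => /ucballE; rewrite le_eqVlt => /predU1P[x1|x1].
  by rewrite ubd//; exact/usphereE.
by apply/ltW/upos/uballE.
Qed.

Let v_sphere x : dot x x = 1 -> v x = 0.
Proof. by move=> x1; rewrite vE ?ubd//; [exact/usphereE|apply/ucballE; rewrite x1]. Qed.

Section Direction.
Context (e : V) (e1 : dot e e = 1).

Let w l x := v (refl e l x) - v x.

Let cont_refl l : continuous (refl e l).
Proof.
move=> x; apply: (contDv V (fun y => y) (fun y => (2 * (l - dot y e)) *: e)).
  exact: cont_id.
have c : {for x, continuous (fun z : V => 2 * (l - dot z e))}.
  by cont; exact: cont_dot.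
by apply: (contZ V _ (fun=> e) _ c); exact: cst_continuous.
Qed.

Let cont_w l : continuous (w l).
Proof.
move=> x; apply: (contD (fun y => v (refl e l y)) (fun y => - v y)).
  by apply: continuous_comp; [exact: cont_refl|exact: cv].
by apply: contN; exact: cv.
Qed.

Let refl_in l x : 0 < l -> uball R x -> l < dot x e -> uball R (refl e l x).
Proof.
move=> l0 /uballE x1 lx; apply/uballE; rewrite refl_dot//.
by apply: le_lt_trans x1; rewrite gerBl mulr_ge0// ?subr_ge0 ltW// mulr_gt0.
Qed.

Let refl_inc l x : 0 < l -> ucball R x -> l <= dot x e -> ucball R (refl e l x).
Proof.
move=> l0 /ucballE x1 lx; apply/ucballE; rewrite refl_dot//.
by apply: le_trans x1; rewrite gerBl mulr_ge0 ?subr_ge0// mulr_ge0// ltW.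
Qed.

Let K_refl l x : 0 < l -> uball R x -> l < dot x e -> K x <= K (refl e l x).
Proof.
move=> l0 ux lx; have ur := refl_in _ _ l0 ux lx.
rewrite !KE// lerD2l lerN2 ler_wpM2l//.
have h : enorm (refl e l x) <= enorm x.
  rewrite -(@ler_pXn2r _ 2) ?nnegrE ?enorm_ge0// !enorm_sq refl_dot//.
  by rewrite gerBl mulr_ge0 ?subr_ge0 ?(ltW lx)// mulr_ge0// ltW.
by apply: lerD => //; rewrite ler_pXn2r ?nnegrE ?enorm_ge0.
Qed.

Let lapw l x : 0 < l -> uball R x -> l < dot x e ->
  lap_at (fun y => u (refl e l y) - u y) x
    (K x * u x ^+ 5 + mu * u x
     - (K (refl e l x) * u (refl e l x) ^+ 5 + mu * u (refl e l x))).
Proof.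
move=> l0 ux lx; have ur := refl_in _ _ l0 ux lx.
rewrite -!eqn// opprK addrC -[- laplacian u x]mulN1r.
apply: lap_atD; first exact: lap_at_refl.
have -> : (fun y => - u y) = (fun y => -1 * u y) by apply/funext => y; rewrite mulN1r.
by apply: lap_atZ; exact: lap_at_self.
Qed.

(* Hopf's argument: [b] is strictly subharmonic enough on the lens [D] around [q = p + 3 e] for
   [w l - eps b] to have no negative minimum there, and [w l] is positive where [D] meets the
   sphere. *)
Let strong_max l : 0 < l ->
  (forall x, uball R x -> l < dot x e -> 0 <= w l x) ->
  forall p, uball R p -> l < dot p e -> 0 < w l p.
Proof.
move=> l0 w0 p up lp.
(* As q.e - r = (p.e + l) / 2 > l, the lens [D] lies strictly beyond the plane, and |p - q| = 3 < r
   puts [p] inside it. The offset 3 keeps the points of the unit ball at distance at least 2 from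
   [q], as needed for the sign of the Laplacian of [b]. *)
pose q : V := p + (3 : R) *: e; pose r := 3 + (dot p e - l) / 2.
have r0 : 0 < r by rewrite /r addr_gt0// divr_gt0// subr_gt0.
pose D := ucball R `&` [set x : V | dot (x - q) (x - q) <= r ^+ 2].
have cdq : continuous (fun x : V => dot (x - q) (x - q)).
  have -> : (fun x : V => dot (x - q) (x - q)) = (fun x => dot x x - 2 * dot x q + dot q q).
    by apply/funext => x; exact: dotBB.
  by move=> x; cont; first [exact: cont_dot2|exact: cont_dot].
have cD : compact D by apply: compact_ball_closed; exact: closed_le_cont.
have De x : D x -> l < dot x e.
  move=> [_ /= xq].
  have : dot (q - x) e <= r.
    have /le_trans h : dot (q - x) e ^+ 2 <= r ^+ 2.
      by apply: le_trans (cauchy_schwarz _ _) _; rewrite e1 mulr1 dot_subC.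
    rewrite leNgt; apply/negP => rd.
    have := h _ (lexx _); rewrite leNgt; apply/negP/negPn.
    by rewrite ltr_pXn2r ?nnegrE// ltW// (lt_trans r0).
  rewrite /q /r !dotE e1; have := lp; lra.
have [eps eps0 epsP] : exists2 eps : R, 0 < eps & forall x, D x -> dot x x = 1 ->
    eps <= w l x.
  pose D1 := ucball R `&` ([set x : V | dot (x - q) (x - q) <= r ^+ 2] `&`
     [set x : V | - dot x x <= -1]).
  have cD1 : compact D1.
    apply: compact_ball_closed; apply: closedI; apply: closed_le_cont => // x.
    by cont; exact: cont_dot2.
  have [D1e|/set0P D1n] := eqVneq D1 set0.
    exists 1 => // x [ux Dx] x1; suff : D1 x by rewrite D1e.
    by split=> //; split=> //=; rewrite x1.
  have [c [uc [c1 c2]] cmin] := compact_min _ _ cD1 D1n (cont_w l).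
  have c3 : dot c c = 1.
    by apply/eqP; rewrite eq_le; move/ucballE: (uc) => ->; rewrite -lerN2.
  have lc := De c (conj uc c1).
  exists (w l c); last first.
    by move=> x [ux Dx] x1; apply: cmin; split=> //; split=> //=; rewrite x1.
  have uc' : uball R (refl e l c).
    by apply/uballE; rewrite refl_dot// c3 gtrBl mulr_gt0 ?subr_gt0// mulr_gt0.
  by rewrite /w (v_sphere c)// subr0 vball ?upos.
(* A Gaussian lowered to vanish on the sphere |x - q| = r. Its Laplacian has the sign of 16 |x -
   q|^2 - 12, positive where |x - q| >= 2. *)
pose b (x : V) := expR (- 2 * dot (x - q) (x - q) + 0 * dot x e + 0) - expR (- 2 * r ^+ 2).
have b1 x : b x <= 1.
  rewrite /b mul0r !addr0; apply: (@le_trans _ _ (expR (- 2 * dot (x - q) (x - q)))).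
    by rewrite gerBl expR_ge0.
  by rewrite -expR0 ler_expR mulr_le0_ge0// ?dot_ge0; lra.
have cb : continuous b.
  by move=> x; rewrite /b; cont; first [exact: cdq|exact: cont_dot].
have pq : dot (p - q) (p - q) = 9.
  by rewrite /q dotBB !dotE e1 (dotC e p); ring.
have Dp : D p.
  split; first by apply/ucballE/ltW/uballE.
  rewrite /= pq /r; have := lp; nra.
pose f (x : V) := w l x - eps * b x.
have cf : continuous f.
  by move=> x; rewrite /f; cont; [exact: cont_w|exact: cb].
have [c Dc cmin] := compact_min _ _ cD (ex_intro _ p Dp) cf.
have bp : 0 < b p.
  rewrite /b mul0r !addr0 subr_gt0 ltr_expR pq /r; have := lp; nra.
suff : 0 <= f c.
  move=> fc; have := le_trans fc (cmin p Dp); rewrite subr_ge0; apply: lt_le_trans.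
  exact: mulr_gt0.
rewrite leNgt; apply/negP => fc0.
have lc := De c Dc; have [uc qc] := Dc.
have uc' : uball R c.
  apply/uballE; rewrite lt_neqAle; move/ucballE : (uc) => ->; rewrite andbT.
  apply/eqP => c1; move: fc0; rewrite ltNge => /negP; apply.
  rewrite subr_ge0; apply: le_trans (epsP c Dc c1).
  by rewrite ler_piMr ?b1// ltW.
have qc' : dot (c - q) (c - q) < r ^+ 2.
  rewrite lt_neqAle qc andbT; apply/eqP => cq.
  move: fc0; rewrite ltNge => /negP; apply.
  by rewrite /f /b cq mul0r !addr0 subrr mulr0 subr0 w0.
have wc := w0 c uc' lc.
have lap := lapw l c l0 uc' lc.
have lapb := lap_at_exp (- 2) 0 0 q e c.
have := lap_atD _ _ _ _ _ lap (lap_atZ _ (- eps) _ _ lapb).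
move=> /lap_at_min H.
have {H} : 0 <= K c * u c ^+ 5 + mu * u c - (K (refl e l c) * u (refl e l c) ^+ 5 + mu * u (refl e l c)) +
    - eps * (expR (-2 * dot (c - q) (c - q) + 0 * dot c e + 0) *
    (dot ((2 * -2) *: (c - q) + 0 *: e) ((2 * -2) *: (c - q) + 0 *: e) + 6 * -2)).
  apply: H.
  have n1 : \forall y \near c, dot y y < 1.
    by apply: near_lt; [exact: cont_dot2|exact/uballE].
  have n2 : \forall y \near c, dot (y - q) (y - q) < r ^+ 2.
    by apply: (near_lt _ (fun y : V => dot (y - q) (y - q))) => //; exact: cdq.
  apply: filterS2 n1 n2 => y y1 y2.
  have uy : ucball R y by apply/ucballE/ltW.
  have Dy : D y by split=> //=; exact: ltW.
  have uy' : uball R y by exact/uballE.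
  have ury : ucball R (refl e l y) by apply: refl_inc => //; exact/ltW/De.
  have urc : ucball R (refl e l c) by apply: refl_inc => //; exact: ltW.
  by have := cmin y Dy; rewrite /f /w /b !vE//; lra.
apply/negP; rewrite -ltNge.
(* At [c] neither [u] nor K is smaller at the reflected point, so the Laplacian of the difference is
   nonpositive, whereas that of [eps * b] is positive: the sum tested at the minimum is negative. *)
have uw : u c <= u (refl e l c) by move: wc; rewrite /w !vball// ?subr_ge0//; exact: refl_in.
have u0 := upos c uc'.
have ur0 : 0 < u (refl e l c) by apply/upos/refl_in.
have t1 : K c * u c ^+ 5 <= K (refl e l c) * u (refl e l c) ^+ 5.
  apply: ler_pM => //; [exact: K_ge0|by rewrite exprn_ge0// ltW|exact: K_refl|].
  by rewrite ler_pXn2r// nnegrE ltW.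
have t2 : mu * u c <= mu * u (refl e l c) by rewrite ler_pM2l.
have t3 : 4 <= dot (c - q) (c - q).
  have h1 : 2 <= dot (q - c) e.
    have : dot c e <= 1.
      rewrite leNgt; apply/negP => ce.
      have := cauchy_schwarz c e; rewrite e1 mulr1 leNgt => /negP; apply.
      apply: (@lt_trans _ _ 1); first exact/uballE.
      by rewrite -[ltLHS](expr1n _ 2) ltr_pXn2r ?nnegrE// ltW// (lt_trans _ ce).
    rewrite /q !dotE e1; have := lp; have := l0; lra.
  have := cauchy_schwarz (q - c) e; rewrite e1 mulr1.
  have -> : dot (q - c) (q - c) = dot (c - q) (c - q).
    exact: dot_subC.
  by move: h1; nra.
rewrite !mul0r !scale0r !addr0 dotZl dotZr.
have E0 := expR_gt0 (-2 * dot (c - q) (c - q)).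
have : 0 < eps * (expR (-2 * dot (c - q) (c - q)) *
   (2 * -2 * (2 * -2 * dot (c - q) (c - q)) + 6 * -2)).
  by rewrite mulr_gt0// mulr_gt0//; lra.
lra.
Qed.

Let v_bounded : exists2 M : R, 0 <= M & forall x, ucball R x -> v x <= M.
Proof.
have uc0 : ucball R (0 : V) by apply/ucballE; rewrite dot0l.
have cvN : continuous (fun x => - v x) by move=> x; cont; exact: cv.
have [c uc cmin] := compact_min _ _ (@compact_ucball R) (ex_intro _ _ uc0) cvN.
by exists (v c); [exact: v_ge0|move=> x /cmin; rewrite lerN2].
Qed.

(* Narrow domains: at a negative minimum of [w l / s], the barrier [s] is too superharmonic
   unless the point stays at distance [1/b] from both the plane and the sphere. *)
Let core_point : exists2 b : R, 1 <= b & forall l, 0 < l ->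
  (exists x, [/\ uball R x, l < dot x e & w l x < 0]) ->
  exists x, [/\ uball R x, l + b^-1 <= dot x e, dot x x <= 1 - b^-1 & w l x < 0].
Proof.
have [M M0 vM] := v_bounded.
(* A Lipschitz constant of t |-> K0 t^5 + mu t on [0, M]. *)
pose C := 5 * K0 * M ^+ 4 + mu.
have C0 : 0 < C by rewrite ltr_wpDl// mulr_ge0 ?exprn_ge0// mulr_ge0// ltW.
have e0 := expR_gt0 (- 1 : R).
(* The barrier [s] takes values in [1, 3], so the nonlinearity contributes at most 3 C times the
   multiplier [k] below. Within 1/b of the plane, or where |x|^2 > 1 - 1/b, one of [E1], [E2] is at
   least exp(-1), and b exp(-1) > 3 C then gives the contradiction. *)
pose b := 1 + 3 * C / expR (- 1).
have b1 : 1 <= b by rewrite /b lerDl divr_ge0 ?(ltW e0)// mulr_ge0// ltW.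
have b0 : 0 < b by apply: lt_le_trans b1.
have bC : 3 * C < b * expR (- 1).
  have -> : b * expR (- 1) = expR (- 1) + 3 * C by rewrite /b; field; rewrite gt_eqF.
  by rewrite ltrDr.
exists b => // l l0 [x0 [ux0 lx0 wx0]].
pose E1 (x : V) := expR (0 * dot (x - 0) (x - 0) + (- b) * dot x e + b * l).
pose E2 (x : V) := expR (b * dot (x - 0) (x - 0) + 0 * dot x e + - b).
pose s x := 3 + -1 * E1 x + -1 * E2 x.
pose cap := ucball R `&` [set x : V | - dot x e <= - l].
have cE1 : continuous E1.
  move=> x; rewrite /E1.
  have -> : (fun x : V => expR (0 * dot (x - 0) (x - 0) + (- b) * dot x e + b * l)) =
    (fun x => expR (- b * dot x e + b * l)) by apply/funext => y; rewrite mul0r add0r.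
  by cont; exact: cont_dot.
have cE2 : continuous E2.
  move=> x; rewrite /E2.
  have -> : (fun x : V => expR (b * dot (x - 0) (x - 0) + 0 * dot x e + - b)) =
    (fun x => expR (b * dot x x + - b)).
    by apply/funext => y; rewrite mul0r addr0 subr0.
  by cont; exact: cont_dot2.
have cs : continuous s by move=> x; rewrite /s; cont; [exact: cE1|exact: cE2].
have s1 x : cap x -> 1 <= s x <= 3.
  move=> [/ucballE x1 /=]; rewrite lerN2 => xl.
  have E1p : 0 < E1 x <= 1.
    by rewrite expR_gt0/= -expR0 ler_expR; nra.
  have E2p : 0 < E2 x <= 1.
    by rewrite expR_gt0/= -expR0 ler_expR subr0; nra.
  by rewrite /s; lra.
have ccap : compact cap.
  apply: compact_ball_closed; apply: closed_le_cont.
  by move=> x; cont; exact: cont_dot.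
have cx0 : cap x0.
  by split; [apply/ucballE/ltW/uballE|rewrite /= lerN2 ltW].
(* The maximum with 1 makes the quotient continuous everywhere; on the cap it is just [s]. *)
have cws : continuous (fun x => w l x / Num.max 1 (s x)).
  move=> x; cont; [exact: cont_w|by rewrite gt_eqF// lt_max ltr01|exact: cs].
have [c cc cmin] := compact_min _ _ ccap (ex_intro _ _ cx0) cws.
have maxs x : cap x -> Num.max 1 (s x) = s x by move=> /s1 /andP[? _]; rewrite max_r.
have sp x : cap x -> 0 < s x by move=> /s1 /andP[h _]; apply: lt_le_trans h.
have wc0 : w l c < 0.
  have := cmin x0 cx0; rewrite !maxs// => h.
  have : w l c / s c < 0 by apply: le_lt_trans h _; rewrite pmulr_llt0// invr_gt0 sp.
  by rewrite pmulr_llt0// invr_gt0 sp.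
have [uc lc'] := cc; move: lc'; rewrite /= lerN2 => lc'.
have lc : l < dot c e.
  rewrite lt_neqAle lc' andbT; apply/eqP => E.
  by move: wc0; rewrite /w /refl E subrr mulr0 scale0r addr0 subrr ltxx.
have uc' : uball R c.
  apply/uballE; rewrite lt_neqAle; move/ucballE : (uc) => ->; rewrite andbT.
  apply/eqP => c1; move: wc0; rewrite /w (v_sphere c)// subr0 ltNge => /negP; apply.
  by apply: v_ge0; exact: refl_inc.
(* Since - k is the minimum of [w l / s] on the cap, [w l + k s] is nonnegative there and vanishes
   at [c], an interior point: the Laplacian test applies to it. *)
pose k := - (w l c / s c).
have k0 : 0 < k by rewrite oppr_gt0 pmulr_llt0// invr_gt0 sp.
have kE : - w l c = k * s c by rewrite /k mulNr divfK// gt_eqF// sp.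
have lapE1 := lap_at_exp 0 (- b) (b * l) 0 e c.
have lapE2 := lap_at_exp b 0 (- b) 0 e c.
have lapF := lap_atD _ _ _ _ _ (lapw l c l0 uc' lc) (lap_atZ _ k _ _ (lap_atD _ _ _ _ _
  (lap_atD _ _ _ _ _ (lap_at_cst 3 c) (lap_atZ _ (-1) _ _ lapE1)) (lap_atZ _ (-1) _ _ lapE2))).
have urc : ucball R (refl e l c) by apply: refl_inc => //; exact: ltW.
have := lap_at_min _ _ _ lapF.
rewrite -/(E1 c) -/(E2 c) => /(_ _)/wrap[].
  have n1 : \forall y \near c, dot y y < 1.
    by apply: near_lt; [exact: cont_dot2|exact/uballE].
  have n2 : \forall y \near c, l < dot y e.
    by apply: near_gt => //; exact: cont_dot.
  apply: filterS2 n1 n2 => y y1 y2.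
  have uy : ucball R y by apply/ucballE/ltW.
  have cy : cap y by split=> //=; rewrite lerN2 ltW.
  have ury : ucball R (refl e l y) by apply: refl_inc => //; exact/ltW.
  have := cmin y cy; rewrite !maxs// ler_pdivlMr ?sp// -[w l c / s c]opprK -/k mulNr => h.
  rewrite -/(E1 y) -/(E2 y) -/(s c) -/(s y) -!vE// -/(w l c) -/(w l y).
  by rewrite -kE addrN -lerBlDr sub0r.
rewrite !mulr0 !scale0r !add0r !addr0 !subr0 !dotZl !dotZr e1 => H.
have uu : u (refl e l c) < u c by move: wc0; rewrite /w !vE// subr_lt0.
have ur := refl_in _ _ l0 uc' lc.
have ur0 := upos _ ur.
have Kc := K_ge0 _ uc'.
have KcK0 : K c <= K0.
  by rewrite KE// gerBl mulr_ge0// addr_ge0 ?sqr_ge0 ?enorm_ge0.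
have Kr := K_refl _ _ l0 uc' lc.
have uM : u c <= M by rewrite -vball// vM.
have t1 : K c * u (refl e l c) ^+ 5 <= K (refl e l c) * u (refl e l c) ^+ 5.
  by rewrite ler_wpM2r// exprn_ge0// ltW.
have t2 : K c * u c ^+ 5 - K c * u (refl e l c) ^+ 5 <= 5 * K0 * M ^+ 4 * (u c - u (refl e l c)).
  set x := u c in uu uM *; set y := u (refl e l c) in ur0 uu *.
  have yM : y <= M by rewrite ltW// (lt_le_trans uu).
  have x0' : 0 <= x by rewrite ltW// (lt_trans ur0).
  have P5 : x ^+ 5 - y ^+ 5 <= 5 * M ^+ 4 * (x - y).
    have -> : x ^+ 5 - y ^+ 5 = (x ^+ 4 + x ^+ 3 * y + x ^+ 2 * y ^+ 2 + x * y ^+ 3 + y ^+ 4) * (x - y) by ring.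
    rewrite ler_wpM2r ?subr_ge0 ?(ltW uu)//.
    have mon i j : (i + j)%N = 4%N -> x ^+ i * y ^+ j <= M ^+ 4.
      by move=> <-; rewrite exprD ler_pM ?exprn_ge0 ?(ltW ur0)// lerXn2r ?nnegrE ?(ltW ur0).
    have := mon 4%N 0%N erefl; have := mon 3%N 1%N erefl; have := mon 2%N 2%N erefl.
    have := mon 1%N 3%N erefl; have := mon 0%N 4%N erefl.
    rewrite !expr0 !expr1 !mulr1 !mul1r; lra.
  rewrite -mulrBr; apply: (@le_trans _ _ (K0 * (x ^+ 5 - y ^+ 5))).
    by rewrite ler_wpM2r// subr_ge0 lerXn2r ?nnegrE ?(ltW ur0)// ltW.
  have -> : 5 * K0 * M ^+ 4 * (x - y) = K0 * (5 * M ^+ 4 * (x - y)) by ring.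
  by rewrite ler_pM2l.
have wcE : w l c = u (refl e l c) - u c by rewrite /w !vE.
have L : K c * u c ^+ 5 + mu * u c - (K (refl e l c) * u (refl e l c) ^+ 5 + mu * u (refl e l c))
    <= 3 * C * k.
  apply: (@le_trans _ _ (C * - w l c)); first by rewrite wcE /C; move: t1 t2; lra.
  rewrite kE; have /andP[_ s3] := s1 _ cc.
  have -> : C * (k * s c) = s c * (C * k) by ring.
  by rewrite -mulrA ler_wpM2r// mulr_ge0// ltW.
have E1p : 0 < E1 c by exact: expR_gt0.
have E2p : 0 < E2 c by exact: expR_gt0.
have {H L} H : b ^+ 2 * E1 c + 6 * b * E2 c <= 3 * C.
  rewrite -(ler_pM2r k0); have := dot_ge0 c => dc.
  have : 0 <= k * (E2 c * (b ^+ 2 * dot c c)).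
    by rewrite !mulr_ge0// ltW.
  move: H L; nra.
exists c; split=> //.
- rewrite leNgt; apply/negP => cl.
  have : expR (- 1) <= E1 c.
    rewrite ler_expR mul0r add0r.
    have : b * (dot c e - l) <= 1.
      by rewrite -ler_pdivlMl// mulr1 lerBlDr addrC ltW.
    lra.
  have : b <= b ^+ 2 by rewrite expr2 ler_peMl// ltW.
  have : 0 < 6 * b * E2 c by rewrite !mulr_gt0.
  move: H bC; nra.
- rewrite leNgt; apply/negP => cl.
  have : expR (- 1) <= E2 c.
    rewrite ler_expR mul0r addr0 subr0.
    have : b * (1 - dot c c) <= 1.
      by rewrite -ler_pdivlMl// mulr1 lerBlDr -lerBlDl ltW.
    lra.
  have : 0 < b ^+ 2 * E1 c by rewrite mulr_gt0// exprn_gt0.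
  have : 0 < b * E2 c by rewrite !mulr_gt0.
  move: H bC; nra.
Qed.

Let cont_w2 : continuous (fun z : V * R => w z.2 z.1).
Proof.
move=> z; rewrite /w.
have c1 : {for z, continuous (fun z : V * R => z.1)} by exact: cvg_fst.
have cr := cont_refl2 e z.
by cont; [apply: (cont_compT _ v _ _ cr); exact: cv|apply: (cont_compT _ v _ _ c1); exact: cv].
Qed.

Let cont_wl x : continuous (fun l => w l x).
Proof.
move=> l; rewrite /w; cont.
exact: (cont_compT _ v _ _ (cont_refl_level e x l) (cv _)).
Qed.

Let near_right (l : R) (P : R -> Prop) : (\forall t \near l, P t) -> exists2 t, l < t & P t.
Proof.
move=> /nbhs_ballP[d /= d0 dP]; exists (l + d / 2); first by rewrite ltrDl divr_gt0.
apply: dP; rewrite -ball_normE /= opprD addrA subrr sub0r normrN gtr0_norm; lra.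
Qed.

(* [L] is the last level at which the reflection inequality fails.  It holds at [L] by continuity,
   hence strictly by [strong_max], hence on the compact core at all nearby levels. *)
Let plane_ge0 l x : 0 < l -> uball R x -> l < dot x e -> 0 <= w l x.
Proof.
move=> l0 ux lx; rewrite leNgt; apply/negP => wx.
have dote y : uball R y -> dot y e < 1.
  move=> /uballE uy; rewrite ltNge; apply/negP => ye.
  have := cauchy_schwarz y e; rewrite e1 mulr1; nra.
pose S := [set t : R | 0 < t /\ exists y, [/\ uball R y, t < dot y e & w t y < 0]].
have Sl : S l by split=> //; exists x.
have hS : has_sup S.
  split; first by exists l.
  by exists 1 => t [_ [y [uy ty _]]]; rewrite ltW// (lt_trans ty)// dote.
pose L := sup S.
have L0 : 0 < L by apply: (lt_le_trans l0); apply: sup_upper_bound.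
have wL y : uball R y -> L < dot y e -> 0 <= w L y.
  move=> uy Ly; rewrite leNgt; apply/negP => wy.
  have n1 : \forall t \near L, w t y < 0 by apply: near_lt => //; exact: cont_wl.
  have n2 : \forall t \near L, t < dot y e.
    by apply: (near_lt _ (fun t : R => t)) => //; exact: cont_id.
  have [t Lt [t1 t2]] := near_right _ _ (filterI n1 n2).
  have St : S t by split; [exact: lt_trans Lt|exists y].
  by have := sup_upper_bound hS St; rewrite leNgt Lt.
have [b b1 core] := core_point.
have b0 : 0 < b^-1 by rewrite invr_gt0 (lt_le_trans _ b1).
(* Core points of a level t are at distance at least 1/b beyond the plane of level t; for L - t <
   1/(2b) they are still 1/(2b) beyond the plane of level [L], hence in this fixed compact set. *)
pose A := ucball R `&` ([set y : V | - dot y e <= - (L + b^-1 / 2)] `&`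
   [set y : V | dot y y <= 1 - b^-1]).
have cA : compact A.
  apply: compact_ball_closed; apply: closedI; apply: closed_le_cont => y.
    by cont; exact: cont_dot.
  exact: cont_dot2.
(* Compactness of [A] turns the pointwise positivity at level [L] into one neighbourhood of levels
   valid for all points of [A]. *)
have nA : \forall t \near L, A `<=` (fun y => 0 < w t y).
  have nc : near_covering A by exact/compact_near_coveringP.
  apply: (nc R (nbhs L) (fun t y => 0 < w t y)) => y [_ [/= y1 y2]].
  have uy : uball R y by apply/uballE; rewrite (le_lt_trans y2)// gtrBl.
  have Ly : L < dot y e by rewrite lerN2 in y1; lra.
  have wy := strong_max _ L0 wL _ uy Ly.
  have cz : {for (y, L), continuous (fun z : V * R => w z.2 z.1)} by exact: cont_w2.
  exact: (near_gt _ _ _ _ cz wy).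
have [d /= d0 dA] := (nbhs_ballP _ _).1 nA.
pose d' := Num.min d (b^-1 / 2).
have d'0 : 0 < d' by rewrite lt_min d0 divr_gt0.
have [t [t0 [y yP]] tL] := sup_adherent d'0 hS.
have tL' : t <= L by apply: sup_upper_bound => //; split=> //; exists y.
have [z [uz z1 z2 wz]] := core t t0 (ex_intro _ y yP).
have Lt1 : L - t < d by rewrite ltrBlDr -ltrBlDl (le_lt_trans _ tL)// lerB// ge_min lexx.
have Lt2 : L - t < b^-1 / 2.
  by rewrite ltrBlDr -ltrBlDl (le_lt_trans _ tL)// lerB// ge_min lexx orbT.
have Az : A z.
  split; first by apply/ucballE/ltW/uballE.
  by split=> //=; rewrite lerN2; lra.
have := dA t _ z Az; rewrite -ball_normE /= ger0_norm ?subr_ge0// => /(_ Lt1).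
by rewrite ltNge (ltW wz).
Qed.

(** The case [l = 0] as a limit: for fixed [x], a strict failure at level 0 would persist at small
    positive levels. *)
Lemma reflection_le x : uball R x -> 0 < dot x e -> u x <= u (refl e 0 x).
Proof.
move=> ux x0.
have ur : uball R (refl e 0 x) by apply/uballE; rewrite refl_dot// mulr0 mul0r subr0; exact/uballE.
rewrite -subr_ge0 -!vball// -/(w 0 x) leNgt; apply/negP => wx.
have n1 : \forall t \near (0 : R), w t x < 0 by apply: near_lt => //; exact: cont_wl.
have n2 : \forall t \near (0 : R), t < dot x e.
  by apply: (near_lt _ (fun t : R => t)) => //; exact: cont_id.
have [t t0 [t1 t2]] := near_right _ _ (filterI n1 n2).
by have := plane_ge0 _ _ t0 ux t2; rewrite leNgt t1.
Qed.

End Direction.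

(** Two points of equal norm are exchanged by the reflection in a plane through the origin, with
    normal x - y; applying [reflection_le] with either sign of the normal gives both
    inequalities. *)
Lemma solution_radial x y : uball R x -> dot x x = dot y y -> u x = u y.
Proof.
move=> ux xy; have uy : uball R y by apply/uballE; rewrite -xy; exact/uballE.
have [->//|nxy] := eqVneq x y.
wlog suff : x y ux uy xy nxy / u x <= u y.
  by move=> h; apply/eqP; rewrite eq_le !h// eq_sym.
have d0 : 0 < dot (x - y) (x - y).
  rewrite lt_neqAle dot_ge0 andbT eq_sym; apply: contra nxy => /eqP/dot_eq0/eqP.
  by rewrite subr_eq0.
pose n := Num.sqrt (dot (x - y) (x - y)).
have n0 : 0 < n by rewrite sqrtr_gt0.
have nn : n ^+ 2 = dot (x - y) (x - y) by rewrite sqr_sqrtr// dot_ge0.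
pose e := n^-1 *: (x - y).
have e1 : dot e e = 1 by rewrite /e dotZl dotZr -nn; field; rewrite gt_eqF.
have xe : dot x e = n / 2.
  rewrite /e dotZr dotDr dotNr.
  have : dot x x - dot x y = n ^+ 2 / 2 by rewrite nn dotBB xy; lra.
  by move=> ->; field; rewrite gt_eqF.
have := reflection_le e e1 x ux; rewrite xe divr_gt0// => /(_ isT).
have -> : refl e 0 x = y; last by [].
rewrite /refl xe sub0r /e scalerA.
have -> : 2 * - (n / 2) / n = - 1 by field; rewrite gt_eqF.
by rewrite scaleN1r opprB addrCA subrr addr0.
Qed.

End MovingPlanes.

(** * From a solution in the ball to the radial equation *)

Section Nonexistence.
Context {R : realType}.
Notation V := 'rV[R]_3.

Lemma near_is_derive (f g : R -> R) (x d : R) :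
  (\forall y \near x, f y = g y) -> is_derive x 1 f d -> is_derive x 1 g d.
Proof. exact: near_eq_is_derive. Qed.

Lemma is_derive_unique (f : R -> R) (x a b : R) :
  is_derive x 1 f a -> is_derive x 1 f b -> a = b.
Proof. by move=> [_ <-] [_ <-]. Qed.

(** The difference quotient at 0 is [k] itself, so continuity of [k] at 0 suffices. It gives
    derivatives at points where [k] is only known as a limit. *)
Lemma is_derive_mulid (k : R -> R) : {for 0, continuous k} ->
  is_derive (0 : R) 1 (fun t => t * k t) (k 0).
Proof.
move=> ck.
suff h : (fun h : R => h^-1 *: (((fun t => t * k t) \o shift 0) (h *: 1) - 0 * k 0)) @ 0^'
    --> k 0.
  by apply: DeriveDef; [apply/cvg_ex; eexists; exact: h|exact: cvg_lim h].
apply: (@cvg_trans _ (k @ 0^')); last exact: cvg_within_filter ck.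
apply: near_eq_cvg; near=> h => /=.
have h0 : h != 0 by near: h; exact: nbhs_dnbhs_neq.
by rewrite addr0 mul0r subr0 [_%:A]mulr1 [_ *: _]mulKf.
Unshelve. all: by end_near. Qed.

Lemma near_itv (a b x : R) : a < x < b -> \forall y \near x, a < y < b.
Proof.
move=> /andP[ax xb].
have n1 : \forall y \near x, a < y by apply: (near_gt _ (fun y : R => y)) => //; exact: cont_id.
have n2 : \forall y \near x, y < b by apply: (near_lt _ (fun y : R => y)) => //; exact: cont_id.
by apply: filterS2 n1 n2 => y -> ->.
Qed.

Lemma dotZe (r : R) (i : 'I_3) : dot (r *: ebase R i) (r *: ebase R i) = r ^+ 2.
Proof. by rewrite dotZl dotZr dot_ebase2 mulr1 expr2. Qed.

Lemma coefficient_bound (K0 eta : R) (K : V -> R) : 0 <= eta ->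
  (forall x, uball R x -> K x = K0 - eta * (enorm x + enorm x ^+ 2)) ->
  (forall x, uball R x -> 0 <= K x) -> 2 * eta <= K0.
Proof.
move=> eta0 KE K_ge0; rewrite leNgt; apply/negP => eK.
have K00 : 0 <= K0.
  have u0 : uball R (0 : V) by apply/uballE; rewrite dot0l.
  have := K_ge0 _ u0; rewrite KE// enormE dot0l sqrtr0 expr0n /= addr0 mulr0 subr0.
  by [].
have etap : 0 < eta by lra.
(* At radius 1 - d the coefficient is K0 - 2 eta + 3 eta d - eta d^2, which for this [d] equals - 3
   eta d - eta d^2 < 0. *)
pose d := (2 * eta - K0) / (6 * eta).
have d0 : 0 < d by rewrite divr_gt0; lra.
have d1 : d < 1 by rewrite ltr_pdivrMr; lra.
have dE : 6 * (eta * d) = 2 * eta - K0 by rewrite /d; field; rewrite gt_eqF.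
pose x : V := (1 - d) *: ebase R 0.
have xn : enorm x = 1 - d.
  by rewrite enormE /x dotZe sqrtr_sqr ger0_norm// subr_ge0 ltW.
have ux : uball R x by rewrite /uball /= xn; lra.
have Kx := K_ge0 x ux; have KxE := KE x ux; rewrite xn in KxE; rewrite KxE in Kx.
have : 0 < eta * (d * d) by apply: mulr_gt0 => //; exact: mulr_gt0.
move: dE eK Kx; clear => h1 h2 h3 h4; nra.
Qed.

Lemma laplacianE (f : V -> R) x : laplacian f x =
  partial 0 (partial 0 f) x + partial 1 (partial 1 f) x + partial 2 (partial 2 f) x.
Proof. exact: sum3E. Qed.

Lemma nonexistence (mu K0 eta : R) (K u : V -> R) :
  0 < mu -> mu < pi ^+ 2 -> 0 < K0 -> 0 <= eta ->
  (forall x, uball R x -> K x = K0 - eta * (enorm x + enorm x ^+ 2)) ->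
  (forall x, uball R x -> 0 <= K x) ->
  4 * K0 * (- (Num.sqrt mu * cos (Num.sqrt mu) / sin (Num.sqrt mu))) <= eta ->
  is_solution K mu u -> False.
Proof.
move=> mu0 mupi K00 eta0 KE K_ge0 cond [c2 eqn upos ubd].
set w := Num.sqrt mu in cond *.
have w0 : 0 < w by rewrite sqrtr_gt0.
have wE : w ^+ 2 = mu by rewrite sqr_sqrtr// ltW.
have wpi : w < pi by rewrite -(@ltr_pXn2r _ 2) ?nnegrE ?pi_ge0 ?(ltW w0)// wE.
have cu := C2_ucball_uball _ c2.
have [cu1 cu2] := cu.
have [cuc _ _ e1 _] := c2.
have [v cv vE] := extend_continuous _ cuc.
have rad := solution_radial mu K0 eta K u v mu0 K00 eta0 KE K_ge0 cu cv vE eqn upos ubd.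
have [h0 ch0 h0E] := e1 0.
have [h ch hE] := extend_continuous _ ch0.
have ub_uc x : uball R x -> ucball R x by move=> /uballE/ltW/ucballE.
pose e := ebase R 0.
(* The restrictions to an axis of the globally continuous extensions of [u] and of its first partial
   derivative: [U] and [U1] are thus continuous on the whole line, including 0 and 1. *)
pose U (r : R) := v (r *: e); pose U1 (r : R) := h (r *: e).
have ub (r : R) : 0 < r < 1 -> uball R (r *: e).
  by move=> /andP[r0 r1]; apply/uballE; rewrite dotZe expr_lt1// ltW.
have cline (r : R) : {for r, continuous (fun s : R => s *: e)}.
  by apply: (contZ V (fun s : R => s) (fun=> e)); [exact: cont_id|exact: cst_continuous].
have UE (r : R) : 0 < r < 1 -> U r = u (r *: e) by move=> /ub/ub_uc; exact: vE.
have U1E (r : R) : 0 < r < 1 -> U1 r = partial 0 u (r *: e).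
  by move=> /ub ur; rewrite /U1 hE ?h0E//; exact: ub_uc.
have linee (f : V -> R) : (fun s : R => f (0 + s *: e)) = (fun s => f (s *: e)).
  by apply/funext => s; rewrite add0r.
have dline (f : V -> R) (r : R) : C1_uball f -> 0 < r < 1 ->
    is_derive r 1 (fun s : R => f (s *: e)) (partial 0 f (r *: e)).
  move=> cf r01; rewrite -linee -[X in partial 0 f X]add0r.
  apply/is_derive_line; rewrite add0r.
  by have [/derivableP + _] := cf 0 _ (ub r r01).
have dU (r : R) : 0 < r < 1 -> is_derive r 1 U (U1 r).
  move=> r01; rewrite U1E//; apply: near_is_derive (dline u r cu1 r01).
  by apply: filterS (near_itv _ _ _ r01) => s s01; rewrite UE.
have Urad x : uball R x -> u x = U (enorm x).
  move=> ux; rewrite /U vE; last first.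
    by rewrite /ucball /= /e enormE dotZe sqrtr_sqr ger0_norm ?enorm_ge0// ltW.
  by apply: rad => //; rewrite dotZe enorm_sq.
(* On the line through [r *: e] in an orthogonal direction, u is U(rho(t)) with rho(t) = sqrt(r^2 +
   t^2), so the transverse first derivative is t times U1(rho)/rho; [is_derive_mulid] differentiates
   it at t = 0. The two transverse directions produce the term 2 U'/r. *)
have side (r : R) (i : 'I_3) : i != 0 -> 0 < r < 1 ->
    partial i (partial i u) (r *: e) = U1 r / r.
  move=> i0 r01; have /andP[r0 r1] := r01.
  have dd : is_derive (0 : R) 1 (fun t => partial i u (r *: e + t *: ebase R i))
      (partial i (partial i u) (r *: e)).
    apply/is_derive_line; rewrite scale0r addr0.
    by have [/derivableP + _] := cu2 i i _ (ub r r01).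
  pose rho (t : R) := Num.sqrt (r ^+ 2 + t ^+ 2).
  have rhop (t : R) : 0 < r ^+ 2 + t ^+ 2 by rewrite ltr_pwDl ?sqr_ge0// exprn_gt0.
  have rho0 : rho 0 = r by rewrite /rho expr0n addr0 sqrtr_sqr gtr0_norm.
  have drho (t : R) : is_derive t 1 rho (t / rho t).
    have ds := is_derive1_sqrt (rhop t).
    have dq : is_derive t 1 (fun t : R => r ^+ 2 + t ^+ 2) (2 * t) by der; rewrite /=; ring.
    have := der_comp Num.sqrt _ _ _ _ _ dq ds => dc.
    apply: der_eq dc _; rewrite /rho; field.
    by rewrite gt_eqF// sqrtr_gt0.
  have crho (t : R) : {for t, continuous rho} by exact: der_continuous (drho t).
  have near01 : \forall t \near (0 : R), 0 < rho t < 1.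
    have r01' : rho 0 < 1 by rewrite rho0.
    have n1 : \forall t \near (0 : R), rho t < 1 := near_lt _ rho 0 1 (crho 0) r01'.
    by apply: filterS n1 => t ->; rewrite andbT sqrtr_gt0.
  pose k (t : R) := U1 (rho t) / rho t.
  have cU1 (s : R) : {for s, continuous U1} by exact: (cont_compT _ h _ _ (cline s) (ch _)).
  have ck : {for 0, continuous k}.
    rewrite /k; cont; [exact: (cont_compT _ U1)|by rewrite rho0 gt_eqF|exact: crho].
  have := is_derive_mulid k ck; rewrite {2}/k rho0 => dk.
  apply: is_derive_unique dd _; apply: near_is_derive dk.
  have [d /= d0 dP] := (nbhs_ballP _ _).1 near01.
  have near2 : \forall t \near (0 : R), forall s : R, `|s - t| < d / 2 -> 0 < rho s < 1.
    apply/nbhs_ballP; exists (d / 2); first by rewrite /= divr_gt0.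
    move=> t; rewrite -ball_normE /= sub0r normrN => td s st.
    apply: dP; rewrite -ball_normE /= sub0r normrN.
    by have := ler_normD (s - t) t; rewrite subrK; lra.
  apply: filterS near2 => t tP.
  have rt : 0 < rho t < 1 by apply: tP; rewrite subrr normr0 divr_gt0.
  have enr (s : R) : enorm (r *: e + s *: ebase R i) = rho s.
    rewrite enormE /rho; congr Num.sqrt.
    rewrite dotDl !dotDr !dotZl !dotZr !dot_ebase2 (dotC (ebase R i)) dot_ebase.
    rewrite mxE (negbTE i0) andbF mulr0n; ring.
  have uline (s : R) : 0 < rho s < 1 -> uball R (r *: e + s *: ebase R i).
    by move=> /andP[_ s1]; rewrite /uball /= enr.
  have d1 : is_derive t 1 (fun s => u (r *: e + s *: ebase R i))
      (partial i u (r *: e + t *: ebase R i)).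
    by apply/is_derive_line; have [/derivableP + _] := cu1 i _ (uline t rt).
  have d2 : is_derive t 1 (fun s => u (r *: e + s *: ebase R i)) (U1 (rho t) * (t / rho t)).
    apply: near_is_derive (der_comp U rho t 1 _ _ (drho t) (dU _ rt)).
    apply/nbhs_ballP; exists (d / 2); first by rewrite /= divr_gt0.
    move=> s; rewrite -ball_normE /= distrC => st.
    by rewrite Urad ?enr//; apply/uline/tP.
  by rewrite (is_derive_unique _ _ _ _ d1 d2) /k; ring.
have sol : radial_solution w K0 eta U U1 0 1.
  move=> r r01; have /andP[r0 r1] := r01; split; first exact: dU.
  have d2 : is_derive r 1 U1 (partial 0 (partial 0 u) (r *: e)).
    apply: near_is_derive (dline (partial 0 u) r (cu2 0) r01).
    by apply: filterS (near_itv _ _ _ r01) => s s01; rewrite U1E.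
  apply: der_eq d2 _.
  have := eqn _ (ub r r01); rewrite (KE _ (ub r r01)) laplacianE (side r 1)// (side r 2)//.
  have -> : enorm (r *: e) = r by rewrite enormE dotZe sqrtr_sqr gtr0_norm.
  rewrite -UE// wE /Krad => E.
  have rn0 : r != 0 by rewrite gt_eqF.
  have -> : - 2 * U1 r / r = - (U1 r / r) - U1 r / r by field.
  by move: E; lra.
have eK := coefficient_bound K0 eta K eta0 KE K_ge0.
have cU (r : R) : {for r, continuous U} by exact: (cont_compT _ v _ _ (cline r) (cv _)).
have cU1 (r : R) : {for r, continuous U1} by exact: (cont_compT _ h _ _ (cline r) (ch _)).
have Upos (r : R) : 0 < r < 1 -> 0 < U r.
  by move=> r01; rewrite UE//; apply: upos; exact: ub.
have Uone : U 1 = 0.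
  have s1 : usphere R ((1 : R) *: e) by apply/usphereE; rewrite dotZe expr1n.
  by rewrite /U vE ?ubd//; apply/ucballE; rewrite dotZe expr1n.
exact: (no_radial_solution w K0 eta U U1 w0 wpi K00 eta0 eK cond cU cU1 sol Upos Uone).
Qed.

End Nonexistence.

(** * The radial initial value problem *)

Section Volterra.
Context {R : realType}.
Implicit Types F G : R -> R.

(** The primitive that vanishes at 0. Integrating from -1 makes it differentiable on both sides of
    0. *)
Definition prim F (x : R) : R :=
  \int[lebesgue_measure]_(t in `[-1, x]) F t - \int[lebesgue_measure]_(t in `[-1, 0]) F t.

Lemma prim0 F : prim F 0 = 0. Proof. by rewrite /prim subrr. Qed.

Lemma der_prim F (x : R) : continuous F -> -1 < x -> is_derive x 1 (prim F) (F x).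
Proof.
move=> cF x1.
have iF : (@lebesgue_measure R).-integrable `[-1, x + 1] (EFin \o F).
  apply: continuous_compact_integrable; first exact: segment_compact.
  exact: continuous_subspaceT.
have [d1 d2] := @continuous_FTC1_closed R F (-1) x (x + 1) (ltac:(by rewrite ltrDl)) iF x1 (cF x).
have d : is_derive x 1 (fun y : R => \int[lebesgue_measure]_(t in `[-1, y]) F t) (F x).
  by apply: DeriveDef; [exact: d1|rewrite -derive1E; exact: d2].
by rewrite /prim; der; rewrite addr0.
Qed.

Lemma cont_prim F (x : R) : continuous F -> -1 < x -> {for x, continuous (prim F)}.
Proof. by move=> cF x1; exact: der_continuous (der_prim F x cF x1). Qed.

(** The solution of - (r^2 U')' = r^2 F with U(0) = A and U'(0) = 0, after two integrations, and its
    derivative [vol1]. As x / 0 = 0, the value at 0 is the right one. *)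
Definition vol (A : R) F (r : R) : R :=
  A - prim (fun s : R => s * F s) r + prim (fun s : R => s ^+ 2 * F s) r / r.
Definition vol1 F (r : R) : R := - (prim (fun s : R => s ^+ 2 * F s) r / r ^+ 2).

Lemma contsF F : continuous F -> continuous (fun s : R => s * F s).
Proof. by move=> cF s; cont; exact: cF. Qed.

Lemma conts2F F : continuous F -> continuous (fun s : R => s ^+ 2 * F s).
Proof. by move=> cF s; cont; exact: cF. Qed.

Lemma vol0 A F : vol A F 0 = A.
Proof. by rewrite /vol !prim0 mul0r subr0 addr0. Qed.

Lemma der_vol A F (r : R) : continuous F -> 0 < r -> is_derive r 1 (vol A F) (vol1 F r).
Proof.
move=> cF r0; have r1 : -1 < r by lra.
have d1 := der_prim _ _ (contsF F cF) r1; have d2 := der_prim _ _ (conts2F F cF) r1.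
have rn0 : r != 0 by rewrite gt_eqF.
by rewrite /vol /vol1; der0; [exact: rn0|field].
Qed.

Lemma der_vol1 F (r : R) : continuous F -> 0 < r ->
  is_derive r 1 (vol1 F) (- 2 * vol1 F r / r - F r).
Proof.
move=> cF r0; have r1 : -1 < r by lra.
have d2 := der_prim _ _ (conts2F F cF) r1.
have rn0 : r != 0 by rewrite gt_eqF.
by rewrite /vol1; der0; [rewrite expf_neq0|rewrite /=; field].
Qed.

Lemma prim_cmp F G (e : R -> R) (r : R) : continuous F -> 0 <= r ->
  (forall s : R, 0 <= s <= r -> {for s, continuous G}) -> G 0 = 0 ->
  (forall s : R, 0 < s < r -> is_derive s 1 G (e s)) ->
  (forall s, 0 < s < r -> `|F s| <= e s) -> `|prim F r| <= G r.
Proof.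
move=> cF r0 cG G0 dG Fe; rewrite ler_norml; apply/andP; split.
- rewrite -subr_ge0 opprK.
  have -> : 0 = prim F 0 + G 0 by rewrite prim0 G0 addr0.
  apply: (deriv_ge0_le (fun s => prim F s + G s) (fun s => F s + e s)) => //.
  + move=> s /andP[s0 sr]; cont; last by apply: cG; rewrite s0.
    by apply: cont_prim => //; lra.
  + by move=> s /andP[s0 sr]; apply: derD; [apply: der_prim => //; lra|apply: dG; rewrite s0].
  + by move=> s /Fe; rewrite ler_norml => /andP[? _]; lra.
- rewrite -subr_ge0.
  have -> : 0 = G 0 - prim F 0 by rewrite prim0 G0 subr0.
  apply: (deriv_ge0_le (fun s => G s - prim F s) (fun s => e s - F s)) => //.
  + move=> s /andP[s0 sr]; cont; first by apply: cG; rewrite s0.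
    by apply: cont_prim => //; lra.
  + move=> s /andP[s0 sr]; have d1 := dG s (ltac:(by rewrite s0)).
    by have d2 := der_prim F s cF (ltac:(lra)); der.
  + by move=> s /Fe; rewrite ler_norml => /andP[_ ?]; lra.
Qed.

Lemma cont_bounded F (a b : R) : continuous F ->
  exists2 M, 0 <= M & forall s, a <= s <= b -> `|F s| <= M.
Proof.
move=> cF; have [ab|ba] := leP a b; last first.
  by exists 0 => // s /andP[sa sb]; have := le_trans sa sb; rewrite leNgt ba.
have cA : {within `[a, b], continuous (fun s : R => `|F s|)}.
  by apply: continuous_subspaceT => s; cont; exact: cF.
have [c cab cmax] := EVT_max ab cA.
by exists `|F c| => // s sab; apply: cmax; rewrite in_itv.
Qed.

Lemma rvol1E F : (fun r : R => r * vol1 F r) = (fun r => - (prim (fun s : R => s ^+ 2 * F s) r / r)).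
Proof.
apply/funext => r; rewrite /vol1; have [->|r0] := eqVneq r 0; last by field.
by rewrite invr0 mulr0 oppr0 mul0r.
Qed.

(** At 0 the quotient tends to the derivative of the primitive, 0^2 F(0) = 0, which agrees with the
    convention for division by 0. *)
Lemma cont_primdiv F (r : R) : continuous F -> 0 <= r ->
  {for r, continuous (fun r : R => prim (fun s : R => s ^+ 2 * F s) r / r)}.
Proof.
move=> cF; rewrite le_eqVlt => /predU1P[<-|r0]; last first.
  cont; last by rewrite gt_eqF.
  by apply: cont_prim; [exact: conts2F|lra].
have [dx dE] := der_prim _ _ (conts2F F cF) (ltac:(lra) : -1 < (0 : R)).
have h : (fun h : R => h^-1 *: ((prim (fun s : R => s ^+ 2 * F s) \o shift 0) (h *: 1)
     - prim (fun s : R => s ^+ 2 * F s) 0)) @ 0^' --> (0 : R).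
  by have := dx; rewrite /derivable; move: dE; rewrite /derive expr0n mul0r => ->.
apply/continuous_withinNx; rewrite prim0 mul0r; apply: cvg_trans h.
apply: near_eq_cvg; near=> t => /=.
by rewrite prim0 subr0 addr0 [_%:A]mulr1 [RHS]mulrC.
Unshelve. all: by end_near. Qed.

Lemma cont_rvol1 F (r : R) : continuous F -> 0 <= r ->
  {for r, continuous (fun r : R => r * vol1 F r)}.
Proof. by move=> cF r0; rewrite rvol1E; apply: contN; exact: cont_primdiv. Qed.

Lemma cont_vol A F (r : R) : continuous F -> 0 <= r -> {for r, continuous (vol A F)}.
Proof.
move=> cF r0; rewrite /vol; apply: contD; last exact: cont_primdiv.
by cont; apply: cont_prim; [exact: contsF|lra].
Qed.

(** A contraction by 4 in the sup norm weighted by exp(2 L r): a source error of size L e exp(2 L t)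
    gives a slope error of at most (e / 2) exp(2 L s), because t^2 <= s^2 in the integral, and
    integrating once more gives the bound since L >= 1. *)
Lemma vol_cmp A F G (L e r : R) : continuous F -> continuous G -> 1 <= L -> 0 <= e ->
  0 <= r <= 1 -> (forall s, 0 <= s <= 1 -> `|F s - G s| <= L * e * expR (2 * L * s)) ->
  `|vol A F r - vol A G r| <= e / 4 * expR (2 * L * r).
Proof.
move=> cF cG L1 e0 /andP[r0 r1] FG.
have L0 : 0 < L by apply: lt_le_trans L1.
have Ln0 := lt0r_neq0 L0.
pose D (s : R) := vol A F s - vol A G s.
pose D1 (s : R) := vol1 F s - vol1 G s.
have E0 (s : R) : 0 <= expR (2 * L * s) by exact: expR_ge0.
have D1b (s : R) : 0 < s <= 1 -> `|D1 s| <= e / 2 * expR (2 * L * s).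
  move=> /andP[s0 s1].
  have sn0 := lt0r_neq0 s0.
  pose H (t : R) := t ^+ 2 * (F t - G t).
  have cFG : continuous (fun t : R => F t - G t) by move=> t; cont; [exact: cF|exact: cG].
  have cH : continuous H by exact: (conts2F _ cFG).
  have DE : D1 s = - (prim H s / s ^+ 2).
    rewrite /D1 /vol1.
    (* Additivity of [prim], by differentiation: the difference of the two sides vanishes at 0 and
       has zero derivative. *)
    suff E : prim H s = prim (fun t : R => t ^+ 2 * F t) s - prim (fun t : R => t ^+ 2 * G t) s.
      by rewrite E; field.
    have := deriv_ge0_le (fun t => prim H t - (prim (fun t : R => t ^+ 2 * F t) t - prim (fun t : R => t ^+ 2 * G t) t)) (fun=> 0) 0 s (ltW s0).
    have := deriv_le0_ge (fun t => prim H t - (prim (fun t : R => t ^+ 2 * F t) t - prim (fun t : R => t ^+ 2 * G t) t)) (fun=> 0) 0 s (ltW s0).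
    rewrite !prim0 !subr0.
    have c (t : R) : 0 <= t <= s -> {for t, continuous (fun t => prim H t - (prim (fun t : R => t ^+ 2 * F t) t - prim (fun t : R => t ^+ 2 * G t) t))}.
      move=> /andP[t0 _]; have t1 : -1 < t by lra.
      by cont; apply: cont_prim => //; exact: conts2F.
    have d (t : R) : 0 < t < s -> is_derive t 1 (fun t => prim H t - (prim (fun t : R => t ^+ 2 * F t) t - prim (fun t : R => t ^+ 2 * G t) t)) 0.
      move=> /andP[t0 _]; have t1 : -1 < t by lra.
      have d1 := der_prim _ _ cH t1; have d2 := der_prim _ _ (conts2F F cF) t1.
      have d3 := der_prim _ _ (conts2F G cG) t1.
      by der; rewrite /H; ring.
    move=> /(_ c d (fun _ _ => lexx _)) h1 /(_ c d (fun _ _ => lexx _)) h2.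
    by apply/eqP; rewrite -subr_eq0 eq_le h1 h2.
  rewrite DE normrN normrM normfV (ger0_norm (sqr_ge0 s)) ler_pdivrMr ?exprn_gt0//.
  apply: (prim_cmp H (fun t => e / 2 * expR (2 * L * t) * t ^+ 2)
    (fun t => L * e * expR (2 * L * t) * t ^+ 2 + e * t * expR (2 * L * t))) => //.
  - exact: ltW.
  - by move=> t _; cont.
  - by rewrite expr0n mulr0.
  - by move=> t _; der; rewrite /=; field.
  - move=> t /andP[t0 ts]; rewrite /H normrM (ger0_norm (sqr_ge0 t)).
    apply: (@le_trans _ _ (t ^+ 2 * (L * e * expR (2 * L * t)))).
      by rewrite ler_wpM2l ?sqr_ge0// FG// (ltW t0) (le_trans (ltW ts)).
    by rewrite mulrC lerDl !mulr_ge0// ltW.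
have cD (s : R) : 0 <= s -> {for s, continuous D}.
  by move=> s0; rewrite /D; cont; exact: cont_vol.
have dD (s : R) : 0 < s -> is_derive s 1 D (D1 s).
  by move=> s0; have d1 := der_vol A F s cF s0; have d2 := der_vol A G s cG s0; rewrite /D; der.
have D0 : D 0 = 0 by rewrite /D !vol0 subrr.
pose B (s : R) := e / 4 * expR (2 * L * s).
have dB (s : R) : is_derive s 1 B (e / 2 * L * expR (2 * L * s)).
  by rewrite /B; der; rewrite /=; field.
have B0 : 0 <= B 0 by rewrite /B mulr_ge0// divr_ge0.
have key (s : R) : 0 < s < r -> `|D1 s| <= e / 2 * L * expR (2 * L * s).
  move=> /andP[s0 sr]; apply: le_trans (D1b s _) _; first by rewrite s0 (le_trans (ltW sr)).
  by rewrite ler_wpM2r// ler_peMr// divr_ge0.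
have cB (s : R) : {for s, continuous B} := der_continuous _ _ _ (dB s).
pose dBs (s : R) := e / 2 * L * expR (2 * L * s).
have lo : D 0 + B 0 <= D r + B r.
  apply: (deriv_ge0_le (fun s => D s + B s) (fun s => D1 s + dBs s) 0 r r0).
  - by move=> s /andP[s0 _]; exact: (contD D B s (cD s s0) (cB s)).
  - by move=> s /andP[s0 _]; exact: (derD D B _ _ _ _ (dD s s0) (dB s)).
  - by move=> s /key; rewrite ler_norml => /andP[+ _]; rewrite -subr_ge0 opprK.
have hi : B 0 - D 0 <= B r - D r.
  apply: (deriv_ge0_le (fun s => B s - D s) (fun s => dBs s - D1 s) 0 r r0).
  - by move=> s /andP[s0 _]; exact: (contD B _ s (cB s) (contN D _ (cD s s0))).
  - by move=> s /andP[s0 _]; exact: (derD B _ _ _ _ _ (dB s) (derN D _ _ _ (dD s s0))).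
  - by move=> s /key; rewrite ler_norml => /andP[_ +]; rewrite -subr_ge0.
rewrite -/(D r) -/(B r) ler_norml; move: lo hi B0; rewrite D0.
move: (D r) (B r) (B 0) => x y z; clear => h1 h2 h3; apply/andP; lra.
Qed.

End Volterra.

Section Picard.
Context {R : realType}.

Lemma geometric_small (D e : R) : 0 < e -> exists n : nat, D / 4 ^+ n < e.
Proof.
move=> e0; exists (Num.bound `|D / e|).
have n4 n : (n%:R : R) < 4 ^+ n.
  by rewrite -natrX ltr_nat ltn_expl.
rewrite ltr_pdivrMr ?exprn_gt0// mulrC -ltr_pdivrMr//.
apply: le_lt_trans (n4 _); apply: le_trans (ler_norm _) _.
by apply: ltW; have := archi_boundP (normr_ge0 (D / e)).
Qed.

(** The intervals of radius 2 C / 4^n around [x n] are nested, and the supremum of their left ends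
    belongs to all of them. The explicit rate makes the convergence uniform when [x] depends on a
    parameter. *)
Lemma geometric_limit (x : nat -> R) (C : R) : 0 <= C ->
  (forall n, `|x n.+1 - x n| <= C / 4 ^+ n) ->
  exists l, forall n, `|l - x n| <= 2 * C / 4 ^+ n.
Proof.
move=> C0 xP.
have p4 n : 0 < (4 : R) ^+ n by rewrite exprn_gt0.
have q n : 0 <= C / 4 ^+ n by rewrite divr_ge0// ltW.
have qS n : C / 4 ^+ n.+1 = C / 4 ^+ n / 4.
  by rewrite exprS; field; rewrite gt_eqF// p4.
have lo m n : (m <= n)%N -> x m - 2 * C / 4 ^+ m <= x n - 2 * C / 4 ^+ n.
  elim: n => [|n IH]; first by rewrite leqn0 => /eqP ->.
  rewrite leq_eqVlt => /predU1P[->//|/IH/le_trans]; apply.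
  have := xP n; rewrite ler_norml -!mulrA qS => /andP[h _]; have := q n; lra.
have hi m n : (m <= n)%N -> x n + 2 * C / 4 ^+ n <= x m + 2 * C / 4 ^+ m.
  elim: n => [|n IH]; first by rewrite leqn0 => /eqP ->.
  rewrite leq_eqVlt => /predU1P[->//|/IH]; apply: le_trans.
  have := xP n; rewrite ler_norml -!mulrA qS => /andP[_ h]; have := q n; lra.
have lohi m n : x m - 2 * C / 4 ^+ m <= x n + 2 * C / 4 ^+ n.
  have [mn|/ltnW nm] := leqP m n.
    by apply: le_trans (lo _ _ mn) _; have := q n; rewrite -!mulrA; lra.
  by apply: le_trans (hi _ _ nm); have := q m; rewrite -!mulrA; lra.
pose S := [set x n - 2 * C / 4 ^+ n | n in [set: nat]].
have hS : has_sup S.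
  split; first by exists (x 0%N - 2 * C / 4 ^+ 0); exists 0%N.
  by exists (x 0%N + 2 * C / 4 ^+ 0) => _ [n _ <-].
exists (sup S) => n; rewrite ler_distl; apply/andP; split.
  by apply: sup_upper_bound => //; exists n.
by apply: sup_le_ub; [case: hS|move=> _ [m _ <-]].
Qed.

Definition clip (a b x : R) := Num.max a (Num.min x b).

Lemma clip_in (a b x : R) : a <= b -> a <= clip a b x <= b.
Proof. by move=> ab; rewrite /clip le_max lexx /= ge_max ab ge_min lexx orbT. Qed.

Lemma clip_id (a b x : R) : a <= x <= b -> clip a b x = x.
Proof. by move=> /andP[ax xb]; rewrite /clip min_l// max_r. Qed.

Lemma clip_le (a b x y : R) : x <= y -> clip a b x <= clip a b y.
Proof.
by move=> xy; rewrite /clip ge_max !le_max lexx /= le_min !ge_min xy lexx !orbT.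
Qed.

Lemma clip_lip (a b x y : R) : a <= b -> `|clip a b x - clip a b y| <= `|x - y|.
Proof.
move=> ab; wlog xy : x y / x <= y.
  by move=> h; have [/h //|/ltW/h] := leP x y; rewrite distrC (distrC y).
rewrite distrC (distrC x) !ger0_norm ?subr_ge0 ?clip_le//.
have h1 : Num.min y b - (y - x) <= Num.min x b.
  have m1 : Num.min y b <= y by rewrite ge_min lexx.
  have m2 : Num.min y b <= b by rewrite ge_min lexx orbT.
  by rewrite le_min; apply/andP; split; lra.
have h2 : Num.max a (Num.min y b) <= Num.max a (Num.min x b) + (y - x).
  have m1 : a <= Num.max a (Num.min x b) by rewrite le_max lexx.
  have m2 : Num.min x b <= Num.max a (Num.min x b) by rewrite le_max lexx orbT.
  by rewrite ge_max; apply/andP; split; lra.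
by rewrite /clip lerBlDl addrC; move: h2; lra.
Qed.

Lemma cont_clip (a b x : R) : {for x, continuous (clip a b)}.
Proof. by rewrite /clip; cont. Qed.

(** The fixed point is sought as a source [F] and not as [U]: for any continuous [F], [vol A F]
    already has the derivatives and the value at 0 of a solution. The factor 1/4 of [vol_cmp] makes
    the iterates converge on all of [0, 1] at once. *)
Lemma picard (f : R -> R -> R) (A L : R) : 1 <= L ->
  (forall r a b, 0 <= r <= 1 -> `|f r a - f r b| <= L * `|a - b|) ->
  (forall U : R -> R, continuous U -> continuous (fun r => f (clip 0 1 r) (U (clip 0 1 r)))) ->
  exists2 F : R -> R, continuous F &
    forall r, 0 <= r <= 1 -> F r = f r (vol A F r).
Proof.
move=> L1 fL fc.
pose Fo (U : R -> R) (r : R) := f (clip 0 1 r) (U (clip 0 1 r)).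
have c01 (r : R) : 0 <= clip 0 1 r <= 1 by exact: clip_in.
have FoE U (r : R) : 0 <= r <= 1 -> Fo U r = f r (U r) by move=> r01; rewrite /Fo clip_id.
(* only the values on [0, 1] matter: clipping makes every iterate continuous *)
pose ext (U : R -> R) (r : R) := U (clip 0 1 r).
pose X := fix X n := if n is m.+1 then ext (vol A (Fo (X m))) else fun=> A.
have cX n : continuous (X n).
  elim: n => [|n IH]; first by move=> r; exact: cst_continuous.
  move=> r; apply: (cont_comp (vol A (Fo (X n))) (clip 0 1)); first exact: cont_clip.
  apply: cont_vol; last by case/andP: (c01 r).
  exact: fc.
have [M M0 MP] := cont_bounded (fun r => X 1%N r - X 0%N r) 0 1
  (fun r => contD (X 1%N) _ r (cX 1%N r) (contN _ _ (cX 0%N r))).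
have L0 : 0 < L by apply: lt_le_trans L1.
have e1 (r : R) : 0 <= r -> 1 <= expR (2 * L * r).
  by move=> r0; rewrite -expR0 ler_expR !mulr_ge0// ltW.
have step n (r : R) : 0 <= r <= 1 -> `|X n.+1 r - X n r| <= M / 4 ^+ n * expR (2 * L * r).
  elim: n r => [|n IH] r r01.
    rewrite expr0 divr1; apply: le_trans (MP r r01) _.
    by rewrite ler_peMr// e1//; case/andP: r01.
  rewrite [X n.+2]/= [X n.+1]/= /ext clip_id//.
  have -> : M / 4 ^+ n.+1 = M / 4 ^+ n / 4 by rewrite exprS invfM; ring.
  apply: (vol_cmp A (Fo (X n.+1)) (Fo (X n)) L) => //; [exact: fc|exact: fc|..].
    by rewrite divr_ge0// exprn_ge0.
  move=> s s01; rewrite !FoE//; apply: le_trans (fL _ _ _ s01) _.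
  by rewrite -mulrA ler_wpM2l// ?(ltW L0)// IH.
pose C := M * expR (2 * L).
have C0 : 0 <= C by rewrite mulr_ge0 ?expR_ge0.
have stepC n (r : R) : `|X n.+1 (clip 0 1 r) - X n (clip 0 1 r)| <= C / 4 ^+ n.
  apply: le_trans (step n _ (c01 r)) _; rewrite /C mulrAC ler_wpM2r// ?invr_ge0 ?exprn_ge0//.
  rewrite ler_wpM2l// ler_expR; have /andP[_] := c01 r.
  by move: (clip 0 1 r) => t t1; rewrite ler_piMr// mulr_ge0// ltW.
have [W WP] : exists W : R -> R, forall r n, `|W r - X n (clip 0 1 r)| <= 2 * C / 4 ^+ n.
  have h (r : R) : exists l, forall n, `|l - X n (clip 0 1 r)| <= 2 * C / 4 ^+ n.
    exact: (geometric_limit (fun n => X n (clip 0 1 r))).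
  by exists (fun r => sval (cid (h r))) => r; exact: (svalP (cid (h r))).
have cW : continuous W.
  move=> r; apply/cvgrPdist_lt => e e0.
  have [n nP] := geometric_small (2 * C) (e / 3) (ltac:(by rewrite divr_gt0)).
  have cn : {for r, continuous (fun s => X n (clip 0 1 s))}.
    by apply: (cont_comp (X n)); [exact: cont_clip|exact: cX].
  have /cvgrPdist_lt/(_ (e / 3) (ltac:(by rewrite divr_gt0))) := cn.
  apply: filterS => s sP.
  have := WP r n; have := WP s n.
  rewrite -(distrC (X n _) (W s)) => h1 h2.
  have := ler_normD (W r - X n (clip 0 1 r)) (X n (clip 0 1 r) - W s).
  have := ler_normD (X n (clip 0 1 r) - X n (clip 0 1 s)) (X n (clip 0 1 s) - W s).
  by rewrite !subrKA; lra.
exists (Fo W); first exact: fc.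
(* [W] is within O(4^-n) both of [X n.+1] and, by one more contraction, [vol A (Fo W)] is too; a
   positive gap would contradict this for large n. *)
have WV (r : R) : 0 <= r <= 1 -> W r = vol A (Fo W) r.
  move=> r01; apply/eqP; rewrite -subr_eq0 -normr_eq0 eq_le normr_ge0 andbT.
  rewrite leNgt; apply/negP => pos.
  pose e := 2 * C.
  have [n nP] := geometric_small (e + e * expR (2 * L)) _ pos.
  have h1 : `|vol A (Fo W) r - X n.+1 r| <= e / 4 ^+ n * expR (2 * L) / 4.
    rewrite [X n.+1]/= /ext clip_id//.
    have en0 : 0 <= e / 4 ^+ n by rewrite divr_ge0 ?exprn_ge0// mulr_ge0.
    have h := vol_cmp A (Fo W) (Fo (X n)) L (e / 4 ^+ n) r (fc _ cW) (fc _ (cX n)) L1 en0 r01.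
    apply: le_trans (h _) _; last first.
      rewrite mulrAC ler_wpM2r// ler_wpM2l ?divr_ge0 ?exprn_ge0 ?mulr_ge0//.
      by rewrite ler_expR; case/andP: r01 => _ r1; rewrite ler_piMr// mulr_ge0// ltW.
    move=> s s01; rewrite !FoE//; apply: le_trans (fL _ _ _ s01) _.
    rewrite -mulrA ler_wpM2l ?(ltW L0)//.
    have := WP s n; rewrite clip_id// => /le_trans; apply.
    by rewrite ler_peMr ?e1 ?divr_ge0 ?exprn_ge0 ?mulr_ge0//; case/andP: s01.
  have h2 := WP r n.+1; rewrite clip_id// in h2.
  have h3 : 2 * C / 4 ^+ n.+1 <= e / 4 ^+ n.
    by rewrite ler_wpM2l ?mulr_ge0// lef_pV2 ?posrE ?exprn_gt0// exprS ler_peMl ?exprn_ge0//; lra.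
  have := ler_normD (W r - X n.+1 r) (X n.+1 r - vol A (Fo W) r).
  rewrite subrKA -(distrC (vol _ _ _) (X _ _)) => h4.
  have h5 : 0 <= e / 4 ^+ n * expR (2 * L).
    by rewrite mulr_ge0 ?expR_ge0// divr_ge0 ?exprn_ge0// mulr_ge0.
  move: nP; rewrite mulrDl [e * _ / _]mulrAC; lra.
by move=> r r01; rewrite FoE// WV.
Qed.

End Picard.

(** * Shooting *)

Section Shooting.
Context {R : realType} (w K0 eta M : R).
Context (w0 : 0 < w) (K00 : 0 < K0) (eta0 : 0 <= eta) (etaK : 2 * eta <= K0) (M0 : 0 < M).

(** The truncation to [0, M] makes the nonlinearity globally Lipschitz and nonnegative; it is the
    true one as long as the solution lies between 0 and M. *)
Definition source (r a : R) :=
  Krad K0 eta r * clip 0 M a ^+ 5 + w ^+ 2 * clip 0 M a.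

Definition shot (A : R) (F : R -> R) :=
  continuous F /\ forall r, 0 <= r <= 1 -> F r = source r (vol A F r).

Lemma Krad_ge0 (r : R) : 0 <= r <= 1 -> 0 <= Krad K0 eta r.
Proof.
move=> /andP[r0 r1]; rewrite /Krad.
have h : r + r ^+ 2 <= 2 by nra.
have : eta * (r + r ^+ 2) <= eta * 2 by rewrite ler_wpM2l.
move: etaK; lra.
Qed.

Lemma Krad_le (r : R) : 0 <= r -> Krad K0 eta r <= K0.
Proof. by move=> r0; rewrite /Krad gerBl mulr_ge0// addr_ge0// sqr_ge0. Qed.

Let c0M a : 0 <= clip 0 M a <= M. Proof. by apply: clip_in; exact: ltW. Qed.

Lemma source_ge0 (r a : R) : 0 <= r <= 1 -> 0 <= source r a.
Proof.
move=> r01; have /andP[c0 _] := c0M a.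
by rewrite addr_ge0// mulr_ge0 ?exprn_ge0// ?Krad_ge0// ltW.
Qed.

(** The summand 1 only secures the condition [1 <= L] of [vol_cmp]. *)
Definition lip := 1 + 5 * K0 * M ^+ 4 + w ^+ 2.

Lemma lip_ge1 : 1 <= lip.
Proof.
by rewrite /lip -addrA lerDl addr_ge0 ?sqr_ge0// mulr_ge0 ?exprn_ge0// ?mulr_ge0// ltW.
Qed.

Lemma pow5_lip (x y : R) : 0 <= x <= M -> 0 <= y <= M ->
  `|x ^+ 5 - y ^+ 5| <= 5 * M ^+ 4 * `|x - y|.
Proof.
move=> /andP[x0 xM] /andP[y0 yM].
have -> : x ^+ 5 - y ^+ 5 = (x ^+ 4 + x ^+ 3 * y + x ^+ 2 * y ^+ 2 + x * y ^+ 3 + y ^+ 4) * (x - y) by ring.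
rewrite normrM ler_wpM2r//.
have mon i j : (i + j)%N = 4%N -> x ^+ i * y ^+ j <= M ^+ 4.
  by move=> <-; rewrite exprD ler_pM ?exprn_ge0// lerXn2r ?nnegrE ?(ltW M0).
have := mon 4%N 0%N erefl; have := mon 3%N 1%N erefl; have := mon 2%N 2%N erefl.
have := mon 1%N 3%N erefl; have := mon 0%N 4%N erefl.
rewrite !expr0 !expr1 !mulr1 !mul1r ger0_norm; first by lra.
by rewrite !addr_ge0 ?mulr_ge0 ?exprn_ge0.
Qed.

Lemma source_lip (r a b : R) : 0 <= r <= 1 ->
  `|source r a - source r b| <= lip * `|a - b|.
Proof.
move=> r01; have /andP[r0 _] := r01.
have h := clip_lip 0 M a b (ltW M0).
have h5 := pow5_lip _ _ (c0M a) (c0M b).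
have -> : source r a - source r b = Krad K0 eta r * (clip 0 M a ^+ 5 - clip 0 M b ^+ 5)
    + w ^+ 2 * (clip 0 M a - clip 0 M b) by rewrite /source; ring.
apply: le_trans (ler_normD _ _) _; rewrite (normrM (Krad _ _ _)) (normrM (w ^+ 2)) (ger0_norm (Krad_ge0 _ r01)) (ger0_norm (sqr_ge0 w)).
have h1 : Krad K0 eta r * `|clip 0 M a ^+ 5 - clip 0 M b ^+ 5| <= K0 * (5 * M ^+ 4 * `|a - b|).
  rewrite ler_pM ?Krad_ge0 ?Krad_le//; apply: le_trans h5 _.
  by rewrite ler_wpM2l// mulr_ge0 ?exprn_ge0// ltW.
have h2 : w ^+ 2 * `|clip 0 M a - clip 0 M b| <= w ^+ 2 * `|a - b|.
  by rewrite ler_wpM2l// sqr_ge0.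
apply: le_trans (lerD h1 h2) _.
by rewrite /lip; have := normr_ge0 (a - b); lra.
Qed.

Lemma source_cont (U : R -> R) : continuous U ->
  continuous (fun r : R => source (clip 0 1 r) (U (clip 0 1 r))).
Proof.
move=> cU r; rewrite /source /Krad.
have c1 := cont_clip 0 1 r.
have c2 : {for r, continuous (fun r : R => clip 0 M (U (clip 0 1 r)))}.
  apply: (cont_comp (clip 0 M)); last exact: cont_clip.
  by apply: (cont_comp U) => //; exact: cU.
by cont.
Qed.

Lemma shot_exists (A : R) : exists F, shot A F.
Proof.
have [F cF FE] := picard source A lip lip_ge1 (fun r a b => source_lip r a b) source_cont.
by exists F.
Qed.

(** Let [q c] be the maximum of the gap weighted by exp(- 2 lip r). By [vol_cmp] the integral part
    contributes at most a quarter of this maximum, which is absorbed: q(c) <= 2 |A - B|. *)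
Lemma shot_lipschitz (A B : R) (F G : R -> R) : shot A F -> shot B G ->
  `|vol A F 1 - vol B G 1| <= 2 * expR (2 * lip) * `|A - B|.
Proof.
move=> [cF FE] [cG GE].
pose d (r : R) := `|vol A F r - vol B G r|.
have cd (r : R) : 0 <= r -> {for r, continuous d}.
  by move=> r0; rewrite /d; cont; exact: cont_vol.
pose q (r : R) := d r * expR (- (2 * lip * r)).
have cq : {within `[0, 1], continuous q}.
  apply: continuous_within => r; rewrite /= in_itv /= => /andP[r0 _].
  by rewrite /q; cont; exact: cd.
have [c c01 cmax] := EVT_max ler01 cq.
have {}cmax r : 0 <= r <= 1 -> d r <= q c * expR (2 * lip * r).
  move=> r01; have := cmax r (ltac:(by rewrite in_itv)).
  by rewrite {1}/q expRN -ler_pdivlMr ?invr_gt0 ?expR_gt0// invrK.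
have q0 : 0 <= q c by apply: mulr_ge0; rewrite ?normr_ge0 ?expR_ge0.
have lip0 : 0 < lip by apply: lt_le_trans lip_ge1.
have step r : 0 <= r <= 1 -> d r <= `|A - B| + q c / 4 * expR (2 * lip * r).
  move=> r01; rewrite /d.
  have -> : vol A F r - vol B G r = (A - B) + (vol A F r - vol A G r) by rewrite /vol; ring.
  apply: le_trans (ler_normD _ _) _; rewrite lerD2l.
  apply: vol_cmp => //; first exact: lip_ge1.
  move=> s s01; rewrite FE// GE//; apply: le_trans (source_lip _ _ _ s01) _.
  by rewrite -mulrA ler_wpM2l ?(ltW lip0)//; exact: cmax.
have c01' : 0 <= c <= 1 by move: c01; rewrite in_itv.
have dc : d c = q c * expR (2 * lip * c).
  by rewrite /q expRN mulrVK// unitfE gt_eqF// expR_gt0.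
have qc : q c <= 2 * `|A - B|.
  have := step c c01'; rewrite dc.
  have e1 : 1 <= expR (2 * lip * c).
    by rewrite -expR0 ler_expR !mulr_ge0// ?(ltW lip0)//; case/andP: c01'.
  have := ler_wpM2l q0 e1; rewrite mulr1.
  have := normr_ge0 (A - B).
  move: (expR _) `|A - B| (q c) => x y z; lra.
have := cmax 1 (ltac:(by rewrite ler01 lexx)); rewrite mulr1 => /le_trans; apply.
by apply: le_trans (ler_wpM2r (expR_ge0 _) qc) _; rewrite mulrAC.
Qed.

Section OneShot.
Context (A : R) (F : R -> R) (A0 : 0 < A) (AM : A <= M) (sF : shot A F).

Let cF : continuous F := sF.1.
Let FE := sF.2.
Notation U := (vol A F).
Notation U1 := (vol1 F).

Let F_ge0 (r : R) : 0 <= r <= 1 -> 0 <= F r.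
Proof. by move=> r01; rewrite FE// source_ge0. Qed.

Lemma shot_pos_near : exists2 d, 0 < d <= 1 & forall r, 0 <= r <= d -> 0 < U r.
Proof.
have U0 : 0 < U 0 by rewrite vol0.
have c : {for 0, continuous U} by exact: cont_vol.
have /nbhs_ballP[d /= d0 dP] : \forall r \near (0 : R), 0 < U r := near_gt _ U 0 0 c U0.
exists (Num.min 1 (d / 2)); first by rewrite lt_min ltr01 divr_gt0//= ge_min lexx.
move=> r /andP[r0]; rewrite le_min => /andP[_ rd]; apply: dP.
by rewrite -ball_normE /= sub0r normrN ger0_norm//; lra.
Qed.

Lemma source_gt0 (r : R) : 0 <= r <= 1 -> 0 < U r -> 0 < F r.
Proof.
move=> r01 Ur; have cp : 0 < clip 0 M (U r) by rewrite /clip lt_max lt_min Ur M0 orbT.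
rewrite FE// /source; apply: ltr_wpDl.
  by apply: mulr_ge0; [exact: Krad_ge0|rewrite exprn_ge0// ltW].
by rewrite mulr_gt0// exprn_gt0.
Qed.

(** r^2 U' is minus the integral of s^2 F, where F >= 0 on all of [0, 1] thanks to the truncation
    and F > 0 near 0. So a shot keeps decreasing past its first zero, and its sign at 1 decides
    whether it vanished before. *)
Lemma shot_slope (r : R) : 0 < r <= 1 -> U1 r < 0.
Proof.
move=> /andP[r0 r1]; have [d /andP[d0 d1] dP] := shot_pos_near.
have D (t : R) : 0 <= t -> is_derive t 1 (prim (fun s : R => s ^+ 2 * F s)) (t ^+ 2 * F t).
  by move=> t0; apply: der_prim; [exact: conts2F|lra].
pose e := Num.min d r.
have e0 : 0 < e by rewrite lt_min d0.
have ed : e <= d by rewrite ge_min lexx.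
have er : e <= r by rewrite ge_min lexx orbT.
have h1 : prim (fun s : R => s ^+ 2 * F s) 0 < prim (fun s : R => s ^+ 2 * F s) e.
  apply: (deriv_gt0_lt _ (fun t => t ^+ 2 * F t)) => //.
  - by move=> t /andP[t0 _]; exact: der_continuous (D t t0).
  - by move=> t /andP[t0 _]; exact: D (ltW t0).
  - move=> t /andP[t0 te]; rewrite mulr_gt0 ?exprn_gt0//; apply: source_gt0.
      by rewrite (ltW t0) (le_trans (ltW te))// (le_trans er).
    by apply: dP; rewrite (ltW t0) (le_trans (ltW te)).
have h2 : prim (fun s : R => s ^+ 2 * F s) e <= prim (fun s : R => s ^+ 2 * F s) r.
  apply: (deriv_ge0_le _ (fun t => t ^+ 2 * F t)) => //.
  - by move=> t /andP[t0 _]; apply: der_continuous (D t _); apply: le_trans t0; exact: ltW.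
  - by move=> t /andP[t0 _]; apply: D; rewrite ltW// (lt_trans e0).
  - move=> t /andP[t0 tr]; rewrite mulr_ge0 ?sqr_ge0// F_ge0//.
    by rewrite ltW ?(lt_trans e0)//= (le_trans (ltW tr)).
by rewrite /vol1 oppr_lt0 divr_gt0 ?exprn_gt0// (lt_le_trans _ h2)// -(prim0 (fun s : R => s ^+ 2 * F s)).
Qed.

Lemma shot_decr (r s : R) : 0 <= r -> r < s -> s <= 1 -> U s < U r.
Proof.
move=> r0 rs s1; apply: (deriv_lt0_gt _ U1) => //.
- by move=> t /andP[rt _]; apply: cont_vol => //; exact: le_trans rt.
- by move=> t /andP[rt _]; apply: der_vol => //; exact: le_lt_trans rt.
- by move=> t /andP[rt ts]; apply: shot_slope; rewrite (le_lt_trans r0 rt) ltW// (lt_le_trans ts).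
Qed.

Lemma shot_le (r : R) : 0 <= r <= 1 -> U r <= A.
Proof.
move=> /andP[]; rewrite le_eqVlt => /predU1P[<- _|r0 r1]; first by rewrite vol0.
by rewrite -[leRHS](vol0 A F) ltW// shot_decr.
Qed.

Lemma shot_source (r : R) : 0 <= r <= 1 -> 0 <= U r ->
  F r = Krad K0 eta r * U r ^+ 5 + w ^+ 2 * U r.
Proof.
by move=> r01 Ur; rewrite FE// /source clip_id// Ur (le_trans (shot_le r r01)).
Qed.

Lemma shot_solution (z : R) : z <= 1 -> (forall r, 0 < r < z -> 0 <= U r) ->
  radial_solution w K0 eta U U1 0 z.
Proof.
move=> z1 Uz r /andP[r0 rz]; split; first exact: der_vol.
rewrite -shot_source; [exact: der_vol1|by rewrite ltW// (le_trans (ltW rz))|].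
by apply: Uz; rewrite r0.
Qed.

(* Sturm comparison with sin (nu r) / r *)
Lemma small_shot (nu : R) : 0 < nu -> nu < pi -> w ^+ 2 + K0 * A ^+ 4 <= nu ^+ 2 -> 0 < U 1.
Proof.
move=> nu0 nupi cond; rewrite ltNge; apply/negP => U10.
have cU : {within `[0, 1], continuous U}.
  by apply: continuous_within => r; rewrite /= in_itv /= => /andP[r0 _]; exact: cont_vol.
have [z z01 Uz] : exists2 c, c \in `[0, 1]%R & U c = 0.
  apply: IVT => //.
  by rewrite vol0 ge_min U10 orbT le_max (ltW A0).
move: z01; rewrite in_itv /= => /andP[z0 z1].
have zn0 : 0 < z.
  rewrite lt_neqAle z0 andbT; apply/eqP => zE.
  by move: Uz A0; rewrite -zE vol0 => ->; rewrite ltxx.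
have Upos r : 0 <= r -> r < z -> 0 < U r.
  by move=> r0 rz; rewrite -Uz shot_decr.
(* The Wronskian of r U and sin(nu r). Up to the zero [z] it is nonnegative, so r U / sin(nu r) does
   not decrease; yet it is positive before [z] and 0 at [z]. *)
pose N (r : R) := sin (nu * r) * (U r + r * U1 r) - nu * cos (nu * r) * (r * U r).
have sinp r : 0 < r -> r <= z -> 0 < sin (nu * r).
  move=> r0 rz; rewrite sin_gt0_pi// mulr_gt0//=.
  by apply: le_lt_trans nupi; rewrite ler_piMr ?(ltW nu0)// (le_trans rz).
have N_ge0 r : 0 < r -> r < z -> 0 <= N r.
  move=> r0 rz; have -> : 0 = N 0 by rewrite /N mulr0 sin0; ring.
  apply: (deriv_ge0_le N (fun t => sin (nu * t) * (t * (nu ^+ 2 * U t - F t))) 0 r (ltW r0)).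
  - move=> t /andP[t0 _]; have c1 := cont_vol A F t cF t0.
    have c3 := contD U _ t c1 (cont_rvol1 F t cF t0).
    by rewrite /N; apply: contD; [apply: contM => //; cont|cont].
  - move=> t /andP[t0 _]; have d1 := der_vol A F t cF t0; have d2 := der_vol1 F t cF t0.
    have tn0 : t != 0 by rewrite gt_eqF.
    by rewrite /N; der; field.
  - move=> t /andP[t0 tr]; have tz := lt_trans tr rz.
    have t01 : 0 <= t <= 1 by rewrite (ltW t0) (le_trans (ltW tz)).
    have Ut := Upos t (ltW t0) tz.
    rewrite mulr_ge0// ?(ltW (sinp t t0 (ltW tz)))// mulr_ge0 ?(ltW t0)//.
    rewrite shot_source ?(ltW Ut)//.
    have h : Krad K0 eta t * U t ^+ 4 <= K0 * A ^+ 4.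
      have U4 : U t ^+ 4 <= A ^+ 4.
        by apply: lerXn2r; rewrite ?nnegrE ?(ltW Ut) ?(ltW A0)//; exact: shot_le.
      apply: ler_pM => //; [exact: Krad_ge0|by rewrite exprn_ge0// ltW|].
      exact: Krad_le (ltW t0).
    have -> : nu ^+ 2 * U t - (Krad K0 eta t * U t ^+ 5 + w ^+ 2 * U t) =
      (nu ^+ 2 - (w ^+ 2 + Krad K0 eta t * U t ^+ 4)) * U t by ring.
    by rewrite mulr_ge0 ?(ltW Ut)// subr_ge0 (le_trans _ cond)// lerD2l.
(* The quotient is compared on [z/2, z], away from the zero of its denominator at 0. *)
have z20 : 0 < z / 2 by rewrite divr_gt0.
have z2z : z / 2 < z by rewrite ltr_pdivrMr// ltr_pMr//; lra.
have := deriv_ge0_le (fun r : R => r * U r / sin (nu * r)) (fun r => N r / sin (nu * r) ^+ 2) (z / 2) z (ltW z2z).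
have c (r : R) : z / 2 <= r <= z -> {for r, continuous (fun r : R => r * U r / sin (nu * r))}.
  move=> /andP[r1 r2]; have r0 := lt_le_trans z20 r1.
  by cont; [apply: cont_vol => //; exact: ltW|rewrite gt_eqF// sinp].
have d (r : R) : z / 2 < r < z -> is_derive r 1 (fun r : R => r * U r / sin (nu * r)) (N r / sin (nu * r) ^+ 2).
  move=> /andP[r1 r2]; have r0 := lt_trans z20 r1; have d1 := der_vol A F r cF r0.
  have sn0 : sin (nu * r) != 0 by rewrite gt_eqF// sinp// ltW.
  by rewrite /N; der0; [exact: sn0|field].
move=> /(_ c d) h.
have : z / 2 * U (z / 2) / sin (nu * (z / 2)) <= z * U z / sin (nu * z).
  apply: h => r /andP[r1 r2]; have r0 := lt_trans z20 r1.
  by rewrite divr_ge0 ?sqr_ge0// N_ge0.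
rewrite Uz mulr0 mul0r leNgt => /negP; apply.
by rewrite divr_gt0 ?sinp ?(ltW z2z)// mulr_gt0// Upos// ltW.
Qed.

End OneShot.
End Shooting.

(** * Shots from a large initial height *)

Section LargeShot.
Context {R : realType}.

(** Twice the derivative of [invsq] with respect to (s1 / s2)^2, since the derivative of (s1 / s2)^2
    in r is 2 s1 / s2^3, the Wronskian of [s1] and [s2] being constant. By [der_slope] it increases
    where the energy is positive. *)
Definition slope (w beta : R) (U U1 : R -> R) (r : R) :=
  - 2 * s2 w beta r ^+ 3 * wronsk1 w U U1 r / (r * U r) ^+ 3.

Definition invsq (w : R) (U : R -> R) (r : R) := (s1 w r / (r * U r)) ^+ 2.

Lemma der_slope (w beta K0 eta : R) (U U1 : R -> R) (a b r : R) : w != 0 -> r != 0 ->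
  U r != 0 -> a < r < b -> radial_solution w K0 eta U U1 a b ->
  is_derive r 1 (slope w beta U U1)
    (6 * s2 w beta r ^+ 2 * energy w beta K0 eta U U1 r / (r * U r) ^+ 4).
Proof.
move=> w0 r0 Ur rab sol; have [dU dU1] := sol r rab.
have dW := der_wronsk1 w K0 eta U U1 a b r w0 r0 rab sol.
have d2 := der_s2 w beta r w0.
have v0 : (r * U r) ^+ 3 != 0 by rewrite expf_neq0// mulf_neq0.
rewrite /slope; der0; first exact: v0.
by rewrite /energy /wronsk2 /wronsk1 /=; field; rewrite r0 Ur.
Qed.

Lemma der_invsq (w beta K0 eta : R) (U U1 : R -> R) (a b r : R) : w != 0 -> r != 0 ->
  U r != 0 -> s2 w beta r != 0 -> a < r < b -> radial_solution w K0 eta U U1 a b ->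
  is_derive r 1 (invsq w U) (slope w beta U U1 r * s1 w r / s2 w beta r ^+ 3).
Proof.
move=> w0 r0 Ur sr rab sol; have [dU dU1] := sol r rab.
have d1 := der_s1 w r w0.
have v0 : r * U r != 0 by rewrite mulf_neq0.
rewrite /invsq; der0; first exact: v0.
by rewrite /slope /wronsk1 /=; field; rewrite r0 Ur sr.
Qed.

Lemma near_right_pos (h : R -> R) : {for 0, continuous h} -> 0 < h 0 ->
  exists2 d, 0 < d & forall r, 0 <= r <= d -> 0 < h r.
Proof.
move=> ch h0; have /nbhs_ballP[d /= d0 dP] : \forall r \near (0 : R), 0 < h r := near_gt _ h 0 0 ch h0.
exists (d / 2); first by rewrite divr_gt0.
move=> r /andP[r0 rd]; apply: dP; rewrite -ball_normE /= sub0r normrN ger0_norm//; lra.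
Qed.

Lemma s1_le (w r : R) : 0 < w -> 0 <= r -> s1 w r <= r.
Proof.
move=> w0 r0; have wn0 := lt0r_neq0 w0; rewrite -subr_ge0.
have -> : 0 = 0 - s1 w 0 by rewrite /s1 mulr0 sin0 mul0r subr0.
apply: (deriv_ge0_le (fun t => t - s1 w t) (fun t => 1 - s1' w t) 0 r r0).
- by move=> t _; cont; exact: cont_s1.
- by move=> t _; have d := der_s1 w t wn0; der.
- by move=> t _; rewrite subr_ge0 cos_le1.
Qed.

Lemma s1_tangent_bound (w r : R) : 0 < w -> 0 <= r -> s1 w r - r * s1' w r <= w ^+ 2 * r ^+ 3.
Proof.
move=> w0 r0; have wn0 := lt0r_neq0 w0; rewrite -subr_ge0.
pose f (t : R) := w ^+ 2 * t ^+ 3 - (s1 w t - t * s1' w t).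
have -> : 0 = f 0 by rewrite /f /s1 mulr0 sin0; ring.
apply: (deriv_ge0_le f (fun t => w ^+ 2 * t * (3 * t - s1 w t)) 0 r r0).
- have c1 (t : R) := cont_s1 w t wn0; have c2 (t : R) := cont_s1' w t wn0.
  by move=> t _; rewrite /f; cont.
- move=> t _; have d1 := der_s1 w t wn0; have d2 := der_s1' w t wn0.
  by rewrite /f; der; rewrite /=; ring.
- move=> t /andP[t0 _]; rewrite mulr_ge0//; first by rewrite mulr_ge0 ?sqr_ge0// ltW.
  by have := s1_le w t w0 (ltW t0); lra.
Qed.

(** The inequalities r s1' <= s1 <= r and s1 - r s1' <= w^2 r^3 bound the defect below by
    [h r * r ^+ 2] with [h] continuous. Its value h(0) = (4 K0 beta - eta) / 3 is twice [c], which
    leaves room near 0. *)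
Lemma core_constants (w beta K0 eta : R) : 0 < w -> w < pi -> 0 < K0 -> 0 <= eta ->
  2 * eta <= K0 -> eta < 4 * K0 * beta ->
  exists d c : R, [/\ 0 < d, 0 < c & forall r, 0 < r <= d -> r <= 1 ->
    [/\ r / 2 <= s1 w r, 1 / 2 <= s2 w beta r <= 2, K0 / 2 <= Krad K0 eta r &
        c * r ^+ 2 <= defect w beta K0 eta r]].
Proof.
move=> w0 wpi K00 eta0 etaK cond.
have wn0 := lt0r_neq0 w0.
pose c := (4 * K0 * beta - eta) / 6.
have c0 : 0 < c by rewrite divr_gt0// subr_gt0.
have beta0 : 0 < beta.
  by have := le_lt_trans eta0 cond; rewrite pmulr_rgt0// mulr_gt0.
pose h r := 4 / 3 * Krad K0 eta r * (s1' w r * s2' w beta r - w ^+ 2 * r * s2 w beta r)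
   - eta * (1 + 2 * r) * s2 w beta r / 3.
have cK (r : R) : {for r, continuous (Krad K0 eta)} := der_continuous _ _ _ (der_Krad K0 eta r).
have c1 (r : R) := cont_s1 w r wn0; have c2 (r : R) := cont_s1' w r wn0.
have c3 (r : R) := cont_s2 w beta r wn0; have c4 (r : R) := cont_s2' w beta r wn0.
have z1 : s1' w 0 = 1 by rewrite /s1' mulr0 cos0.
have z2 : s2 w beta 0 = 1 by rewrite /s2 mulr0 cos0 sin0 mul0r mulr0 addr0.
have z3 : s2' w beta 0 = beta by rewrite /s2' mulr0 cos0 sin0 mulr0 mulr1 subr0.
have z4 : Krad K0 eta 0 = K0 by rewrite /Krad expr0n addr0 mulr0 subr0.
have [d1 d10 p1] : exists2 d, 0 < d & forall r, 0 <= r <= d -> 0 < h r - c.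
  apply: near_right_pos; first by rewrite /h; cont.
  by rewrite /h z1 z2 z3 z4 /c; move: cond; lra.
have [d2 d20 p2] : exists2 d, 0 < d & forall r, 0 <= r <= d -> 0 < s1' w r - 1 / 2.
  by apply: near_right_pos; [cont|rewrite z1; lra].
have [d3 d30 p3] : exists2 d, 0 < d & forall r, 0 <= r <= d -> 0 < s2 w beta r - 1 / 2.
  by apply: near_right_pos; [cont|rewrite z2; lra].
have [d4 d40 p4] : exists2 d, 0 < d & forall r, 0 <= r <= d -> 0 < 2 - s2 w beta r.
  by apply: near_right_pos; [cont|rewrite z2; lra].
have [d5 d50 p5] : exists2 d, 0 < d & forall r, 0 <= r <= d -> 0 < Krad K0 eta r - K0 / 2.
  by apply: near_right_pos; [cont|rewrite z4; move: K00; lra].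
have [d6 d60 p6] : exists2 d, 0 < d & forall r, 0 <= r <= d -> 0 < s2' w beta r.
  by apply: near_right_pos; [|rewrite z3].
pose d := Num.min d1 (Num.min d2 (Num.min d3 (Num.min d4 (Num.min d5 d6)))).
exists d, c; split=> //; first by rewrite !lt_min d10 d20 d30 d40 d50 d60.
move=> r /andP[r0]; rewrite !le_min => /and5P[r1 r2 r3 r4 /andP[r5 r6]] rle1.
have rr := ltW r0.
have {}p1 := p1 r (ltac:(by rewrite rr)); have {}p2 := p2 r (ltac:(by rewrite rr)).
have {}p3 := p3 r (ltac:(by rewrite rr)); have {}p4 := p4 r (ltac:(by rewrite rr)).
have {}p5 := p5 r (ltac:(by rewrite rr)); have {}p6 := p6 r (ltac:(by rewrite rr)).
have tan := s1_tangent w r w0 wpi (ltac:(by rewrite r0)).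
have tanb := s1_tangent_bound w r w0 rr.
have sle := s1_le w r w0 rr.
split.
- by apply: le_trans tan; rewrite -[r / 2]mulrC mulrC ler_pM2l//; lra.
- by apply/andP; split; lra.
- by lra.
have Kp : 0 < Krad K0 eta r by lra.
have s2p : 0 < s2 w beta r by lra.
apply: (@le_trans _ _ (h r * r ^+ 2)).
  by rewrite ler_wpM2r ?sqr_ge0//; lra.
rewrite /defect /h.
have q1 : - (w ^+ 2 * r ^+ 3) * s2 w beta r <= (r * s1' w r - s1 w r) * s2 w beta r.
  by rewrite ler_wpM2r ?(ltW s2p)//; lra.
have q2 : r ^+ 2 * (s1' w r * s2' w beta r) <= r * s1 w r * s2' w beta r.
  by rewrite mulrA ler_wpM2r ?(ltW p6)// expr2 -mulrA ler_wpM2l.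
have q3 : s1 w r * (eta * r * (1 + 2 * r) * s2 w beta r) <= r * (eta * r * (1 + 2 * r) * s2 w beta r).
  by rewrite ler_wpM2r// !mulr_ge0 ?(ltW s2p)//; lra.
have q4 := ler_wpM2l (ltW Kp) (lerD q1 q2).
move: q3 q4; lra.
Qed.

(** The condition on [beta] says that [s2] is negative at 1. Any zero r that the intermediate value
    theorem gives is the first one, as s2(t) s1(r) = sin(w (r - t)) / w there, and the Wronskian s1
    s2' - s1' s2 = -1 gives the sign of the slope. *)
Lemma first_zero (w beta : R) : 0 < w -> w < pi -> beta < - (w * cos w / sin w) ->
  exists r0 : R, [/\ 0 < r0 < 1, s2 w beta r0 = 0, s2' w beta r0 < 0 &
    forall r, 0 <= r < r0 -> 0 < s2 w beta r].
Proof.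
move=> w0 wpi cond; have wn0 := lt0r_neq0 w0.
have sw : 0 < sin w by rewrite sin_gt0_pi// w0.
have n1 : s2 w beta 1 < 0.
  rewrite /s2 mulr1 -(pmulr_llt0 _ (divr_gt0 w0 sw)).
  have -> : (cos w + beta * (sin w / w)) * (w / sin w) = w * cos w / sin w + beta.
    by field; rewrite wn0 gt_eqF.
  by rewrite addrC -ltrBrDr sub0r.
have p0 : s2 w beta 0 = 1 by rewrite /s2 mulr0 cos0 sin0 mul0r mulr0 addr0.
have cs : {within `[0, 1], continuous (s2 w beta)}.
  by apply: continuous_within => r _; exact: cont_s2.
have [r r01 rz] : exists2 r, r \in `[0, 1]%R & s2 w beta r = 0.
  by apply: IVT => //; rewrite p0 ge_min (ltW n1) orbT le_max ler01.
move: r01; rewrite in_itv /= => /andP[r0 r1].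
have r0' : 0 < r.
  rewrite lt_neqAle r0 andbT; apply/eqP => E; move: rz; rewrite -E p0 => /eqP.
  by rewrite oner_eq0.
have r1' : r < 1.
  rewrite lt_neqAle r1 andbT; apply/eqP => E; move: n1; rewrite -E rz.
  by rewrite ltxx.
have s1p : 0 < s1 w r by apply: s1_gt0 => //; rewrite r0' ltW.
exists r; split => //; first by rewrite r0'.
  have : s1 w r * s2' w beta r = - 1.
    have -> : s1 w r * s2' w beta r = s1' w r * s2 w beta r - (cos (w * r) ^+ 2 + sin (w * r) ^+ 2).
      by rewrite /s1 /s2' /s2 /s1'; field.
    by rewrite rz mulr0 sub0r cos2Dsin2.
  by move=> E; rewrite -(pmulr_rlt0 _ s1p) E; lra.
move=> t /andP[t0 tr].
rewrite -(pmulr_lgt0 _ s1p).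
have -> : s2 w beta t * s1 w r = s1 w t * s2 w beta r + sin (w * (r - t)) / w.
  by rewrite /s1 /s2 mulrBr sinB; field.
rewrite rz mulr0 add0r divr_gt0// sin_gt0_pi// mulr_gt0 ?subr_gt0//=.
by apply: le_lt_trans wpi; rewrite ler_piMr ?(ltW w0)//; lra.
Qed.

End LargeShot.

Section Concentration.
Context {R : realType} (w beta K0 eta d c A : R) (F : R -> R).
Context (w0 : 0 < w) (K00 : 0 < K0) (eta0 : 0 <= eta) (etaK : 2 * eta <= K0).
Context (d0 : 0 < d) (d1 : d < 1) (c0 : 0 < c) (A1 : 1 <= A).
Context (core : forall r, 0 < r <= d ->
    [/\ r / 2 <= s1 w r, 1 / 2 <= s2 w beta r <= 2, K0 / 2 <= Krad K0 eta r &
        c * r ^+ 2 <= defect w beta K0 eta r]).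
Context (sF : shot w K0 eta A A F).
Notation U := (vol A F).
Notation U1 := (vol1 F).
Context (Upos : forall r, 0 <= r < 1 -> 0 < U r).

Let A0 : 0 < A. Proof. exact: lt_le_trans A1. Qed.
Let wn0 : w != 0. Proof. exact: lt0r_neq0. Qed.
Let cF : continuous F. Proof. by case: sF. Qed.
Let Ule (r : R) : 0 <= r <= 1 -> U r <= A.
Proof. exact: (shot_le w K0 eta A w0 eta0 etaK A0 A F A0 sF). Qed.
Let FE (r : R) : 0 <= r < 1 -> F r = Krad K0 eta r * U r ^+ 5 + w ^+ 2 * U r.
Proof.
move=> /andP[r0 r1].
apply: (shot_source w K0 eta A w0 eta0 etaK A0 A F A0 (lexx A) sF).
  by rewrite r0 ltW.
by rewrite ltW// Upos// r0.
Qed.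

Let sol : radial_solution w K0 eta U U1 0 1.
Proof.
apply: (shot_solution w K0 eta A w0 eta0 etaK A0 A F A0 (lexx A) sF) => // r /andP[r0 r1].
by rewrite ltW// Upos// ltW.
Qed.

Let kap := 1 + K0 + w ^+ 2.
Let rho := (kap * A ^+ 2)^-1.
Context (rhod : rho <= d / 2).

Let kap1 : 1 <= kap.
Proof. by rewrite /kap -addrA lerDl addr_ge0 ?sqr_ge0// ltW. Qed.
Let kap0 : 0 < kap. Proof. exact: lt_le_trans kap1. Qed.
Let A2 : 0 < A ^+ 2. Proof. by rewrite exprn_gt0. Qed.
Let rho0 : 0 < rho. Proof. by rewrite invr_gt0 mulr_gt0. Qed.
Let rhoE : kap * A ^+ 2 * rho = 1.
Proof. by rewrite /rho mulfV// gt_eqF// mulr_gt0. Qed.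
Let rd : rho < d. Proof. by apply: le_lt_trans rhod _; move: d0; lra. Qed.

Let cU (r : R) : 0 <= r -> {for r, continuous U}. Proof. exact: cont_vol. Qed.

(** On [0, 1) the source is at most B = kap A^5, so U >= A - B r^2 / 2, and B rho^2 = A / kap <= A.
    This is why [rho] is of order A^-2 and why [kap] collects both terms of the nonlinearity. *)
Let U_half (r : R) : 0 <= r <= rho -> A / 2 <= U r.
Proof.
move=> /andP[r0 rr].
pose B := kap * A ^+ 5.
have B0 : 0 <= B by rewrite mulr_ge0 ?exprn_ge0 ?(ltW kap0) ?(ltW A0).
have r1 : r < 1 by apply: le_lt_trans rr _; apply: lt_trans rd d1.
have FB (s : R) : 0 <= s < 1 -> `|F s| <= B.
  move=> /andP[s0 s1]; have s01 : 0 <= s <= 1 by rewrite s0 ltW.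
  have Us : 0 < U s by apply: Upos; rewrite s0.
  rewrite FE ?s0// ger0_norm; last first.
    by rewrite addr_ge0// mulr_ge0 ?sqr_ge0 ?exprn_ge0 ?(ltW Us)// Krad_ge0.
  have h1 : Krad K0 eta s * U s ^+ 5 <= K0 * A ^+ 5.
    apply: ler_pM; [exact: Krad_ge0|by rewrite exprn_ge0// ltW|exact: Krad_le|].
    by apply: lerXn2r; rewrite ?nnegrE ?(ltW Us) ?(ltW A0)// Ule.
  have h2 : w ^+ 2 * U s <= w ^+ 2 * A ^+ 5.
    rewrite ler_wpM2l ?sqr_ge0//; apply: le_trans (Ule _ s01) _.
    by rewrite -[leLHS]expr1 ler_weXn2l.
  have h3 : 0 <= A ^+ 5 by rewrite exprn_ge0// ltW.
  by apply: le_trans (lerD h1 h2) _; rewrite /B /kap; move: h3; lra.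
have slopeB (s : R) : 0 < s < 1 -> - (B * s) <= U1 s.
  move=> /andP[s0 s1].
  have : `|prim (fun t : R => t ^+ 2 * F t) s| <= B * s ^+ 3.
    apply: (prim_cmp (fun t : R => t ^+ 2 * F t) (fun t => B * t ^+ 3) (fun t => B * (3 * t ^+ 2))).
    - exact: conts2F.
    - exact: ltW.
    - by move=> t _; cont.
    - by rewrite expr0n mulr0.
    - by move=> t _; der; rewrite /=; ring.
    - move=> t /andP[t0 ts]; rewrite normrM (ger0_norm (sqr_ge0 t)).
      have ht := FB t (ltac:(by rewrite (ltW t0) (lt_trans ts))).
      apply: le_trans (ler_wpM2l (sqr_ge0 t) ht) _.
      have : 0 <= B * t ^+ 2 by rewrite mulr_ge0// sqr_ge0.
      lra.
  rewrite ler_norml => /andP[_ h]; rewrite /vol1 lerN2 ler_pdivrMr ?exprn_gt0//.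
  by rewrite -mulrA -exprS.
have : U 0 + B * 0 ^+ 2 / 2 <= U r + B * r ^+ 2 / 2.
  apply: (deriv_ge0_le (fun t => U t + B * t ^+ 2 / 2) (fun t => U1 t + B * t) 0 r r0).
  - by move=> t /andP[t0 _]; have ct := cU t t0; cont.
  - move=> t /andP[t0 _]; have dU := der_vol A F t cF t0.
    by der; rewrite /=; field.
  - move=> t /andP[t0 tr]; have := slopeB t (ltac:(by rewrite t0 (lt_trans tr))).
    by rewrite -subr_ge0 opprK.
rewrite vol0 expr0n mulr0 mul0r addr0 => h.
have : B * r ^+ 2 <= A.
  have h1 : r ^+ 2 <= rho ^+ 2 by rewrite lerXn2r ?nnegrE// ltW.
  apply: le_trans (ler_wpM2l B0 h1) _.
  have -> : B * rho ^+ 2 = A * (kap * A ^+ 2 * rho) ^+ 2 / kap.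
    by rewrite /B; field; rewrite gt_eqF.
  by rewrite rhoE expr1n mulr1 ler_pdivrMr// ler_peMr// ltW.
by move: h; lra.
Qed.

Let E := energy w beta K0 eta U U1.

Let cE (r : R) : 0 <= r -> {for r, continuous E}.
Proof. by move=> r0; apply: cont_energy => //; [exact: cU|exact: cont_rvol1]. Qed.

Let dE (r : R) : 0 < r < 1 -> is_derive r 1 E (r * U r ^+ 6 * defect w beta K0 eta r).
Proof.
move=> r01; have rn0 : r != 0 by case/andP: r01 => /lt0r_neq0.
exact: (der_energy w beta K0 eta U U1 0 1 r wn0 rn0 r01 sol).
Qed.

Let E0 : E 0 = 0.
Proof. by rewrite /E /energy /wronsk1 /s1 mulr0 sin0; ring. Qed.

Let defect_ge0 (r : R) : 0 < r <= d -> 0 <= defect w beta K0 eta r.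
Proof.
by move=> /core[_ _ _]; apply: le_trans; rewrite mulr_ge0 ?sqr_ge0// ltW.
Qed.

Let E_mono (r s : R) : 0 <= r -> r <= s -> s <= d -> E r <= E s.
Proof.
move=> r0 rs sd.
apply: (deriv_ge0_le E (fun t => t * U t ^+ 6 * defect w beta K0 eta t) r s rs).
- by move=> t /andP[rt _]; apply: cE; exact: le_trans rt.
- by move=> t /andP[rt ts]; apply: dE; rewrite (le_lt_trans r0 rt) (lt_trans ts)// (le_lt_trans sd).
- move=> t /andP[rt ts]; have t0 := le_lt_trans r0 rt.
  have td : t <= d by rewrite (le_trans (ltW ts)).
  rewrite mulr_ge0 ?defect_ge0 ?t0// mulr_ge0 ?(ltW t0)// exprn_ge0// ltW// Upos//.
  by rewrite (ltW t0) (le_lt_trans td).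
Qed.

(** Integrating r (A/2)^6 c r^2 up to [rho] gives c A^6 rho^4 / 256, with 256 = 4 . 64 and rho = 1 /
    (kap A^2). *)
Let E_low : c / (256 * kap ^+ 4) / A ^+ 2 <= E rho.
Proof.
pose k := c * (A / 2) ^+ 6.
have : E 0 - k * 0 ^+ 4 / 4 <= E rho - k * rho ^+ 4 / 4.
  apply: (deriv_ge0_le (fun t => E t - k * t ^+ 4 / 4) (fun t => t * U t ^+ 6 * defect w beta K0 eta t - k * t ^+ 3) 0 rho (ltW rho0)).
  - by move=> t /andP[t0 _]; have h := cE t t0; cont.
  - move=> t /andP[t0 tr]; have h := dE t (ltac:(by rewrite t0 (lt_trans tr)// (lt_trans rd))).
    by der; rewrite /=; field.
  - move=> t /andP[t0 tr].
    have [_ _ _ h] := core t (ltac:(by rewrite t0 ltW// (lt_trans tr))).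
    have hU := U_half t (ltac:(by rewrite (ltW t0) ltW)).
    have A20 : 0 <= A / 2 by rewrite divr_ge0// ltW.
    have h6 : (A / 2) ^+ 6 <= U t ^+ 6.
      by rewrite lerXn2r ?nnegrE// (le_trans A20).
    have : (A / 2) ^+ 6 * (c * t ^+ 2) <= U t ^+ 6 * defect w beta K0 eta t.
      by apply: ler_pM => //; [rewrite exprn_ge0|rewrite mulr_ge0 ?sqr_ge0// ltW].
    move=> /(ler_wpM2l (ltW t0)); rewrite /k; lra.
rewrite E0 expr0n mulr0 mul0r subr0 subr_ge0; apply: le_trans.
rewrite /k.
have -> : c * (A / 2) ^+ 6 * rho ^+ 4 / 4 = c / (256 * kap ^+ 4) / A ^+ 2 * (kap * A ^+ 2 * rho) ^+ 4.
  by field; rewrite !gt_eqF.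
by rewrite rhoE expr1n mulr1.
Qed.

Let p0 := K0 * A ^+ 2 / 6 / 256.

Let p0_gt0 : 0 < p0.
Proof. by rewrite /p0 divr_gt0 ?ltr0n// divr_gt0 ?ltr0n// mulr_gt0. Qed.

(** At [rho], W1 <= - K0 A^5 rho^3 / 384 from the bounds of [core] and U >= A/2; with s2 >= 1/2 and
    U <= A the slope is then at least K0 A^2 / 1536 = [p0]. Afterwards it does not decrease, as E >=
    0 up to [d]. *)
Let slope_low (r : R) : rho <= r <= d -> p0 <= slope w beta U U1 r.
Proof.
move=> /andP[rr rled].
have rho1 : 0 <= rho < 1 by rewrite (ltW rho0) (lt_trans rd).
have Up (t : R) : 0 < t <= d -> 0 < U t.
  by move=> /andP[t0 td]; apply: Upos; rewrite (ltW t0) (le_lt_trans td).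
have rhod' : 0 < rho <= d by rewrite rho0 ltW.
pose k := K0 * A ^+ 5 / 128 / 3.
have k0 : 0 <= k by rewrite /k divr_ge0 ?ler0n// divr_ge0 ?ler0n// ltW// mulr_gt0// exprn_gt0.
have W1low : wronsk1 w U U1 rho <= - (k * rho ^+ 3).
  rewrite -subr_ge0.
  have -> : 0 = - (k * 0 ^+ 3) - wronsk1 w U U1 0.
    by rewrite /wronsk1 /s1 mulr0 sin0; ring.
  apply: (deriv_ge0_le (fun t => - (k * t ^+ 3) - wronsk1 w U U1 t)
    (fun t => t * s1 w t * Krad K0 eta t * U t ^+ 5 - 3 * k * t ^+ 2) 0 rho (ltW rho0)).
  - move=> t /andP[t0 _].
    have h := cont_wronsk1 w U U1 t wn0 (cU t t0) (cont_rvol1 F t cF t0).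
    by cont.
  - move=> t /andP[t0 tr]; have t1 : 0 < t < 1 by rewrite t0 (lt_trans tr)// (lt_trans rd).
    have h := der_wronsk1 w K0 eta U U1 0 1 t wn0 (lt0r_neq0 t0) t1 sol.
    by der; rewrite /=; ring.
  - move=> t /andP[t0 tr].
    have [h1 _ h2 _] := core t (ltac:(by rewrite t0 ltW// (lt_trans tr))).
    have hU := U_half t (ltac:(by rewrite (ltW t0) ltW)).
    have A20 : 0 <= A / 2 by rewrite divr_ge0// ltW.
    have h5 : (A / 2) ^+ 5 <= U t ^+ 5 by rewrite lerXn2r ?nnegrE// (le_trans A20).
    have t20 : 0 <= t / 2 by rewrite divr_ge0// ltW.
    have K20 : 0 <= K0 / 2 by rewrite divr_ge0// ltW.
    have : t / 2 * (K0 / 2) * (A / 2) ^+ 5 <= s1 w t * Krad K0 eta t * U t ^+ 5.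
      exact: ler_pM (mulr_ge0 t20 K20) (exprn_ge0 5 A20) (ler_pM t20 K20 h1 h2) h5.
    move=> /(ler_wpM2l (ltW t0)); rewrite subr_ge0 /k; lra.
have base : p0 <= slope w beta U U1 rho.
  have [_ /andP[s2l _] _ _] := core rho rhod'.
  have Ur := Up rho rhod'.
  have v0 : 0 < (rho * U rho) ^+ 3 by rewrite exprn_gt0// mulr_gt0.
  rewrite /slope ler_pdivlMr//.
  have h1 : (rho * U rho) ^+ 3 <= (rho * A) ^+ 3.
    rewrite lerXn2r ?nnegrE ?mulr_ge0 ?(ltW rho0) ?(ltW Ur) ?(ltW A0)// ler_wpM2l ?(ltW rho0)//.
    by rewrite Ule// (ltW rho0) ltW// (lt_trans rd).
  have p00 : 0 <= p0 := ltW p0_gt0.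
  apply: le_trans (ler_wpM2l p00 h1) _.
  have s23 : (1 / 2) ^+ 3 <= s2 w beta rho ^+ 3.
    by rewrite lerXn2r ?nnegrE//; move: s2l; lra.
  have kr : 0 <= k * rho ^+ 3.
    exact: mulr_ge0 k0 (exprn_ge0 3 (ltW rho0)).
  have h2 : (1 / 2) ^+ 3 * (k * rho ^+ 3) <= s2 w beta rho ^+ 3 * - wronsk1 w U U1 rho.
    by apply: ler_pM => //; rewrite lerNr.
  have -> : p0 * (rho * A) ^+ 3 = 2 * ((1 / 2) ^+ 3 * (k * rho ^+ 3)).
    by rewrite /p0 /k; field.
  by move: h2; lra.
apply: le_trans base _.
apply: (deriv_ge0_le (slope w beta U U1)
  (fun t => 6 * s2 w beta t ^+ 2 * E t / (t * U t) ^+ 4) rho r rr).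
- move=> t /andP[rt tr]; have t0 := lt_le_trans rho0 rt.
  have c1 := cont_wronsk1 w U U1 t wn0 (cU t (ltW t0)) (cont_rvol1 F t cF (ltW t0)).
  have c2 := cont_s2 w beta t wn0; have c3 := cU t (ltW t0).
  rewrite /slope; cont.
  by rewrite expf_neq0// mulf_neq0// gt_eqF// Up// t0 (le_trans tr).
- move=> t /andP[rt tr]; have t0 := lt_trans rho0 rt.
  have td : 0 < t <= d by rewrite t0 ltW// (lt_le_trans tr).
  have t1 : 0 < t < 1 by rewrite t0 (lt_trans tr)// (le_lt_trans rled).
  exact: (der_slope w beta K0 eta U U1 0 1 t wn0 (lt0r_neq0 t0) (lt0r_neq0 (Up t td)) t1 sol).
- move=> t /andP[rt tr]; have t0 := lt_trans rho0 rt.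
  have td : 0 < t <= d by rewrite t0 ltW// (lt_le_trans tr).
  have Et : 0 <= E t by rewrite -E0; apply: E_mono => //; [exact: ltW|case/andP: td].
  apply: divr_ge0; last by rewrite exprn_ge0// ltW// mulr_gt0// Up.
  by apply: mulr_ge0 => //; rewrite mulr_ge0// sqr_ge0.
Qed.

(** [slope_low] makes the derivative of [invsq] at least p0 t / 16. From rho <= d/2 to d this yields
    p0 d^2 / 64 at least, while [invsq] at d is at most U(d)^-2; 384 . 256 is 64 . 1536. *)
Let U_outer : U d ^+ 2 <= (384 * 256) / (K0 * d ^+ 2) / A ^+ 2.
Proof.
have Up (t : R) : 0 < t <= d -> 0 < U t.
  by move=> /andP[t0 td]; apply: Upos; rewrite (ltW t0) (le_lt_trans td).
have p00 := p0_gt0.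
have : invsq w U rho - p0 / 32 * rho ^+ 2 <= invsq w U d - p0 / 32 * d ^+ 2.
  apply: (deriv_ge0_le (fun t => invsq w U t - p0 / 32 * t ^+ 2)
    (fun t => slope w beta U U1 t * s1 w t / s2 w beta t ^+ 3 - p0 / 16 * t) rho d (ltW rd)).
  - move=> t /andP[rt td]; have t0 := lt_le_trans rho0 rt.
    have c1 := cont_s1 w t wn0; have c3 := cU t (ltW t0).
    rewrite /invsq; cont.
    by rewrite mulf_neq0// gt_eqF// Up// t0.
  - move=> t /andP[rt td]; have t0 := lt_trans rho0 rt.
    have td' : 0 < t <= d by rewrite t0 ltW.
    have t1 : 0 < t < 1 by rewrite t0 (lt_trans td).
    have [_ /andP[s2l _] _ _] := core t td'.
    have s2n : s2 w beta t != 0 by rewrite gt_eqF//; move: s2l; lra.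
    have h := der_invsq w beta K0 eta U U1 0 1 t wn0 (lt0r_neq0 t0) (lt0r_neq0 (Up t td')) s2n t1 sol.
    by der; rewrite /=; field.
  - move=> t /andP[rt td]; have t0 := lt_trans rho0 rt.
    have td' : 0 < t <= d by rewrite t0 ltW.
    have [h1 /andP[s2l s2u] _ _] := core t td'.
    have s2p : 0 < s2 w beta t by move: s2l; lra.
    have hp := slope_low t (ltac:(by rewrite (ltW rt) (ltW td))).
    have h3 : 8^-1 <= (s2 w beta t ^+ 3)^-1.
      rewrite lef_pV2 ?posrE ?exprn_gt0//.
      have -> : 8 = 2 ^+ 3 :> R by rewrite -natrX.
      by rewrite lerXn2r ?nnegrE ?(ltW s2p).
    have t20 : 0 <= t / 2 by rewrite divr_ge0// ltW.
    have : p0 * (t / 2) * 8^-1 <= slope w beta U U1 t * s1 w t * (s2 w beta t ^+ 3)^-1.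
      have i8 : 0 <= 8^-1 :> R by rewrite invr_ge0.
      exact: ler_pM (mulr_ge0 (ltW p00) t20) i8 (ler_pM (ltW p00) t20 hp h1) h3.
    by rewrite subr_ge0; apply: le_trans; lra.
have q0 : 0 <= invsq w U rho by rewrite /invsq sqr_ge0.
have rd2 : rho ^+ 2 <= (d / 2) ^+ 2 by rewrite lerXn2r ?nnegrE ?(ltW rho0)// divr_ge0// ltW.
have := ler_wpM2l (ltW p00) rd2 => h1 h2.
have h3 : p0 * d ^+ 2 / 64 <= invsq w U d.
  have : 0 <= p0 * d ^+ 2 by rewrite mulr_ge0 ?sqr_ge0// ltW.
  by move: h1 h2 q0; lra.
have Ud := Up d (ltac:(by rewrite d0 lexx)).
have sd := s1_le w d w0 (ltW d0).
have [sd' _ _ _] := core d (ltac:(by rewrite d0 lexx)).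
have h4 : invsq w U d <= (U d ^+ 2)^-1.
  rewrite /invsq expr_div_n ler_pdivrMr ?exprn_gt0 ?mulr_gt0//.
  have -> : (U d ^+ 2)^-1 * (d * U d) ^+ 2 = d ^+ 2 by field; rewrite gt_eqF.
  by rewrite lerXn2r ?nnegrE ?(ltW d0)// (le_trans _ sd')// divr_ge0// ltW.
have h5 := le_trans h3 h4.
have h6 : 0 < p0 * d ^+ 2 / 64 by rewrite divr_gt0// mulr_gt0// exprn_gt0.
rewrite -[leLHS]invrK.
have -> : (384 * 256) / (K0 * d ^+ 2) / A ^+ 2 = (p0 * d ^+ 2 / 64)^-1.
  by rewrite /p0; field; rewrite !gt_eqF.
by rewrite lef_pV2 ?posrE// invr_gt0 exprn_gt0.
Qed.

(** The incompatibility for large heights, stated as a bound on A^4: the gain of order A^-2 made by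
    E near 0 has to be undone between [d] and [r0], where U^6 is of order A^-6. *)
Lemma concentration (Cd r0 : R) : d < r0 -> r0 < 1 -> 0 <= Cd ->
  (forall r, 0 <= r <= 1 -> - Cd <= defect w beta K0 eta r) ->
  energy w beta K0 eta U U1 r0 <= 0 ->
  A ^+ 4 * (c / (256 * kap ^+ 4)) <= Cd * ((384 * 256) / (K0 * d ^+ 2)) ^+ 3.
Proof.
move=> dr0 r01 Cd0 hCd Er0.
set H := (384 * 256) / (K0 * d ^+ 2).
have U6 (t : R) : d <= t < 1 -> 0 <= U t ^+ 6 <= H ^+ 3 / A ^+ 6.
  move=> /andP[dt t1]; have t0 := lt_le_trans d0 dt.
  have Ut : 0 < U t by apply: Upos; rewrite ltW.
  rewrite exprn_ge0 ?(ltW Ut)//=.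
  have UtUd : U t <= U d.
    move: dt; rewrite le_eqVlt => /predU1P[->//|dt].
    by apply/ltW/(shot_decr w K0 eta A w0 eta0 etaK A0 A F A0 sF d t) => //; exact: ltW.
  have Ud : 0 < U d by apply: lt_le_trans UtUd.
  have h : U t ^+ 2 <= H / A ^+ 2.
    by apply: le_trans U_outer; rewrite lerXn2r ?nnegrE ?(ltW Ut) ?(ltW Ud).
  have -> : H ^+ 3 / A ^+ 6 = (H / A ^+ 2) ^+ 3 by field; rewrite gt_eqF.
  have -> : U t ^+ 6 = (U t ^+ 2) ^+ 3 by rewrite -exprM.
  by rewrite lerXn2r ?nnegrE ?sqr_ge0// (le_trans _ h)// sqr_ge0.
pose k := Cd * (H ^+ 3 / A ^+ 6).
have k0 : 0 <= k.
  rewrite mulr_ge0//; have /andP[h1 h2] := U6 d (ltac:(by rewrite lexx d1)).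
  exact: le_trans h2.
have : E d + k * d <= E r0 + k * r0.
  apply: (deriv_ge0_le (fun t => E t + k * t)
    (fun t => t * U t ^+ 6 * defect w beta K0 eta t + k) d r0 (ltW dr0)).
  - by move=> t /andP[dt _]; have h := cE t (le_trans (ltW d0) dt); cont.
  - move=> t /andP[dt tr]; have h := dE t (ltac:(by rewrite (lt_trans d0 dt) (lt_trans tr))).
    by der; rewrite /=; ring.
  - move=> t /andP[dt tr]; have t0 := lt_trans d0 dt; have t1 := lt_trans tr r01.
    have /andP[u0 u1] := U6 t (ltac:(by rewrite (ltW dt))).
    have hd := hCd t (ltac:(by rewrite (ltW t0) (ltW t1))).
    have h1 : t * U t ^+ 6 <= H ^+ 3 / A ^+ 6.
      by apply: le_trans u1; rewrite ler_piMl// ltW.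
    have tu : 0 <= t * U t ^+ 6 by rewrite mulr_ge0// ltW.
    have h2 := ler_wpM2l tu hd.
    have h3 := ler_wpM2l Cd0 h1.
    by rewrite /k; move: h2 h3; lra.
have := E_low; have := E_mono rho d (ltW rho0) (ltW rd) (lexx d).
have : k * r0 <= k by rewrite ler_piMr// ltW.
have : 0 <= k * d by rewrite mulr_ge0// ltW.
rewrite -/(E r0) in Er0 => h1 h2 h3 h4 h5.
have : c / (256 * kap ^+ 4) / A ^+ 2 <= k by move: h1 h2 h3 h4 h5 Er0; lra.
rewrite ler_pdivrMr//.
have A4 : 0 < A ^+ 4 by rewrite exprn_gt0.
move=> /(ler_wpM2l (ltW A4)) /le_trans; apply.
by rewrite /k le_eqVlt; apply/orP; left; apply/eqP; field; rewrite gt_eqF.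
Qed.

End Concentration.

Section ShootingMethod.
Context {R : realType} (w K0 eta : R).
Context (w0 : 0 < w) (wpi : w < pi) (K00 : 0 < K0) (eta0 : 0 <= eta) (etaK : 2 * eta <= K0).
Context (cond : eta < 4 * K0 * (- (w * cos w / sin w))).

(** The height serves also as truncation level, since shots decrease. In [shooting] this same level
    truncates all the shots of smaller height, so that they belong to one continuous family. *)
Lemma large_shot : exists2 A : R, 1 <= A &
  forall F, shot w K0 eta A A F -> vol A F 1 < 0.
Proof.
have wn0 := lt0r_neq0 w0.
pose t := - (w * cos w / sin w).
(* The midpoint of the interval that the hypothesis makes nonempty: above eta / (4 K0) the defect is
   positive near 0, below - w cot w the zero of [s2] falls before 1. *)
pose beta := (eta / (4 * K0) + t) / 2.
have K04 : 0 < 4 * K0 by rewrite mulr_gt0.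
have et : eta / (4 * K0) < t by rewrite ltr_pdivrMr// mulrC.
have bt : beta < t by rewrite /beta; move: et; lra.
have be : eta < 4 * K0 * beta.
  by rewrite mulrC -ltr_pdivrMr//; rewrite /beta; move: et; lra.
have [r0 [/andP[r00 r01] s20 s2s _]] := first_zero w beta w0 wpi bt.
have [d' [c [d'0 c0 core']]] := core_constants w beta K0 eta w0 wpi K00 eta0 etaK be.
pose d := Num.min d' (r0 / 2).
have d0 : 0 < d by rewrite lt_min d'0 divr_gt0.
have dr0 : d < r0.
  by apply: (@le_lt_trans _ _ (r0 / 2)); [rewrite ge_min lexx orbT|move: r00; lra].
have d1 : d < 1 := lt_trans dr0 r01.
have core (r : R) : 0 < r <= d -> [/\ r / 2 <= s1 w r, 1 / 2 <= s2 w beta r <= 2,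
    K0 / 2 <= Krad K0 eta r & c * r ^+ 2 <= defect w beta K0 eta r].
  move=> /andP[rp rled]; apply: core'.
    by rewrite rp (le_trans rled)// ge_min lexx.
  by rewrite (le_trans rled)// ltW.
have cdef : continuous (defect w beta K0 eta).
  move=> r; rewrite /defect /Krad.
  have c1 := cont_s1 w r wn0; have c2 := cont_s1' w r wn0.
  have c3 := cont_s2 w beta r wn0; have c4 := cont_s2' w beta r wn0.
  by cont.
have [Cd Cd0 CdP] := cont_bounded _ 0 1 cdef.
pose kap := 1 + K0 + w ^+ 2.
have kap1 : 1 <= kap by rewrite /kap -addrA lerDl addr_ge0 ?sqr_ge0// ltW.
have kap0 : 0 < kap := lt_le_trans ltr01 kap1.
pose c1 := c / (256 * kap ^+ 4).
have c10 : 0 < c1 by rewrite /c1 divr_gt0 ?mulr_gt0 ?ltr0n ?exprn_gt0.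
pose X := Cd * ((384 * 256) / (K0 * d ^+ 2)) ^+ 3.
have X0 : 0 <= X.
  apply: mulr_ge0; first exact: Cd0.
  apply: exprn_ge0; apply: divr_ge0.
    by rewrite mulr_ge0 ?ler0n.
  by rewrite mulr_ge0 ?sqr_ge0// ltW.
have kd : 0 < kap * d by rewrite mulr_gt0.
(* The second term ensures rho <= d/2, the third contradicts the bound of [concentration], since A^4
   >= A > X / c1. *)
pose A := 1 + 2 / (kap * d) + X / c1.
have q1 : 0 < 2 / (kap * d) by rewrite divr_gt0.
have q2 : 0 <= X / c1 by rewrite divr_ge0// ltW.
have A1 : 1 <= A by rewrite /A -addrA lerDl addr_ge0// ltW.
have A0 : 0 < A := lt_le_trans ltr01 A1.
exists A => // F sF; rewrite ltNge; apply/negP => U1pos.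
have Upos (r : R) : 0 <= r < 1 -> 0 < vol A F r.
  move=> /andP[rp rlt]; apply: le_lt_trans U1pos _.
  exact: (shot_decr w K0 eta A w0 eta0 etaK A0 A F A0 sF).
have rhod : ((1 + K0 + w ^+ 2) * A ^+ 2)^-1 <= d / 2.
  rewrite -/kap invf_ple ?posrE ?mulr_gt0 ?exprn_gt0 ?divr_gt0//.
  have -> : (d / 2)^-1 = kap * (2 / (kap * d)) by field; rewrite !gt_eqF.
  rewrite ler_pM2l//; apply: (@le_trans _ _ A).
    by rewrite /A; move: (2 / (kap * d)) (X / c1) q2 => a b hb; move: hb; lra.
  by rewrite expr2 ler_peMr// ltW.
(* As s2(r0) = 0 only W1 W2 is left. W1 decreases from 0, and W2 = - s2'(r0) r0 U(r0) is
   positive. *)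
have Er0 : energy w beta K0 eta (vol A F) (vol1 F) r0 <= 0.
  have cF : continuous F by case: sF.
  have sol : radial_solution w K0 eta (vol A F) (vol1 F) 0 1.
    apply: (shot_solution w K0 eta A w0 eta0 etaK A0 A F A0 (lexx A) sF) => // r /andP[rp rlt].
    by rewrite ltW// Upos// ltW.
  rewrite /energy s20 mulr0 !mul0r addr0 mulr_le0_ge0//.
    have -> : 0 = wronsk1 w (vol A F) (vol1 F) 0 by rewrite /wronsk1 /s1 mulr0 sin0; ring.
    apply: (deriv_le0_ge (wronsk1 w (vol A F) (vol1 F))
      (fun r => - r * s1 w r * Krad K0 eta r * vol A F r ^+ 5) 0 r0 (ltW r00)).
    - move=> r /andP[rp _]; apply: cont_wronsk1 => //; first exact: cont_vol.
      exact: cont_rvol1.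
    - move=> r /andP[rp rr0]; have r01' : 0 < r < 1 by rewrite rp (lt_trans rr0).
      exact: (der_wronsk1 w K0 eta _ _ 0 1 r wn0 (lt0r_neq0 rp) r01' sol).
    - move=> r /andP[rp rr0]; have r01' : 0 < r <= 1 by rewrite rp ltW// (lt_trans rr0).
      have h1 := s1_gt0 w r w0 wpi r01'.
      have h2 := Krad_ge0 K0 eta eta0 etaK r (ltac:(by case/andP: r01' => /ltW -> ->)).
      have h3 := Upos r (ltac:(by rewrite (ltW rp) (lt_trans rr0))).
      rewrite !mulNr oppr_le0; apply: mulr_ge0; last by rewrite exprn_ge0// ltW.
      by apply: mulr_ge0 => //; apply: mulr_ge0; exact: ltW.
  rewrite /wronsk2 s20 mul0r sub0r -mulNr mulr_ge0//; first by rewrite oppr_ge0 ltW.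
  by rewrite mulr_ge0 ?(ltW r00)// ltW// Upos// ltW.
have CdP' (r : R) : 0 <= r <= 1 -> - Cd <= defect w beta K0 eta r.
  by move=> /CdP; rewrite ler_norml => /andP[].
have := concentration w beta K0 eta d c A F w0 K00 eta0 etaK d0 d1 c0 A1 core sF Upos rhod
  Cd r0 dr0 r01 Cd0 CdP' Er0.
rewrite -/kap -/c1 -/X -ler_pdivlMr// leNgt => /negP; apply.
apply: (@lt_le_trans _ _ A); first by rewrite /A ltrDr addr_gt0.
by rewrite -[leLHS]expr1 ler_weXn2l.
Qed.

Lemma shooting : exists (A : R) (F : R -> R), [/\ 0 < A, continuous F,
  forall r : R, 0 <= r <= 1 -> F r = Krad K0 eta r * vol A F r ^+ 5 + w ^+ 2 * vol A F r,
  forall r : R, 0 <= r < 1 -> 0 < vol A F r & vol A F 1 = 0].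
Proof.
have [M M1 MP] := large_shot.
have M0 : 0 < M := lt_le_trans ltr01 M1.
pose F (A : R) := sval (cid (shot_exists w K0 eta M K00 eta0 etaK M0 A)).
have FP (A : R) : shot w K0 eta M A (F A) by exact: (svalP (cid (shot_exists w K0 eta M K00 eta0 etaK M0 A))).
pose S (A : R) := vol A (F A) 1.
pose C := 2 * expR (2 * lip w K0 M).
have C0 : 0 < C by rewrite mulr_gt0 ?expR_gt0.
have SL (A B : R) : `|S A - S B| <= C * `|A - B|.
  exact: (shot_lipschitz w K0 eta M K00 eta0 etaK M0 A B).
have cS : continuous S.
  move=> A; apply/cvgrPdist_lt => e e0; apply/nbhs_ballP; exists (e / C); first by rewrite /= divr_gt0.
  move=> B; rewrite /ball /= => AB; apply: le_lt_trans (SL A B) _.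
  by rewrite mulrC -ltr_pdivlMr.
(* Any frequency strictly between w and pi serves in the Sturm comparison; [A0] is then small enough
   for w^2 + K0 A0^4 <= nu^2. *)
pose nu := (w + pi) / 2.
have nuw : w < nu by rewrite /nu; move: wpi; lra.
have nupi : nu < pi by rewrite /nu; move: wpi; lra.
have nu0 : 0 < nu := lt_trans w0 nuw.
have nu2 : 0 < nu ^+ 2 - w ^+ 2 by rewrite subr_gt0 ltr_pXn2r ?nnegrE ?(ltW w0) ?(ltW nu0).
pose A0 := Num.min 1 ((nu ^+ 2 - w ^+ 2) / K0).
have A00 : 0 < A0 by rewrite lt_min ltr01 divr_gt0.
have A01 : A0 <= 1 by rewrite ge_min lexx.
have A0M : A0 <= M := le_trans A01 M1.
have S0 : 0 < S A0.
  apply: (small_shot w K0 eta M w0 eta0 etaK M0 A0 (F A0) A00 A0M (FP A0) nu nu0 nupi).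
  have : A0 ^+ 4 <= (nu ^+ 2 - w ^+ 2) / K0.
    apply: (@le_trans _ _ A0); last by rewrite ge_min lexx orbT.
    by rewrite -[leRHS]expr1 ler_wiXn2l// ltW.
  by rewrite ler_pdivlMr// mulrC; lra.
have S1 : S M < 0 by apply: MP; exact: FP.
have [A] : exists2 A, A \in `[A0, M]%R & S A = 0.
  apply: IVT => //; first exact: continuous_subspaceT.
  by rewrite ge_min (ltW S1) orbT le_max (ltW S0).
rewrite in_itv /= => /andP[A0A AM] SA0.
have Apos : 0 < A := lt_le_trans A00 A0A.
have Upos (r : R) : 0 <= r < 1 -> 0 < vol A (F A) r.
  move=> /andP[rp rlt]; rewrite -SA0.
  exact: (shot_decr w K0 eta M w0 eta0 etaK M0 A (F A) Apos (FP A)).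
exists A, (F A); split => //; first by case: (FP A).
move=> r r01; apply: (shot_source w K0 eta M w0 eta0 etaK M0 A (F A) Apos AM (FP A)) => //.
move: r01 => /andP[rp]; rewrite le_eqVlt => /predU1P[->|rlt]; first by rewrite -/(S A) SA0.
by rewrite ltW// Upos// rp.
Qed.

End ShootingMethod.

(** * Radial functions in space *)

Section RadialFunction.
Context {R : realType} (A : R) (F : R -> R) (cF : continuous F).
Notation V := 'rV[R]_3.
Notation U := (vol A F).
Notation U1 := (vol1 F).

Definition radial (x : V) : R := U (enorm x).

(** U'(r) / r with its limit at 0, which comes from r^2 U' = - F(0) r^3 / 3 + o(r^3); the plain
    quotient would take the value 0 there. The gradient of the radial function is x times this. *)
Definition quot (r : R) : R := if r == 0 then - (F 0 / 3) else U1 r / r.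

(** The Hessian of a radial function, delta_ij U'/r + (x_i x_j / r^2) (U'' - U'/r), where the
    equation U'' = - 2 U'/r - F has been used. *)
Definition hess (i j : 'I_3) (x : V) : R :=
  (i == j)%:R * quot (enorm x)
  - x ord0 i * x ord0 j / enorm x ^+ 2 * (3 * quot (enorm x) + F (enorm x)).

Lemma quot_near0 (e : R) : 0 < e -> exists2 d, 0 < d & forall r, 0 <= r < d ->
  `|quot r - quot 0| <= e.
Proof.
move=> e0; have /cvgrPdist_lt/(_ e e0)/nbhs_ballP[d /= d0 dP] := cF 0.
exists d => // r /andP[r0 rd]; rewrite /quot eqxx.
case: eqVneq => [_|rn0]; first by rewrite subrr normr0 ltW.
have rp : 0 < r by rewrite lt_neqAle eq_sym rn0.
pose p (t : R) := prim (fun s : R => s ^+ 2 * F s) t.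
have dp (t : R) : 0 <= t -> is_derive t 1 p (t ^+ 2 * F t).
  by move=> t0; apply: der_prim; [exact: conts2F|lra].
pose f0 := F 0.
have near (t : R) : 0 < t < r -> `|f0 - F t| < e.
  move=> /andP[t0 tr]; apply: dP; rewrite -ball_normE /= sub0r normrN gtr0_norm//.
  exact: lt_trans rd.
have p0 : p 0 = 0 by rewrite /p prim0.
have up : p r <= (f0 + e) * r ^+ 3 / 3.
  rewrite -subr_ge0.
  have -> : 0 = (f0 + e) * 0 ^+ 3 / 3 - p 0 by rewrite p0 expr0n mulr0 mul0r subr0.
  apply: (deriv_ge0_le (fun t => (f0 + e) * t ^+ 3 / 3 - p t)
    (fun t => t ^+ 2 * (f0 + e - F t)) 0 r r0).
  - by move=> t /andP[t0 _]; have h := der_continuous _ _ _ (dp t t0); cont.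
  - by move=> t /andP[t0 _]; have h := dp t (ltW t0); der; rewrite /=; field.
  - move=> t /near; rewrite ltr_norml => /andP[h1 h2].
    by rewrite mulr_ge0 ?sqr_ge0//; lra.
have lo : (f0 - e) * r ^+ 3 / 3 <= p r.
  rewrite -subr_ge0.
  have -> : 0 = p 0 - (f0 - e) * 0 ^+ 3 / 3 by rewrite p0 expr0n mulr0 mul0r subr0.
  apply: (deriv_ge0_le (fun t => p t - (f0 - e) * t ^+ 3 / 3)
    (fun t => t ^+ 2 * (F t - (f0 - e))) 0 r r0).
  - by move=> t /andP[t0 _]; have h := der_continuous _ _ _ (dp t t0); cont.
  - by move=> t /andP[t0 _]; have h := dp t (ltW t0); der; rewrite /=; field.
  - move=> t /near; rewrite ltr_norml => /andP[h1 h2].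
    by rewrite mulr_ge0 ?sqr_ge0//; lra.
have r3 : 0 < r ^+ 3 by rewrite exprn_gt0.
have -> : vol1 F r / r = - (p r / r ^+ 3) by rewrite /vol1 -/(p r); field.
have h1 : p r / r ^+ 3 <= (f0 + e) / 3 by rewrite ler_pdivrMr// mulrAC.
have h2 : (f0 - e) / 3 <= p r / r ^+ 3 by rewrite ler_pdivlMr// mulrAC.
by rewrite -/f0 ler_norml; apply/andP; split; lra.
Qed.

Lemma cont_quot (r : R) : 0 < r -> {for r, continuous quot}.
Proof.
move=> r0; have d1 := der_vol1 F r cF r0.
have c : {for r, continuous (fun t => U1 t / t)}.
  by cont; [exact: der_continuous d1|rewrite gt_eqF].
have rE : quot r = U1 r / r by rewrite /quot gt_eqF.
rewrite /prop_for /continuous_at rE; apply: cvg_trans c; apply: near_eq_cvg.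
have : \forall t \near r, 0 < t by apply: (near_gt _ (fun t : R => t)) => //; exact: cont_id.
by apply: filterS => t t0; rewrite /quot gt_eqF.
Qed.

Lemma enorm_gt0 (x : V) : x != 0 -> 0 < enorm x.
Proof.
move=> x0; rewrite lt_neqAle enorm_ge0 andbT eq_sym; apply: contra x0 => /eqP h.
by apply/eqP/dot_eq0; rewrite -enorm_sq h expr0n.
Qed.

Lemma enorm0 : enorm (0 : V) = 0.
Proof. by rewrite enormE dot0l sqrtr0. Qed.

Lemma near_enorm (d : R) : 0 < d -> \forall x \near (0 : V), enorm x < d.
Proof.
by move=> d0; apply: near_lt; [exact: cont_enorm|rewrite enorm0].
Qed.

Lemma cont_quot_enorm (x : V) : {for x, continuous (fun y => quot (enorm y))}.
Proof.
have [->|x0] := eqVneq x 0; last first.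
  by apply: (cont_comp quot); [exact: cont_enorm|apply: cont_quot; exact: enorm_gt0].
apply: cont_eps => e e0; have [d d0 dP] := quot_near0 _ e0.
rewrite enorm0; apply: filterS (near_enorm d d0) => y yd.
by rewrite distrC dP// enorm_ge0.
Qed.

Lemma cont_F_enorm (x : V) : {for x, continuous (fun y => F (enorm y))}.
Proof. by apply: (cont_comp F); [exact: cont_enorm|exact: cF]. Qed.

Lemma cont_radial : continuous radial.
Proof.
by move=> x; apply: (cont_comp U); [exact: cont_enorm|apply: cont_vol => //; exact: enorm_ge0].
Qed.

(** At the origin the factor x_i x_j / |x|^2 has no limit but is bounded by 1, and what it
    multiplies tends to 3 (- F(0) / 3) + F(0) = 0. *)
Lemma cont_hess i j : continuous (hess i j).
Proof.
move=> x.
have c : {for x, continuous (fun y : V => 3 * quot (enorm y) + F (enorm y))}.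
  by cont; [exact: cont_quot_enorm|exact: cont_F_enorm].
have c1 : {for x, continuous (fun y : V => (i == j)%:R * quot (enorm y))}.
  by cont; exact: cont_quot_enorm.
suff c2 : {for x, continuous (fun y : V => y ord0 i * y ord0 j / enorm y ^+ 2 *
    (3 * quot (enorm y) + F (enorm y)))}.
  exact: (contD _ _ _ c1 (contN _ _ c2)).
have [x0|x0] := eqVneq x 0; last first.
  apply: (contM (fun y : V => y ord0 i * y ord0 j / enorm y ^+ 2)) => //.
  cont; try exact: cont_coord; try exact: cont_enorm.
  by rewrite expf_neq0// gt_eqF// enorm_gt0.
subst x; apply: cont_eps => e e0; have := eps_cont _ _ _ c e e0.
have -> : 3 * quot (enorm (0 : V)) + F (enorm (0 : V)) = 0.
  by rewrite enorm0 /quot eqxx; field.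
apply: filterS => y; rewrite !sub0r !normrN mxE !mul0r sub0r normrN => h.
rewrite normrM; apply: le_trans h; rewrite ler_piMl//.
have [->|y0] := eqVneq y 0; first by rewrite mxE !mul0r normr0.
have yp := enorm_gt0 _ y0.
rewrite normrM normfV (ger0_norm (sqr_ge0 _)) ler_pdivrMr ?exprn_gt0// mul1r normrM expr2.
by apply: ler_pM => //; exact: abs_coord_le.
Qed.

Lemma is_derive_line0 (f : V -> R) (x a : V) (d : R) :
  is_derive (0 : R) 1 (fun s : R => f (x + s *: a)) d -> is_derive x a f d.
Proof. by move=> /is_derive_line; rewrite scale0r addr0. Qed.

Lemma der_coord (x v : V) (k : 'I_3) : is_derive x v (fun y : V => y ord0 k) (v ord0 k).
Proof.
apply: is_derive_line0.
have -> : (fun s : R => (x + s *: v) ord0 k) = (fun s => x ord0 k + s * v ord0 k).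
  by apply/funext => s; rewrite !mxE.
by der; rewrite /=; ring.
Qed.

Lemma der_enorm (x v : V) : x != 0 -> is_derive x v (@enorm R) (dot x v / enorm x).
Proof.
move=> x0; have xp := enorm_gt0 _ x0.
have dd : is_derive x v (fun y : V => dot y y) (2 * dot x v).
  apply: is_derive_line0.
  have -> : (fun s : R => dot (x + s *: v) (x + s *: v)) =
      (fun s => dot x x + 2 * s * dot x v + s ^+ 2 * dot v v).
    by apply/funext => s; rewrite !dotE (dotC v x); ring.
  by der; rewrite /=; ring.
have dp : 0 < dot x x by rewrite -enorm_sq exprn_gt0.
have := der_comp Num.sqrt _ _ _ _ _ dd (is_derive1_sqrt dp).
have -> : (fun y : V => Num.sqrt (dot y y)) = @enorm R by apply/funext => y; rewrite enormE.
move=> h; apply: der_eq h _; rewrite -enormE; field.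
by rewrite gt_eqF.
Qed.

Lemma der_radial (x : V) (i : 'I_3) :
  is_derive x (ebase R i) radial (x ord0 i * quot (enorm x)).
Proof.
have [->|x0] := eqVneq x 0; last first.
  have xp := enorm_gt0 _ x0.
  have h := der_comp U _ _ _ _ _ (der_enorm x (ebase R i) x0) (der_vol A F _ cF xp).
  by apply: der_eq h _; rewrite dot_ebase /quot gt_eqF//; field; rewrite gt_eqF.
rewrite mxE mul0r.
(* At the origin: U1 = c quot(c) with [quot] bounded near 0, so U(r) - U(0) = O(r^2) and the
   gradient vanishes. *)
have [d d0 dP] := quot_near0 1 ltr01.
pose B := `|quot 0| + 1.
have B0 : 0 < B by rewrite ltr_wpDl.
have est (r : R) : 0 < r < d -> `|U r - U 0| <= B * r ^+ 2.
  move=> /andP[r0 rd].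
  have cU (t : R) : 0 <= t <= r -> {for t, continuous U}.
    by move=> /andP[t0 _]; exact: cont_vol.
  have dU (t : R) : 0 < t < r -> is_derive t 1 U (U1 t).
    by move=> /andP[t0 _]; exact: der_vol.
  have [c /andP[c0 cr] ->] := mean_value U U1 0 r r0 cU dU.
  rewrite subr0.
  have hc : `|quot c - quot 0| <= 1 by apply: dP; rewrite (ltW c0) (lt_trans cr).
  have qB : `|quot c| <= B.
    by rewrite /B; have := ler_normD (quot c - quot 0) (quot 0); rewrite subrK; move: hc; lra.
  have -> : U1 c = c * quot c by rewrite /quot gt_eqF// mulrC mulfVK// gt_eqF.
  rewrite !normrM (gtr0_norm c0) (gtr0_norm r0) expr2 [B * _]mulrA ler_wpM2r ?(ltW r0)//.
  by rewrite mulrC; apply: ler_pM => //; exact: ltW.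
suff h : (fun h : R => h^-1 *: ((radial \o shift (0 : V)) (h *: ebase R i) - radial 0)) @ 0^' --> (0 : R).
  by apply: DeriveDef; [apply/cvg_ex; eexists; exact: h|exact: cvg_lim h].
apply/cvgrPdist_le => e e0; near=> h.
have hn0 : h != 0 by near: h; exact: nbhs_dnbhs_neq.
have hp : 0 < `|h| by rewrite normr_gt0.
have hd : `|h| < d by near: h; exact: dnbhs0_lt.
have hB : `|h| < e / B by near: h; apply: dnbhs0_lt; rewrite divr_gt0.
rewrite /= sub0r normrN addr0 /radial enorm0 enormE dotZe sqrtr_sqr.
rewrite normrM normfV mulrC ler_pdivrMr//.
apply: le_trans (est _ _) _; first by rewrite hp.
rewrite expr2 mulrA ler_wpM2r// mulrC -ler_pdivlMr// ltW//.
Unshelve. all: by end_near. Qed.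

Lemma partial_radial (i : 'I_3) : partial i radial = fun x => x ord0 i * quot (enorm x).
Proof. by apply/funext => x; rewrite /partial; case: (der_radial x i). Qed.

Lemma der_partial (x : V) (i j : 'I_3) :
  is_derive x (ebase R j) (fun y => y ord0 i * quot (enorm y)) (hess i j x).
Proof.
have [->|x0] := eqVneq x 0; last first.
  have xp := enorm_gt0 _ x0; have xn := lt0r_neq0 xp.
  have dq : is_derive (enorm x) 1 quot (- (3 * quot (enorm x) + F (enorm x)) / enorm x).
    have d1 := der_vol1 F _ cF xp.
    have dq' : is_derive (enorm x) 1 (fun t => U1 t / t)
        (- (3 * quot (enorm x) + F (enorm x)) / enorm x).
      by der0; [exact: xn|rewrite /quot gt_eqF//; field].
    apply: near_is_derive dq'.
    have : \forall t \near enorm x, 0 < t by apply: (near_gt _ (fun t : R => t)) => //; exact: cont_id.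
    by apply: filterS => t t0; rewrite /quot gt_eqF.
  have h1 := der_comp quot _ _ _ _ _ (der_enorm x (ebase R j) x0) dq.
  have h2 := der_coord x (ebase R j) i.
  apply: der_eq (derM _ _ _ _ _ _ h2 h1) _.
  rewrite /hess dot_ebase mxE eqxx /= mulrC; field.
  by [].
rewrite /hess mxE !mul0r subr0.
apply: is_derive_line0.
pose k (t : R) := (i == j)%:R * quot (enorm (t *: ebase R j)).
have ck : {for 0, continuous k}.
  rewrite /k; cont; apply: (cont_compT _ (fun y : V => quot (enorm y))); last exact: cont_quot_enorm.
  by apply: (contZ V (fun s : R => s) (fun=> ebase R j)); [exact: cont_id|exact: cst_continuous].
have := is_derive_mulid k ck.
have -> : k 0 = (i == j)%:R * quot (enorm (0 : V)) by rewrite /k scale0r.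
have -> // : (fun t : R => t * k t) =
  (fun s : R => (0 + s *: ebase R j) ord0 i * quot (enorm (0 + s *: ebase R j))).
apply/funext => t; rewrite add0r !mxE eqxx /k mulrA /=; congr (_ * _ * _).
Qed.

Lemma partial_partial_radial (i j : 'I_3) : partial j (partial i radial) = hess i j.
Proof. by rewrite partial_radial; apply/funext => x; rewrite /partial; case: (der_partial x i j). Qed.

Lemma laplacian_radial (x : V) : laplacian radial x = - F (enorm x).
Proof.
rewrite laplacianE !partial_partial_radial /hess !eqxx.
have [->|x0] := eqVneq x 0.
  by rewrite !mxE !mul0r !subr0 !mul1r enorm0 /quot eqxx; field.
have xp := enorm_gt0 _ x0; have xn := lt0r_neq0 xp.
have xE : enorm x ^+ 2 = x ord0 0 * x ord0 0 + x ord0 1 * x ord0 1 + x ord0 2 * x ord0 2.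
  by rewrite enorm_sq; exact: (sum3E (fun i => x ord0 i * x ord0 i)).
have : (x ord0 0 * x ord0 0 + x ord0 1 * x ord0 1 + x ord0 2 * x ord0 2) / enorm x ^+ 2 = 1.
  by rewrite -xE mulfV// expf_neq0.
move: (enorm x ^+ 2)^-1 (quot (enorm x)) (F (enorm x)) => n q f.
move: (x ord0 0) (x ord0 1) (x ord0 2) => a b c h.
have -> : a * a * n = 1 - b * b * n - c * c * n by move: h; lra.
by rewrite !mul1r /=; ring.
Qed.

Lemma C2_radial : C2_ucball radial.
Proof.
split.
- exact: continuous_subspaceT cont_radial.
- by move=> i x _; case: (der_radial x i).
- by move=> i j x _; rewrite partial_radial; case: (der_partial x i j).
- move=> i; exists (fun x : V => x ord0 i * quot (enorm x)); last by move=> x _; rewrite partial_radial.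
  apply: continuous_subspaceT => x.
  by apply: (contM (fun y : V => y ord0 i)); [exact: cont_coord|exact: cont_quot_enorm].
- move=> i j; exists (hess i j); last by move=> x _; rewrite partial_partial_radial.
  by apply: continuous_subspaceT; exact: cont_hess.
Qed.

End RadialFunction.

Lemma existence {R : realType} (mu K0 eta : R) (K : 'rV[R]_3 -> R) :
  0 < mu -> mu < pi ^+ 2 -> 0 < K0 -> 0 <= eta ->
  (forall x, uball R x -> K x = K0 - eta * (enorm x + enorm x ^+ 2)) ->
  (forall x, uball R x -> 0 <= K x) ->
  eta < 4 * K0 * (- (Num.sqrt mu * cos (Num.sqrt mu) / sin (Num.sqrt mu))) ->
  exists u, is_solution K mu u.
Proof.
move=> mu0 mupi K00 eta0 KE K_ge0 cond.
set w := Num.sqrt mu in cond *.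
have w0 : 0 < w by rewrite sqrtr_gt0.
have wE : w ^+ 2 = mu by rewrite sqr_sqrtr// ltW.
have wpi : w < pi by rewrite -(@ltr_pXn2r _ 2) ?nnegrE ?pi_ge0 ?(ltW w0)// wE.
have etaK := coefficient_bound _ _ _ eta0 KE K_ge0.
have [A [F [A0 cF FE Upos U1]]] := shooting w K0 eta w0 wpi K00 eta0 etaK cond.
exists (radial A F); split.
- exact: C2_radial.
- move=> x ux; rewrite laplacian_radial// opprK FE ?enorm_ge0 ?(ltW ux)//.
  by rewrite wE KE.
- by move=> x ux; apply: Upos; rewrite enorm_ge0.
- by move=> x ux; rewrite /radial ux.
Qed.

(** * Integration by parts for radial fields *)

Section ProductIntegral.
Context {R : realType}.

Lemma bounded_support_integrable d (T : measurableType d)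
    (m : {measure set T -> \bar R}) (D : set T) (f : T -> R) (M : R) :
  measurable D -> (m D < +oo)%E -> measurable_fun setT f ->
  (forall x, `|f x| <= M) -> (forall x, ~ D x -> f x = 0) ->
  m.-integrable setT (EFin \o f).
Proof.
move=> mD fD mf fM f0.
have -> : EFin \o f = (EFin \o f) \_ D.
  apply/funext => x; rewrite patchE; case: ifPn => // /negP h /=.
  by rewrite f0//; move=> Dx; apply: h; rewrite inE.
apply: (integrable_mkcond _ mD).1; apply: measurable_bounded_integrable => //.
- exact: measurable_funS mf.
- by exists M; split; [exact: num_real|move=> N MN x _ /=; exact: le_trans (fM x) (ltW MN)].
Qed.

Lemma fubini_snd_eq0 d1 d2 (T1 : measurableType d1) (T2 : measurableType d2)
    (m1 : {sigma_finite_measure set T1 -> \bar R})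
    (m2 : {sigma_finite_measure set T2 -> \bar R}) (f : T1 * T2 -> R) :
  (m1 \x m2)%E.-integrable setT (EFin \o f) ->
  (forall x, \int[m2]_y (f (x, y))%:E = 0)%E ->
  (\int[m1 \x m2]_p (f p)%:E = 0)%E.
Proof.
move=> fi f0; have <- := integral12_prod_meas1 fi.
by rewrite integral0_eq// => x _; exact: f0.
Qed.

Lemma fubini_fst_eq0 d1 d2 (T1 : measurableType d1) (T2 : measurableType d2)
    (m1 : {sigma_finite_measure set T1 -> \bar R})
    (m2 : {sigma_finite_measure set T2 -> \bar R}) (f : T1 * T2 -> R) :
  (m1 \x m2)%E.-integrable setT (EFin \o f) ->
  (forall y, \int[m1]_x (f (x, y))%:E = 0)%E ->
  (\int[m1 \x m2]_p (f p)%:E = 0)%E.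
Proof.
move=> fi f0; have <- := integral21_prod_meas1 fi.
by rewrite integral0_eq// => x _; exact: f0.
Qed.

Lemma integral_derive_eq0 (h h' : R -> R) (b : R) : 0 < b ->
  (forall t : R, is_derive t 1 h (h' t)) -> continuous h' ->
  (forall t : R, b <= `|t| -> h t = 0) -> (forall t : R, b <= `|t| -> h' t = 0) ->
  (\int[@lebesgue_measure R]_t (h' t)%:E = 0)%E.
Proof.
move=> b0 dh ch h0 h'0.
have -> : (fun t => (h' t)%:E) = (fun t => (h' t)%:E) \_ `[-b, b].
  apply/funext => t; rewrite patchE; case: ifPn => // /negP tb.
  rewrite h'0// leNgt; apply/negP => lt_tb; apply: tb.
  by rewrite inE /= in_itv/= -ler_norml ltW.
rewrite -integral_mkcond (@continuous_FTC2 R h' h).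
- by rewrite !h0 ?normrN ?(gtr0_norm b0)// subee.
- by rewrite gtrN.
- exact: continuous_subspaceT.
- have ct (t : R) : {for t, continuous h} by exact: der_continuous (dh t).
  split.
  + by move=> t _; case: (dh t).
  + exact/cvg_at_right_filter/ct.
  + exact/cvg_at_left_filter/ct.
- by move=> t _; rewrite derive1E; case: (dh t).
Qed.

Notation T := (measurableTypeR R).
Notation V := 'rV[R]_3.

Lemma row3E (x y z : R) : row3 ((x, y), z) =
  x *: ebase R 0 + y *: ebase R 1 + z *: ebase R 2.
Proof.
rewrite [LHS]row3_expand; congr (_ *: _ + _ *: _ + _ *: _); by rewrite mxE.
Qed.

Lemma measurable_row3 (i : 'I_3) :
  measurable_fun setT (fun p : T * T * T => row3 p ord0 i).
Proof.
have m1 : measurable_fun setT (fun p : T * T * T => p.1) by exact: measurable_fst.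
case: i => -[|[|[|//]]] ip.
- rewrite (_ : (fun _ => _) = (fun p : T * T * T => p.1.1)); last by apply/funext => p; rewrite mxE.
  exact: (measurableT_comp (@measurable_fst _ _ _ _) m1).
- rewrite (_ : (fun _ => _) = (fun p : T * T * T => p.1.2)); last by apply/funext => p; rewrite mxE.
  exact: (measurableT_comp (@measurable_snd _ _ _ _) m1).
- rewrite (_ : (fun _ => _) = (fun p : T * T * T => p.2)); last by apply/funext => p; rewrite mxE.
  exact: measurable_snd.
Qed.

Lemma measurable_radial (q : R -> R) : continuous q ->
  measurable_fun setT (fun p : T * T * T => q (enorm (row3 p))).
Proof.
move=> cq; apply: (measurableT_comp (continuous_measurable_fun cq)).
have me : measurable_fun setT (@Num.sqrt R).
  by apply: continuous_measurable_fun; exact: sqrt_continuous.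
apply: (measurableT_comp me).
rewrite (_ : (fun _ => _) = (fun p : T * T * T => row3 p ord0 0 ^+ 2 + row3 p ord0 1 ^+ 2
   + row3 p ord0 2 ^+ 2)); last by apply/funext => p; rewrite sum3E.
by apply: measurable_funD; [apply: measurable_funD|];
  apply: measurable_funX; exact: measurable_row3.
Qed.

Lemma measurable_uball : measurable (@row3 R @^-1` uball R : set (T * T * T)).
Proof.
have := measurable_radial (fun r => r) (fun r => cont_id r) measurableT _ (measurable_itv `]-oo, 1[).
by rewrite setTI; congr measurable; apply/seteqP; split => p /=; rewrite in_itv.
Qed.

End ProductIntegral.

Section PlaneMeasure.
Context {R : realType}.
Notation T := (measurableTypeR R).
(** A name for the plane measure, to which the sigma-finite structure is attached that Fubini's
    theorem requires on the product with the third line. *)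
Definition leb2 : set (T * T) -> \bar R := (@lebesgue_measure R \x @lebesgue_measure R)%E.

HB.instance Definition _ := Measure.on leb2.

Lemma leb2_sigma_finite : sigma_finite setT leb2.
Proof.
have /sigma_finiteP[F [TF ndF Foo]] := @sigma_finiteT _ _ _ (@lebesgue_measure R).
exists (fun n => F n `*` F n).
  rewrite -setXTT TF predeqE => -[x y]; split.
    move=> [/= [n _ Fnx] [k _ Gky]]; exists (maxn n k) => //; split.
    - by move: x Fnx; exact/subsetPset/ndF/leq_maxl.
    - by move: y Gky; exact/subsetPset/ndF/leq_maxr.
  by move=> [n _ []/= ? ?]; split; exists n.
move=> k; have [m1 f1] := Foo k.
split; first exact: measurableX.
have -> : leb2 (F k `*` F k) = (@lebesgue_measure R (F k) * @lebesgue_measure R (F k))%E.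
  exact: product_measure1E.
by apply: lte_mul_pinfty => //; rewrite ge0_fin_numE.
Qed.

HB.instance Definition _ := Measure_isSigmaFinite.Build _ _ _ leb2 leb2_sigma_finite.

Definition leb3 : set (T * T * T) -> \bar R := (leb2 \x @lebesgue_measure R)%E.
HB.instance Definition _ := Measure.on leb3.
Lemma lebesgue3E : lebesgue3 R = leb3 :> (set _ -> \bar R).
Proof. by []. Qed.

Lemma leb3_box (A B C : set T) : measurable A -> measurable B -> measurable C ->
  leb3 ((A `*` B) `*` C) =
  (@lebesgue_measure R A * @lebesgue_measure R B * @lebesgue_measure R C)%E.
Proof.
move=> mA mB mC; have -> : leb3 ((A `*` B) `*` C) = (leb2 (A `*` B) * @lebesgue_measure R C)%E.
  by apply: product_measure1E => //; exact: measurableX.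
by congr (_ * _)%E; exact: product_measure1E.
Qed.

Lemma leb2_box (A B : set T) : measurable A -> measurable B ->
  leb2 (A `*` B) = (@lebesgue_measure R A * @lebesgue_measure R B)%E.
Proof. exact: product_measure1E. Qed.

End PlaneMeasure.

Section RadialDivergence.
Context {R : realType}.
Notation V := 'rV[R]_3.
Notation T := (measurableTypeR R).

Lemma near0_radial (P : R -> R) (a : R) : 0 < a -> (forall r, r < a -> P r = 0) ->
  \forall y \near (0 : V), P (enorm y) = 0.
Proof. by move=> a0 P0; apply: filterS (near_enorm a a0) => y /P0. Qed.

Lemma der_radial_comp (P P' : R -> R) (a : R) : 0 < a ->
  (forall r : R, is_derive r 1 P (P' r)) ->
  (forall r, r < a -> P r = 0) -> (forall r, r < a -> P' r = 0) ->
  forall x v : V, is_derive x v (fun y => P (enorm y)) (P' (enorm x) / enorm x * dot x v).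
Proof.
move=> a0 dP P0 P'0 x v; have [->|x0] := eqVneq x 0; last first.
  have := der_comp P _ _ _ _ _ (der_enorm x v x0) (dP (enorm x)).
  by move=> h; apply: der_eq h _; rewrite mulrAC mulrA.
rewrite dot0l mulr0; apply: is_derive_line0.
apply: (near_is_derive (fun=> 0)).
have c : {for (0 : R), continuous (fun s : R => 0 + s *: v)}.
  apply: (contDv V (fun=> 0)); first exact: cst_continuous.
  by apply: (contZ V (fun s : R => s) (fun=> v)); [exact: cont_id|exact: cst_continuous].
have n0 : nbhs (0 + (0 : R) *: v) [set y | P (enorm y) = 0].
  by rewrite scale0r addr0; exact: near0_radial P0.
have h : \forall s \near (0 : R), P (enorm (0 + s *: v)) = 0 := c _ n0.
by apply: filterS h => s ->.
Qed.

Lemma cont_div_id (q : R -> R) (a : R) : 0 < a -> continuous q ->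
  (forall r, r < a -> q r = 0) -> continuous (fun r => q r / r).
Proof.
move=> a0 cq q0 r; have [->|r0] := eqVneq r 0; last by cont; exact: cq.
apply: cont_eps => e e0; rewrite (q0 0 a0) mul0r.
have : \forall y \near (0 : R), y < a by apply: near_lt => //; exact: cont_id.
by apply: filterS => y /q0 ->; rewrite mul0r subrr normr0 ltW.
Qed.

Lemma shell_bounded (q : R -> R) (b : R) : continuous q -> (forall r, b < r -> q r = 0) ->
  exists2 M, 0 <= M & forall r, 0 <= r -> `|q r| <= M.
Proof.
move=> cq q0; have [M M0 MP] := cont_bounded q 0 b cq.
exists M => // r r0; have [rb|/q0 ->] := leP r b; last by rewrite normr0.
by apply: MP; rewrite r0.
Qed.

Definition seg1 : set T := `[-1, 1]%classic.

Lemma measurable_seg1 : measurable seg1. Proof. exact: measurable_itv. Qed.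

Lemma lebesgue_seg1 : (@lebesgue_measure R seg1 < +oo)%E.
Proof. by rewrite lebesgue_measure_itv/= lte_fin gtrN// -EFinB ltry. Qed.

Section Divergence.
Variables (k k' : R -> R) (a b : R).
Hypotheses (a0 : 0 < a) (b1 : b < 1) (dk : forall r : R, is_derive r 1 k (k' r))
  (ck' : continuous k') (ka : forall r, r < a -> k r = 0) (ka' : forall r, r < a -> k' r = 0)
  (kb : forall r, b < r -> k r = 0) (kb' : forall r, b < r -> k' r = 0).

(** The derivative in direction i of the component x_i k(|x|). The sum over i is the divergence 3 k
    + r k' of the field k(|x|) x. *)
Let dg (i : 'I_3) (x : V) := k (enorm x) + x ord0 i ^+ 2 * (k' (enorm x) / enorm x).

Let ck : continuous k. Proof. by move=> r; exact: der_continuous (dk r). Qed.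

Let cq : continuous (fun r => k' r / r). Proof. exact: cont_div_id ka'. Qed.

Let der_dg (x : V) (i : 'I_3) :
  is_derive x (ebase R i) (fun y : V => y ord0 i * k (enorm y)) (dg i x).
Proof.
have h1 := der_coord x (ebase R i) i.
have h2 := der_radial_comp k k' a a0 dk ka ka' x (ebase R i).
apply: der_eq (derM _ _ _ _ _ _ h1 h2) _.
by rewrite /dg mxE !eqxx dot_ebase /=; ring.
Qed.

Let measurable_dg (i : 'I_3) : measurable_fun setT (fun p : T * T * T => dg i (row3 p)).
Proof.
apply: measurable_funD; first exact: measurable_radial.
apply: measurable_funM; first by apply: measurable_funX; exact: measurable_row3.
exact: (measurable_radial (fun r => k' r / r)).
Qed.

Let dg_bounded : exists M, forall i x, `|dg i x| <= M.
Proof.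
have [M M0 MP] := shell_bounded k b ck kb.
have [N N0 NP] := shell_bounded k' b ck' kb'.
exists (M + N) => i x; apply: le_trans (ler_normD _ _) _; apply: lerD; first exact: MP (enorm_ge0 x).
have [->|x0] := eqVneq x 0; first by rewrite mxE expr0n /= mul0r normr0.
have xp := enorm_gt0 _ x0.
have [xb|bx] := leP (enorm x) b; last by rewrite kb'// mul0r mulr0 normr0.
apply: le_trans (NP _ (ltW xp)).
rewrite mulrCA normrM ler_piMr// normrM normfV (gtr0_norm xp) normrX ler_pdivrMr// mul1r.
rewrite expr2; apply: le_trans (abs_coord_le x i); rewrite ler_piMl//.
by apply: le_trans (abs_coord_le x i) (le_trans xb (ltW b1)).
Qed.

Let dg_line (x0 : V) (i : 'I_3) : x0 ord0 i = 0 ->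
  (\int[@lebesgue_measure R]_t (dg i (x0 + t *: ebase R i))%:E = 0)%E.
Proof.
move=> xi.
have big (t : R) : 1 <= `|t| -> b < enorm (x0 + t *: ebase R i).
  move=> t1; apply: lt_le_trans b1 (le_trans t1 _).
  apply: le_trans (abs_coord_le _ i); rewrite !mxE !eqxx xi /= mulr1 add0r.
  by [].
apply: (integral_derive_eq0
  (fun t : R => (x0 + t *: ebase R i) ord0 i * k (enorm (x0 + t *: ebase R i))) _ 1) => //.
- move=> t; have := der_dg (x0 + t *: ebase R i) i.
  by move/is_derive_line.
- have cl (t : R) : {for t, continuous (fun t : R => x0 + t *: ebase R i)}.
    apply: (contDv V (fun=> x0)); first exact: cst_continuous.
    by apply: (contZ V (fun s : R => s) (fun=> ebase R i)); [exact: cont_id|exact: cst_continuous].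
  have ce (t : R) : {for t, continuous (fun t : R => enorm (x0 + t *: ebase R i))}.
    by apply: (cont_compT V (@enorm R)); [exact: cl|exact: cont_enorm].
  move=> t.
  have c1 := cont_comp k _ t (ce t) (ck _).
  have c2 := cont_compT _ (fun y : V => y ord0 i) _ t (cl t) (cont_coord i _).
  have c3 := cont_comp (fun r => k' r / r) _ t (ce t) (cq _).
  exact: (contD _ _ _ c1 (contM _ _ _ (contX _ 2 _ c2) c3)).
- by move=> t /big/kb ->; rewrite mulr0.
- by move=> t /big tb; rewrite /dg kb ?kb'// mul0r mulr0 addr0.
Qed.

Let II : set (T * T) := seg1 `*` seg1.

Let mII : measurable II.
Proof. by apply: measurableX; exact: measurable_seg1. Qed.

Let II_fin : (leb2 II < +oo)%E.
Proof.
have m1 := measurable_seg1; rewrite leb2_box//.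
by apply: lte_mul_pinfty => //; [rewrite ge0_fin_numE//|]; exact: lebesgue_seg1.
Qed.

Let III_fin : (leb3 (II `*` seg1) < +oo)%E.
Proof.
have m1 := measurable_seg1; rewrite leb3_box//.
have f1 : @lebesgue_measure R seg1 \is a fin_num by rewrite ge0_fin_numE// lebesgue_seg1.
by rewrite ltey_eq !fin_numM.
Qed.

Let dg_out (i : 'I_3) (p : T * T * T) (j : 'I_3) : ~ seg1 (row3 p ord0 j) -> dg i (row3 p) = 0.
Proof.
move=> h; have out : b < enorm (row3 p).
  apply: lt_le_trans b1 _; apply: le_trans (abs_coord_le _ j).
  by rewrite leNgt; apply/negP => lt1; apply: h; rewrite /seg1 /= in_itv/= -ler_norml ltW.
by rewrite /dg kb ?kb'// mul0r mulr0 addr0.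
Qed.

Let dg_integrable i : leb3.-integrable setT (EFin \o (fun p => dg i (row3 p))).
Proof.
have [M MP] := dg_bounded.
apply: (bounded_support_integrable _ _ _ (II `*` seg1) _ M).
- by apply: measurableX => //; exact: measurable_seg1.
- exact: III_fin.
- exact: measurable_dg.
- by move=> p; exact: MP.
- move=> [[x y] z] h.
  case: (boolP (x \in seg1)) => hx; last by apply: (dg_out i _ 0); rewrite mxE => h'; move: hx; rewrite notin_setE.
  case: (boolP (y \in seg1)) => hy; last by apply: (dg_out i _ 1); rewrite mxE => h'; move: hy; rewrite notin_setE.
  case: (boolP (z \in seg1)) => hz; last by apply: (dg_out i _ 2); rewrite mxE => h'; move: hz; rewrite notin_setE.
  by exfalso; apply: h; split; [split|]; exact: set_mem.
Qed.

Let dg_integrable2 i (z : R) : leb2.-integrable setT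
  (EFin \o (fun p => dg i (row3 (p, z)))).
Proof.
have [M MP] := dg_bounded.
apply: (bounded_support_integrable _ _ _ II _ M).
- by [].
- exact: II_fin.
- exact: (measurableT_comp (measurable_dg i) (pair2_measurable z)).
- by move=> p; exact: MP.
- move=> [x y] h.
  case: (boolP (x \in seg1)) => hx; last by apply: (dg_out i _ 0); rewrite mxE => h'; move: hx; rewrite notin_setE.
  case: (boolP (y \in seg1)) => hy; last by apply: (dg_out i _ 1); rewrite mxE => h'; move: hy; rewrite notin_setE.
  by exfalso; apply: h; split; exact: set_mem.
Qed.

(** Fubini is applied in the order that integrates along the i-th axis first, where the integrand is
    the derivative of a function of compact support. *)
Let integral_dg i : (\int[leb3]_p (dg i (row3 p))%:E = 0)%E.
Proof.
case: i => -[|[|[|//]]] ip.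
- apply: (fubini_fst_eq0 _ _ _ _ _ _ _ (dg_integrable _)) => z.
  apply: (fubini_fst_eq0 _ _ _ _ _ _ _ (dg_integrable2 _ z)) => y.
  rewrite -[RHS](dg_line (row3 ((0, y), z)) (Ordinal ip)); last by rewrite mxE.
  apply: eq_integral => t _; congr (dg _ _)%:E.
  rewrite !row3E scale0r add0r [RHS]addrC [RHS]addrA; congr (_ *: ebase R _ + _ + _); exact: val_inj.
- apply: (fubini_fst_eq0 _ _ _ _ _ _ _ (dg_integrable _)) => z.
  apply: (fubini_snd_eq0 _ _ _ _ _ _ _ (dg_integrable2 _ z)) => x.
  rewrite -[RHS](dg_line (row3 ((x, 0), z)) (Ordinal ip)); last by rewrite mxE.
  apply: eq_integral => t _; congr (dg _ _)%:E.
  rewrite !row3E scale0r addr0 [RHS]addrAC; congr (_ + _ *: ebase R _ + _); exact: val_inj.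
- apply: (fubini_snd_eq0 _ _ _ _ _ _ _ (dg_integrable _)) => -[x y].
  rewrite -[RHS](dg_line (row3 ((x, y), 0)) (Ordinal ip)); last by rewrite mxE.
  apply: eq_integral => t _; congr (dg _ _)%:E.
  rewrite !row3E scale0r addr0; congr (_ + _ *: ebase R _); exact: val_inj.
Qed.

Lemma int_divergence : int_uball (fun x : V => 3 * k (enorm x) + enorm x * k' (enorm x)) = 0.
Proof.
rewrite /int_uball lebesgue3E Rintegral_mkcond.
have -> : (fun p : T * T * T => 3 * k (enorm (row3 p)) + enorm (row3 p) * k' (enorm (row3 p)))
    \_ (@row3 R @^-1` uball R) = fun p => \sum_(i < 3) dg i (row3 p).
  apply/funext => p; rewrite patchE; case: ifPn => pb.
    rewrite sum3E /dg.
    have : enorm (row3 p) * k' (enorm (row3 p)) = enorm (row3 p) ^+ 2 * (k' (enorm (row3 p)) / enorm (row3 p)).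
      have [->|n0] := eqVneq (enorm (row3 p)) 0; first by rewrite mul0r expr0n mul0r.
      by field.
    by move=> ->; rewrite enorm_sq /dot sum3E; ring.
  have out : b < enorm (row3 p).
    by apply: lt_le_trans b1 _; rewrite leNgt; apply: contra pb => h; rewrite inE.
  by rewrite big1// => i _; rewrite /dg kb ?kb'// mul0r mulr0 addr0.
have -> : (fun p : T * T * T => \sum_(i < 3) dg i (row3 p)) =
    (fun p => dg 0 (row3 p) + dg 1 (row3 p) + dg 2 (row3 p)).
  by apply/funext => p; exact: sum3E.
have i01 : leb3.-integrable setT (EFin \o (fun p => dg 0 (row3 p) + dg 1 (row3 p))).
  by have := integrableD measurableT (dg_integrable 0) (dg_integrable 1).
have z i : \int[leb3]_p dg i (row3 p) = 0 by have := integral_dg i; rewrite /Rintegral => ->.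
have e1 : \int[leb3]_p (dg 0 (row3 p) + dg 1 (row3 p)) = 0.
  apply: (etrans (RintegralD measurableT (dg_integrable 0) (dg_integrable 1))).
  by rewrite (z 0) (z 1) addr0.
apply: (etrans (RintegralD measurableT i01 (dg_integrable 2))).
by rewrite (z 2) addr0; exact: e1.
Qed.

End Divergence.
End RadialDivergence.

(** * Smooth functions *)

Section SmoothLine.
Context {R : realType}.
Implicit Types f g : R -> R.

Fixpoint Ck n f : Prop :=
  if n is m.+1 then exists2 f', (forall x : R, is_derive x 1 f (f' x)) & Ck m f'
  else continuous f.

Definition Cinf f := forall n, Ck n f.

Lemma Ck_cont n f : Ck n f -> continuous f.
Proof. by case: n => [//|n] [f' df _] x; exact: der_continuous (df x). Qed.

Lemma Ck_pred n f : Ck n.+1 f -> Ck n f.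
Proof.
elim: n f => [|n IH] f; first exact: (@Ck_cont 1).
by move=> [f' df cf']; exists f' => //; exact: IH.
Qed.

Lemma Cinf_cont f : Cinf f -> continuous f. Proof. by move=> /(_ 0%N). Qed.

Lemma CkD n f g : Ck n f -> Ck n g -> Ck n (fun x => f x + g x).
Proof.
elim: n f g => [|n IH] f g; first by move=> cf cg x; exact: (contD f g x (cf x) (cg x)).
move=> [f' df cf] [g' dg cg]; exists (fun x => f' x + g' x); last exact: IH.
by move=> x; exact: (derD f g _ _ _ _ (df x) (dg x)).
Qed.

Lemma CkM n f g : Ck n f -> Ck n g -> Ck n (fun x => f x * g x).
Proof.
elim: n f g => [|n IH] f g; first by move=> cf cg x; exact: (contM f g x (cf x) (cg x)).
move=> cf1 cg1; have cf0 := Ck_pred _ _ cf1; have cg0 := Ck_pred _ _ cg1.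
move: cf1 cg1 => [f' df cf] [g' dg cg].
exists (fun x => f x * g' x + g x * f' x); last by apply: CkD; exact: IH.
by move=> x; exact: (derM f g _ _ _ _ (df x) (dg x)).
Qed.

Lemma Ck_cst n (c : R) : Ck n (fun=> c).
Proof.
elim: n c => [|n IH] c; first exact: cst_continuous.
by exists (fun=> 0) => // x; exact: der_cst.
Qed.

Lemma Ck_id n : Ck n (fun x => x).
Proof.
case: n => [|n]; first exact: cont_id.
by exists (fun=> 1); [move=> x; exact: der_id|exact: Ck_cst].
Qed.

Lemma Ck_comp n f g : Ck n f -> Ck n g -> Ck n (fun x => f (g x)).
Proof.
elim: n f g => [|n IH] f g; first by move=> cf cg x; exact: (cont_comp f g x (cg x) (cf _)).
move=> cf1 cg1; have cg0 := Ck_pred _ _ cg1.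
move: cf1 cg1 => [f' df cf] [g' dg cg].
exists (fun x => f' (g x) * g' x); last by apply: CkM => //; exact: IH.
by move=> x; exact: (der_comp f g _ _ _ _ (dg x) (df _)).
Qed.

Lemma CinfD f g : Cinf f -> Cinf g -> Cinf (fun x => f x + g x).
Proof. by move=> cf cg n; exact: CkD. Qed.

Lemma CinfM f g : Cinf f -> Cinf g -> Cinf (fun x => f x * g x).
Proof. by move=> cf cg n; exact: CkM. Qed.

Lemma Cinf_cst (c : R) : Cinf (fun=> c). Proof. by move=> n; exact: Ck_cst. Qed.

Lemma Cinf_id : Cinf (fun x => x). Proof. by move=> n; exact: Ck_id. Qed.

Lemma CinfN f : Cinf f -> Cinf (fun x => - f x).
Proof.
move=> cf; have -> : (fun x => - f x) = (fun x => -1 * f x).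
  by apply/funext => x; rewrite mulN1r.
by apply: CinfM => //; exact: Cinf_cst.
Qed.

Lemma Cinf_comp f g : Cinf f -> Cinf g -> Cinf (fun x => f (g x)).
Proof. by move=> cf cg n; exact: Ck_comp. Qed.

Lemma Cinf_prim f f' : (forall x : R, is_derive x 1 f (f' x)) -> Cinf f' -> Cinf f.
Proof. by move=> df cf [|n]; [move=> x; exact: der_continuous (df x)|exists f']. Qed.

Lemma Cinf_derive f f' : (forall x : R, is_derive x 1 f (f' x)) -> Cinf f -> Cinf f'.
Proof.
move=> df cf n; have [g dg cg] := cf n.+1.
suff -> : f' = g by [].
by apply/funext => x; exact: is_derive_unique (df x) (dg x).
Qed.

Lemma Ck_sin_cos n : Ck n (@sin R) /\ Ck n (@cos R).
Proof.
elim: n => [|n [IHs IHc]]; first by split; [exact: continuous_sin|exact: continuous_cos].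
split; first by exists (@cos R) => // x; exact: is_derive_sin.
exists (fun x => -1 * sin x); last by apply: CkM => //; exact: Ck_cst.
by move=> x; rewrite mulN1r; exact: is_derive_cos.
Qed.

Lemma Cinf_sin : Cinf (@sin R). Proof. by move=> n; case: (Ck_sin_cos n). Qed.
Lemma Cinf_cos : Cinf (@cos R). Proof. by move=> n; case: (Ck_sin_cos n). Qed.

Lemma derive_eq0 f f' (a : R) : (forall r, r < a -> f r = 0) ->
  (forall x : R, is_derive x 1 f (f' x)) -> forall r, r < a -> f' r = 0.
Proof.
move=> f0 df r ra; apply: is_derive_unique (df r) _.
apply: (near_is_derive (fun=> 0)).
have : \forall y \near r, y < a by apply: near_lt => //; exact: cont_id.
by apply: filterS => y /f0 ->.
Qed.

Lemma derive_eq0_gt f f' (b : R) : (forall r, b < r -> f r = 0) ->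
  (forall x : R, is_derive x 1 f (f' x)) -> forall r, b < r -> f' r = 0.
Proof.
move=> f0 df r ra; apply: is_derive_unique (df r) _.
apply: (near_is_derive (fun=> 0)).
have : \forall y \near r, b < y by apply: near_gt => //; exact: cont_id.
by apply: filterS => y /f0 ->.
Qed.

Lemma der_div_id f f' (a : R) : 0 < a -> (forall r, r < a -> f r = 0) ->
  (forall x : R, is_derive x 1 f (f' x)) ->
  forall r : R, is_derive r 1 (fun x => f x / x) (f' r / r - f r / r / r).
Proof.
move=> a0 f0 df r; have [ra|ar] := ltP r a; last first.
  have rn0 : r != 0 by rewrite gt_eqF// (lt_le_trans a0).
  by have d := df r; der0; [exact: rn0|field].
rewrite (derive_eq0 _ _ _ f0 df _ ra) (f0 _ ra) !mul0r subr0.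
apply: (near_is_derive (fun=> 0)).
have : \forall y \near r, y < a by apply: near_lt => //; exact: cont_id.
by apply: filterS => y /f0 ->; rewrite mul0r.
Qed.

(** The derivative of f/r is f'/r - (f/r)/r, built from quotients of the same kind by functions that
    still vanish near 0; hence the induction on the order. *)
Lemma Cinf_div_id f (a : R) : 0 < a -> Cinf f -> (forall r, r < a -> f r = 0) ->
  Cinf (fun r => f r / r).
Proof.
move=> a0 cf f0 n.
elim: n f {cf}(cf n) f0 => [|n IH] f cf f0; first exact: cont_div_id f0.
have cf0 := Ck_pred _ _ cf; have [f' df cf'] := cf.
exists (fun r => f' r / r + -1 * (f r / r / r)).
  by move=> x; rewrite mulN1r; exact: der_div_id f0 df x.
apply: CkD; first by apply: (IH) => //; exact: derive_eq0 df.
apply: CkM; first exact: Ck_cst.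
by apply: (IH); [exact: (IH)|move=> r /f0 ->; rewrite mul0r].
Qed.

(** The exponent [m] is there to close the family under differentiation: the derivative of [flat m]
    is a combination of [flat m.+1] and [flat m.+2]. *)
Definition flat (m : nat) (t : R) : R := if 0 < t then t ^- m * expR (- t^-1) else 0.

Lemma flat_le0 m t : t <= 0 -> flat m t = 0.
Proof. by rewrite /flat leNgt => /negbTE ->. Qed.

Lemma flat_gt0 m t : 0 < t -> 0 < flat m t.
Proof. by move=> t0; rewrite /flat t0 mulr_gt0 ?invr_gt0 ?exprn_gt0 ?expR_gt0. Qed.

(** With N = m + 1, exp(1/t) is the N-th power of exp(1/(tN)) >= 1/(tN). *)
Lemma flat_bound m t : 0 < t -> flat m t <= m.+1%:R ^+ m.+1 * t.
Proof.
move=> t0; rewrite /flat t0; set N := m.+1%:R : R.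
have N0 : 0 < N by rewrite ltr0n.
have h1 : (t^-1 / N) ^+ m.+1 <= expR t^-1.
  have -> : expR t^-1 = expR (t^-1 / N) ^+ m.+1.
    by rewrite -expRM_natl; congr expR; rewrite mulrC divfK// gt_eqF.
  rewrite lerXn2r ?nnegrE ?divr_ge0 ?invr_ge0 ?(ltW t0) ?(ltW N0) ?expR_ge0//.
  by apply: le_trans (expR_ge1Dx _); rewrite lerDr.
rewrite expRN -ler_pdivlMl ?invr_gt0 ?exprn_gt0// invrK.
rewrite -[leLHS]mul1r ler_pdivrMr ?expR_gt0//.
have -> : 1 = t ^+ m * (N ^+ m.+1 * t) * (t^-1 / N) ^+ m.+1.
  have -> : t ^+ m * (N ^+ m.+1 * t) = (t * N) ^+ m.+1 by rewrite exprMn (exprSr t); ring.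
  by rewrite -invfM exprVn mulfV// expf_neq0// gt_eqF// mulr_gt0.
rewrite ler_wpM2l//; apply: mulr_ge0; first exact/exprn_ge0/ltW.
by apply: mulr_ge0; [exact/exprn_ge0/ltW|exact: ltW].
Qed.

Lemma cont_flat m : continuous (flat m).
Proof.
move=> t; have [t0|t0|->] := ltgtP t 0.
- have n : \forall y \near t, y < 0 by apply: near_lt => //; exact: cont_id.
  apply: cont_eps => e e0; rewrite flat_le0 ?(ltW t0)//.
  by apply: filterS n => y y0; rewrite flat_le0 ?(ltW y0)// subrr normr0 ltW.
- have c : {for t, continuous (fun t : R => t ^- m * expR (- t^-1))}.
    by cont; rewrite ?expf_neq0// gt_eqF.
  have n : \forall y \near t, 0 < y by apply: near_gt => //; exact: cont_id.
  apply: cont_eps => e e0; apply: filterS2 n (eps_cont _ _ _ c e e0) => y y0.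
  by rewrite /flat t0 y0.
- apply: cont_eps => e e0; rewrite flat_le0//.
  pose d := e / m.+1%:R ^+ m.+1.
  have N0 : 0 < m.+1%:R ^+ m.+1 :> R by rewrite exprn_gt0 ?ltr0n.
  have d0 : 0 < d by rewrite divr_gt0.
  have n : \forall y \near (0 : R), y < d by apply: near_lt => //; exact: cont_id.
  apply: filterS n => y yd; rewrite sub0r normrN.
  have [y0|y0] := leP y 0; first by rewrite flat_le0// normr0 ltW.
  rewrite gtr0_norm ?flat_gt0//; apply: le_trans (flat_bound _ _ y0) _.
  by rewrite mulrC -ler_pdivlMr// ltW.
Qed.

Lemma der_flat m (t : R) :
  is_derive t 1 (flat m) (flat m.+2 t + - m%:R * flat m.+1 t).
Proof.
have [t0|t0|->] := ltgtP t 0.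
- rewrite !flat_le0 ?(ltW t0)// mulr0 addr0.
  apply: (near_is_derive (fun=> 0)).
  have n : \forall y \near t, y < 0 by apply: near_lt => //; exact: cont_id.
  by apply: filterS n => y y0; rewrite flat_le0 ?(ltW y0).
- have tn0 := lt0r_neq0 t0.
  have d : is_derive t 1 (fun t : R => t ^- m * expR (- t^-1))
      (flat m.+2 t + - m%:R * flat m.+1 t).
    der0; [by rewrite expf_neq0|exact: tn0|].
    rewrite /flat t0; case: m => [|m] /=; first by field.
    by rewrite !exprS; field; rewrite expf_neq0.
  apply: near_is_derive d.
  have n : \forall y \near t, 0 < y by apply: near_gt => //; exact: cont_id.
  by apply: filterS n => y y0; rewrite /flat y0.
(* At 0, write [flat m t] as t times [flat m.+1 t], a continuous function that vanishes there. *)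
- have := is_derive_mulid (flat m.+1) (cont_flat m.+1 0).
  rewrite !flat_le0// mulr0 addr0; congr is_derive; apply/funext => s.
  rewrite /flat; case: ifPn => s0; last by rewrite mulr0.
  by rewrite exprS; field; rewrite ?expf_neq0 ?(lt0r_neq0 s0).
Qed.

Lemma Cinf_flat m : Cinf (flat m).
Proof.
move=> n; elim: n m => [|n IH] m; first exact: cont_flat.
exists (fun t => flat m.+2 t + - m%:R * flat m.+1 t); first exact: der_flat.
by apply: CkD => //; apply: CkM => //; exact: Ck_cst.
Qed.

Definition smooth_bump (c d t : R) : R := flat 0 (t - c) * flat 0 (d - t).

Lemma Cinf_bump c d : Cinf (smooth_bump c d).
Proof.
apply: CinfM.
  apply: (Cinf_comp (flat 0)); first exact: Cinf_flat.
  by apply: CinfD; [exact: Cinf_id|exact: Cinf_cst].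
apply: (Cinf_comp (flat 0)); first exact: Cinf_flat.
by apply: CinfD; [exact: Cinf_cst|apply: CinfN; exact: Cinf_id].
Qed.

Lemma bump_ge0 c d t : 0 <= smooth_bump c d t.
Proof.
have h m s : 0 <= flat m s.
  by have [s0|s0] := leP s 0; [rewrite flat_le0|rewrite ltW// flat_gt0].
by rewrite mulr_ge0.
Qed.

Lemma bump_gt0 c d t : c < t < d -> 0 < smooth_bump c d t.
Proof. by move=> /andP[ct td]; rewrite mulr_gt0// flat_gt0// subr_gt0. Qed.

Lemma bump_le c d t : t <= c -> smooth_bump c d t = 0.
Proof. by move=> tc; rewrite /smooth_bump flat_le0 ?mul0r// subr_le0. Qed.

Lemma bump_ge c d t : d <= t -> smooth_bump c d t = 0.
Proof. by move=> dt; rewrite /smooth_bump [X in _ * X]flat_le0 ?mulr0// subr_le0. Qed.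

Lemma is_derive0_eq f (a b : R) : a <= b ->
  (forall t, a <= t <= b -> {for t, continuous f}) ->
  (forall t : R, a < t < b -> is_derive t 1 f 0) -> f a = f b.
Proof.
move=> ab cf df; apply/eqP; rewrite eq_le.
rewrite (deriv_ge0_le f (fun=> 0) a b ab cf df)//.
by rewrite (deriv_le0_ge f (fun=> 0) a b ab cf df).
Qed.

(** Since [prim] integrates from -1, it is constant on the negative axis when F vanishes there; the
    derivative formula then extends to the whole line. *)
Lemma der_prim_supp (F : R -> R) : continuous F -> (forall t, t < 0 -> F t = 0) ->
  forall x : R, is_derive x 1 (prim F) (F x).
Proof.
move=> cF F0 x; have [x1|x1] := ltP (-1) x; first exact: der_prim.
have x0 : x < 0 by apply: le_lt_trans x1 _; rewrite oppr_lt0.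
rewrite F0//.
have n : \forall y \near x, y < 0 by apply: near_lt => //; exact: cont_id.
apply: (near_is_derive (fun=> - \int[lebesgue_measure]_(t in `[-1, 0]) F t)).
apply: filterS n => y y0; rewrite /prim.
have -> : \int[lebesgue_measure]_(t in `[-1, y]) F t = 0; last by rewrite add0r.
have -> : \int[lebesgue_measure]_(t in `[-1, y]) F t = \int[lebesgue_measure]_(t in `[-1, y]) (0 : R).
  apply: eq_Rintegral => t; rewrite inE /= in_itv /= => /andP[_ ty].
  by rewrite F0// (le_lt_trans ty).
by rewrite Rintegral_cst// mul0r.
Qed.

Lemma Cinf_prim_supp (F : R -> R) : Cinf F -> (forall t, t < 0 -> F t = 0) -> Cinf (prim F).
Proof. by move=> cF F0; apply: Cinf_prim (der_prim_supp F (Cinf_cont _ cF) F0) cF. Qed.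

End SmoothLine.

Section SmoothSpace.
Context {R : realType}.
Notation V := 'rV[R]_3.
Implicit Types f g : V -> R.

Fixpoint CkV n f : Prop :=
  if n is m.+1 then continuous f /\
    forall i, (forall x, derivable f x (ebase R i)) /\ CkV m (partial i f)
  else continuous f.

Lemma CkV_pred n f : CkV n.+1 f -> CkV n f.
Proof.
elim: n f => [|n IH] f [cf df]; first exact: cf.
by split => // i; have [d1 d2] := df i; split => //; exact: IH.
Qed.

Lemma partialE f f' (i : 'I_3) : (forall x : V, is_derive x (ebase R i) f (f' x)) ->
  partial i f = f'.
Proof. by move=> df; apply/funext => x; rewrite /partial; case: (df x). Qed.

Lemma CkVD n f g : CkV n f -> CkV n g -> CkV n (fun x => f x + g x).
Proof.
elim: n f g => [|n IH] f g; first by move=> cf cg x; exact: (contD f g x (cf x) (cg x)).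
move=> [cf df] [cg dg]; split; first by move=> x; exact: (contD f g x (cf x) (cg x)).
move=> i; have [d1 d2] := df i; have [e1 e2] := dg i.
have d (x : V) : is_derive x (ebase R i) (fun y => f y + g y) (partial i f x + partial i g x).
  exact: (derD f g _ _ _ _ (derivableP (d1 x)) (derivableP (e1 x))).
split; first by move=> x; case: (d x).
by rewrite (partialE _ _ _ d); exact: IH.
Qed.

Lemma CkVM n f g : CkV n f -> CkV n g -> CkV n (fun x => f x * g x).
Proof.
elim: n f g => [|n IH] f g; first by move=> cf cg x; exact: (contM f g x (cf x) (cg x)).
move=> cf1 cg1; have cf0 := CkV_pred _ _ cf1; have cg0 := CkV_pred _ _ cg1.
move: cf1 cg1 => [cf df] [cg dg]; split.
  by move=> x; exact: (contM f g x (cf x) (cg x)).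
move=> i; have [d1 d2] := df i; have [e1 e2] := dg i.
have d (x : V) : is_derive x (ebase R i) (fun y => f y * g y)
    (f x * partial i g x + g x * partial i f x).
  exact: (derM f g _ _ _ _ (derivableP (d1 x)) (derivableP (e1 x))).
split; first by move=> x; case: (d x).
by rewrite (partialE _ _ _ d); apply: CkVD; exact: IH.
Qed.

Lemma CkV_cst n (c : R) : CkV n (fun=> c).
Proof.
elim: n c => [|n IH] c; first exact: cst_continuous.
split; first exact: cst_continuous.
move=> i; have d (x : V) : is_derive x (ebase R i) (fun=> c) 0 by exact: der_cst.
split; first by move=> x; case: (d x).
by rewrite (partialE _ _ _ d).
Qed.

Lemma CkV_coord n (k : 'I_3) : CkV n (fun x => x ord0 k).
Proof.
have c : continuous (fun x : V => x ord0 k) by move=> x; exact: cont_coord.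
case: n => [//|n]; split => // i.
have d (x : V) : is_derive x (ebase R i) (fun x : V => x ord0 k) (ebase R i ord0 k) by exact: der_coord.
split; first by move=> x; case: (d x).
by rewrite (partialE _ _ _ d); exact: CkV_cst.
Qed.

Lemma cont_radial_comp (q : R -> R) : continuous q -> continuous (fun x : V => q (enorm x)).
Proof. by move=> cq x; apply: (cont_comp q); [exact: cont_enorm|exact: cq]. Qed.

(** A partial derivative of P(|x|) is a coordinate times (P'/r)(|x|), where P'/r is again smooth and
    zero near 0: the induction stays inside this class, and the norm is never differentiated at the
    origin. *)
Lemma CkV_radial n (P : R -> R) (a : R) : 0 < a -> Cinf P -> (forall r, r < a -> P r = 0) ->
  CkV n (fun x => P (enorm x)).
Proof.
move=> a0; elim: n P => [|n IH] P cP P0; first exact/cont_radial_comp/Cinf_cont.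
split; first exact/cont_radial_comp/Cinf_cont.
have [P' dP _] := cP 1%N.
have cP' := Cinf_derive _ _ dP cP; have P'0 := derive_eq0 _ _ _ P0 dP.
move=> i; have d (x : V) := der_radial_comp P P' a a0 dP P0 P'0 x (ebase R i).
split; first by move=> x; case: (d x).
rewrite (partialE _ _ _ d).
have -> : (fun x : V => P' (enorm x) / enorm x * dot x (ebase R i)) =
    (fun x : V => P' (enorm x) / enorm x * x ord0 i).
  by apply/funext => x; rewrite dot_ebase.
apply: CkVM; last exact: CkV_coord.
apply: (IH (fun r => P' r / r)); first exact: Cinf_div_id P'0.
by move=> r /P'0 ->; rewrite mul0r.
Qed.

Lemma CkV_smooth f : (forall n, CkV n f) -> smooth f.
Proof.
move=> cf s; have {}cf := cf (size s).+1.
(* [foldr] applies the last index of the word first, so the word is peeled from its end. *)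
elim/last_ind: s f cf => [|s i IH] f cf.
  have [c d] := cf; split; first exact: c.
  by move=> i x; case: (d i).
by rewrite foldr_rcons; apply: IH; move: cf; rewrite size_rcons => -[_ /(_ i)[]].
Qed.

Lemma test_function_radial (P : R -> R) (a b : R) : 0 < a -> b < 1 -> Cinf P ->
  (forall r, r < a -> P r = 0) -> (forall r, b < r -> P r = 0) ->
  test_function (fun x : V => P (enorm x)).
Proof.
move=> a0 b1 cP Pa Pb; split; first by apply: CkV_smooth => n; exact: CkV_radial Pa.
exists [set x | enorm x <= b]; split.
- have -> : [set x : V | enorm x <= b] = ucball R `&` (@enorm R) @^-1` [set t : R | t <= b].
    apply/seteqP; split => x /=; last by case.
    by move=> h; split => //=; exact: le_trans h (ltW b1).
  apply: compact_closedI; first exact: compact_ucball.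
  by apply: closed_comp; [move=> x _; exact: cont_enorm|exact: closed_le].
- by move=> x h; exact: le_lt_trans h b1.
- by move=> x /negP; rewrite -ltNge => /Pb.
Qed.

(** In dimension three the Laplacian of p(r)/r is p''(r)/r; profiles are therefore always divided by
    r, which reduces everything to p'' + w^2 p. *)
Lemma laplacian_radial_comp (p p1 p2 : R -> R) (a : R) : 0 < a ->
  (forall r : R, is_derive r 1 p (p1 r)) -> (forall r : R, is_derive r 1 p1 (p2 r)) ->
  (forall r, r < a -> p r = 0) ->
  forall x : V, laplacian (fun x => p (enorm x) / enorm x) x = p2 (enorm x) / enorm x.
Proof.
move=> a0 dp dp1 p0 x.
have p10 := derive_eq0 _ _ _ p0 dp; have p20 := derive_eq0 _ _ _ p10 dp1.
pose P' (r : R) := p1 r / r - p r / r / r.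
have dP (r : R) : is_derive r 1 (fun r => p r / r) (P' r) by exact: der_div_id p0 dp r.
have P0 (r : R) : r < a -> p r / r = 0 by move=> /p0 ->; rewrite mul0r.
have P'0 (r : R) : r < a -> P' r = 0 by move=> ra; rewrite /P' p10// p0// !mul0r subr0.
pose P'' (r : R) := p2 r / r - p1 r / r / r - (p1 r / r - p r / r / r) / r + p r / r / r / r.
have dP' (r : R) : is_derive r 1 P' (P'' r).
  have d1 := der_div_id p1 p2 a a0 p10 dp1 r.
  have d2 := der_div_id (fun r => p r / r) P' a a0 P0 dP r.
  have -> : P'' r = p2 r / r - p1 r / r / r - (P' r / r - p r / r / r / r).
    by rewrite /P'' /P'; ring.
  exact: (derD _ _ _ _ _ _ d1 (derN _ _ _ _ d2)).
have dQ (r : R) := der_div_id P' P'' a a0 P'0 dP' r.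
have Q0 (r : R) : r < a -> P' r / r = 0 by move=> /P'0 ->; rewrite mul0r.
have Q'0 (r : R) : r < a -> P'' r / r - P' r / r / r = 0.
  by move=> ra; rewrite /P'' /P' p20// p10// p0// !(mul0r, subr0, addr0).
have d1 (i : 'I_3) (x : V) := der_radial_comp _ P' a a0 dP P0 P'0 x (ebase R i).
have d2 (i : 'I_3) : partial i (partial i (fun x => p (enorm x) / enorm x)) =
    fun x => x ord0 i ^+ 2 * ((P'' (enorm x) / enorm x - P' (enorm x) / enorm x / enorm x) / enorm x)
      + P' (enorm x) / enorm x.
  rewrite (partialE _ _ _ (d1 i)); apply: partialE => y.
  have e1 := der_radial_comp _ _ a a0 dQ Q0 Q'0 y (ebase R i).
  have e2 := der_coord y (ebase R i) i.
  have -> : (fun x : V => P' (enorm x) / enorm x * dot x (ebase R i)) =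
      (fun x : V => P' (enorm x) / enorm x * x ord0 i).
    by apply/funext => z; rewrite dot_ebase.
  apply: der_eq (derM _ _ _ _ _ _ e1 e2) _.
  by rewrite dot_ebase mxE !eqxx /=; ring.
rewrite laplacianE !d2.
have [xa|ax] := ltP (enorm x) a.
  by rewrite Q'0// P'0// p20// !(mul0r, mulr0, addr0).
have xn : enorm x != 0 by rewrite gt_eqF// (lt_le_trans a0).
have xE : enorm x ^+ 2 = x ord0 0 ^+ 2 + x ord0 1 ^+ 2 + x ord0 2 ^+ 2.
  rewrite enorm_sq; apply: etrans (sum3E _) _.
  by rewrite !expr2.
transitivity (enorm x ^+ 2 * ((P'' (enorm x) / enorm x - P' (enorm x) / enorm x / enorm x) / enorm x)
  + 3 * (P' (enorm x) / enorm x)).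
  by rewrite xE; ring.
by rewrite /P'' /P'; field.
Qed.

End SmoothSpace.

(** * The value of the regular part *)

Section BallIntegral.
Context {R : realType}.
Notation V := 'rV[R]_3.
Notation T := (measurableTypeR R).

Definition ball3 : set (T * T * T) := @row3 R @^-1` uball R.

Lemma ball3_fin : (leb3 ball3 < +oo)%E.
Proof.
have m1 := @measurable_seg1 R; pose I3 : set (T * T * T) := (seg1 `*` seg1) `*` seg1.
have sub : ball3 `<=` I3.
  move=> [[x y] z] /= /ltW h.
  have co (i : 'I_3) : seg1 (row3 ((x, y), z) ord0 i).
    by rewrite /seg1 /= in_itv/= -ler_norml (le_trans (abs_coord_le _ i)).
  split; first split.
  - by have := co 0; rewrite mxE.
  - by have := co 1; rewrite mxE.
  - by have := co 2; rewrite mxE.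
have fin : (leb3 I3 < +oo)%E.
  have f1 : @lebesgue_measure R seg1 \is a fin_num by rewrite ge0_fin_numE// lebesgue_seg1.
  by rewrite /I3 leb3_box// ltey_eq !fin_numM.
apply: le_lt_trans (le_measure _ _ _ sub) fin.
- by rewrite inE; exact: measurable_uball.
- by rewrite inE; apply: measurableX => //; exact: measurableX.
Qed.

Lemma bounded_integrable_ball (f : T * T * T -> R) (M : R) : measurable_fun setT f ->
  (forall p, ball3 p -> `|f p| <= M) -> leb3.-integrable ball3 (EFin \o f).
Proof.
move=> mf fM; apply: measurable_bounded_integrable.
- exact: measurable_uball.
- exact: ball3_fin.
- exact: measurable_funS mf.
- by exists M; split; [exact: num_real|move=> N MN x /fM h; exact: le_trans h (ltW MN)].
Qed.

Lemma bounded_radial (q : R -> R) : continuous q -> exists2 M, 0 <= M &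
  forall p, ball3 p -> `|q (enorm (row3 p))| <= M.
Proof.
move=> cq; have [M M0 MP] := cont_bounded q 0 1 cq.
by exists M => // p pb; apply: MP; rewrite enorm_ge0 ltW.
Qed.

Lemma integrable_radial (q : R -> R) : continuous q ->
  leb3.-integrable ball3 (EFin \o (fun p => q (enorm (row3 p)))).
Proof.
move=> cq; have [M _ MP] := bounded_radial q cq.
by apply: bounded_integrable_ball MP; exact: measurable_radial.
Qed.

Lemma integrableM_radial (f : V -> R) (q : R -> R) : continuous q ->
  integrable_on_uball f ->
  leb3.-integrable ball3 (EFin \o (fun p => f (row3 p) * q (enorm (row3 p)))).
Proof.
move=> cq fi; have [M _ MP] := bounded_radial q cq.
have := @integrableMl _ _ _ leb3 ball3 measurable_uball (fun p => (f (row3 p))%:E)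
  (fun p => q (enorm (row3 p))) fi.
apply; first exact: measurable_funS (measurable_radial q cq).
by exists M; split; [exact: num_real|move=> N MN x /MP h; exact: le_trans h (ltW MN)].
Qed.

(** Boxes have explicit volumes. One box inside a shell and one cube around the origin replace
    integrals over shells and balls. *)
Definition box3 (a b : R) (c d : R) : set (T * T * T) :=
  ([set` `[a, b]%R] `*` [set` `[c, d]%R]) `*` [set` `[c, d]%R].

Lemma measurable_box3 a b c d : measurable (box3 a b c d).
Proof. by apply: measurableX; [apply: measurableX|]; exact: measurable_itv. Qed.

Lemma leb3_box3 a b c d : a < b -> c < d ->
  leb3 (box3 a b c d) = ((b - a) * (d - c) * (d - c))%:E.
Proof.
move=> ab cd; rewrite /box3 leb3_box; try exact: measurable_itv.
by rewrite !lebesgue_measure_itv/= !lte_fin ab cd -!EFinD -!EFinM.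
Qed.

Lemma integrable_indic_ball (A : set (T * T * T)) (m : R) : measurable A ->
  leb3.-integrable ball3 (EFin \o (fun p => m * \1_A p)).
Proof.
move=> mA; apply: (bounded_integrable_ball _ `|m|).
  by apply: measurable_funM => //; exact: measurable_indic.
by move=> p _; rewrite normrM indicE; case: (_ \in _); rewrite ?normr1 ?mulr1 ?normr0 ?mulr0.
Qed.

Lemma Rintegral_indic_ball (A : set (T * T * T)) (m : R) : measurable A ->
  \int[leb3]_(p in ball3) (m * \1_A p) = m * fine (leb3 (A `&` ball3)).
Proof.
move=> mA.
have i1 : leb3.-integrable ball3 (EFin \o (\1_A : T * T * T -> R)).
  have := integrable_indic_ball A 1 mA.
  by congr (_.-integrable _ _); apply/funext => p /=; rewrite mul1r.
rewrite (RintegralZl _ measurable_uball i1); congr (_ * _).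
by rewrite /Rintegral integral_indic//; exact: measurable_uball.
Qed.

(* The left-hand sides bound a function that is positive on a fixed box and small on a
   cube shrinking to the origin, relatively to the volume of the cube. *)
Lemma box_estimate (f : V -> R) (c h d m E : R) : 0 < h -> 0 < d -> 0 <= E ->
  leb3.-integrable ball3 (EFin \o (fun p => f (row3 p))) -> int_uball f <= 0 ->
  (forall p, box3 c (c + h) 0 h p -> ball3 p) ->
  (forall p, ball3 p -> m * \1_(box3 c (c + h) 0 h) p - E * \1_(box3 (- d) d (- d) d) p
     <= f (row3 p)) ->
  m * h ^+ 3 <= E * (2 * d) ^+ 3.
Proof.
move=> h0 d0 E0 fi f0 Qb fle.
have mQ := measurable_box3 c (c + h) 0 h; have mC := measurable_box3 (- d) d (- d) d.
have mB : measurable ball3 := measurable_uball.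
have iQ := integrable_indic_ball _ m mQ; have iC := integrable_indic_ball _ E mC.
have iQC : leb3.-integrable ball3 (EFin \o (fun p => m * \1_(box3 c (c + h) 0 h) p
    - E * \1_(box3 (- d) d (- d) d) p)).
  by have := integrableB mB iQ iC.
have le1 := le_Rintegral mB iQC fi fle.
have eQ : fine (leb3 (box3 c (c + h) 0 h `&` ball3)) = h ^+ 3.
  have -> : box3 c (c + h) 0 h `&` ball3 = box3 c (c + h) 0 h.
    by apply/setIidPl => p /Qb.
  by rewrite leb3_box3 ?ltrDl//= subr0; ring.
have eC : fine (leb3 (box3 (- d) d (- d) d `&` ball3)) <= (2 * d) ^+ 3.
  have -> : (2 * d) ^+ 3 = fine (leb3 (box3 (- d) d (- d) d)).
    by rewrite leb3_box3 ?gtrN//=; ring.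
  apply: fine_le.
  - rewrite ge0_fin_numE//; apply: le_lt_trans ball3_fin; apply: le_measure.
    + by rewrite inE; exact: measurableI.
    + by rewrite inE.
    + exact: subIsetr.
  - by rewrite leb3_box3 ?gtrN.
  - apply: le_measure; last exact: subIsetl.
    + by rewrite inE; exact: measurableI.
    + by rewrite inE.
have e := RintegralB mB iQ iC.
rewrite (Rintegral_indic_ball _ m mQ) (Rintegral_indic_ball _ E mC) eQ in e.
have : m * h ^+ 3 - E * fine (leb3 (box3 (- d) d (- d) d `&` ball3)) <= 0.
  by apply: le_trans f0; rewrite -e; exact: le1.
rewrite subr_le0 => /le_trans; apply.
by rewrite ler_wpM2l.
Qed.

End BallIntegral.

Section Annihilation.
Context {R : realType}.
Notation V := 'rV[R]_3.
Variables (w A B : R).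

(** [wave r / r] is the general radial solution of Lap f + w^2 f = 0 away from 0; it is Gam for A =
    1 / (4 pi) and B = g(o,o) / w. *)
Definition wave (r : R) : R := A * cos (w * r) + B * sin (w * r).
Definition wave1 (r : R) : R := w * (B * cos (w * r) - A * sin (w * r)).

Lemma der_wave (r : R) : is_derive r 1 wave (wave1 r).
Proof. by rewrite /wave; der; rewrite /wave1; ring. Qed.

Lemma der_wave1 (r : R) : is_derive r 1 wave1 (- (w ^+ 2 * wave r)).
Proof. by rewrite /wave1; der; rewrite /wave; ring. Qed.

Lemma Cinf_wave : Cinf wave.
Proof.
have cw : Cinf (fun r : R => w * r) by apply: CinfM; [exact: Cinf_cst|exact: Cinf_id].
apply: CinfD; (apply: CinfM; first exact: Cinf_cst).
  by apply: Cinf_comp cw; exact: Cinf_cos.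
by apply: Cinf_comp cw; exact: Cinf_sin.
Qed.

Section Profile.
Variables (p p1 p2 : R -> R) (a b : R).
Hypotheses (a0 : 0 < a) (b1 : b < 1) (cp : Cinf p)
  (dp : forall r : R, is_derive r 1 p (p1 r)) (dp1 : forall r : R, is_derive r 1 p1 (p2 r))
  (pa : forall r, r < a -> p r = 0) (pb : forall r, b < r -> p r = 0).

(** The operator - Lap - w^2 applied to the radial function p(|x|) / |x|. *)
Definition residual (r : R) : R := - ((p2 r + w ^+ 2 * p r) / r).

Let cp1 : Cinf p1. Proof. exact: Cinf_derive dp cp. Qed.
Let pa1 : forall r, r < a -> p1 r = 0. Proof. exact: derive_eq0 pa dp. Qed.
Let pa2 : forall r, r < a -> p2 r = 0. Proof. exact: derive_eq0 pa1 dp1. Qed.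
Let pb1 : forall r, b < r -> p1 r = 0. Proof. exact: derive_eq0_gt pb dp. Qed.
Let pb2 : forall r, b < r -> p2 r = 0. Proof. exact: derive_eq0_gt pb1 dp1. Qed.

Lemma residual_near0 r : r < a -> residual r = 0.
Proof. by move=> ra; rewrite /residual pa2// pa// mulr0 addr0 mul0r oppr0. Qed.

Let csum : Cinf (fun r => p2 r + w ^+ 2 * p r).
Proof. by apply: CinfD; [exact: Cinf_derive dp1 cp1|apply: CinfM => //; exact: Cinf_cst]. Qed.

Lemma cont_residual : continuous residual.
Proof.
have c : continuous (fun r => (p2 r + w ^+ 2 * p r) / r).
  apply: (cont_div_id _ a a0); first exact: Cinf_cont csum.
  by move=> s sa; rewrite pa2// pa// mulr0 addr0.
by move=> r; exact: (contN _ _ (c r)).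
Qed.

Lemma cont_wave_residual : continuous (fun r => wave r / r * residual r).
Proof.
have -> : (fun r => wave r / r * residual r) = fun r => (wave r * residual r) / r.
  by apply/funext => r; ring.
apply: (cont_div_id _ a a0).
  by move=> r; exact: (contM _ _ _ (Cinf_cont _ Cinf_wave r) (cont_residual r)).
by move=> r ra; rewrite residual_near0// mulr0.
Qed.

(* Green's second identity for [p r / r] and [wave r / r], which solve the radial equation away
   from the origin. *)
Lemma int_wave_residual : int_uball (fun x : V => wave (enorm x) / enorm x * residual (enorm x)) = 0.
Proof.
pose q (r : R) := wave1 r * p r - wave r * p1 r.
pose q1 (r : R) := - (wave r * (p2 r + w ^+ 2 * p r)).
have dq (r : R) : is_derive r 1 q (q1 r).
  have d1 := derM _ _ _ _ _ _ (der_wave1 r) (dp r).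
  have d2 := derM _ _ _ _ _ _ (der_wave r) (dp1 r).
  by apply: der_eq (derD _ _ _ _ _ _ d1 (derN _ _ _ _ d2)) _; rewrite /q1; ring.
have qa r : r < a -> q r = 0 by move=> ra; rewrite /q pa// pa1// !mulr0 subr0.
have qb r : b < r -> q r = 0 by move=> ra; rewrite /q pb// pb1// !mulr0 subr0.
have cq : Cinf q.
  apply: (Cinf_prim _ _ dq); apply: CinfN; apply: CinfM; first exact: Cinf_wave.
  exact: csum.
have q1a r : r < a -> q1 r = 0 by move=> ra; rewrite /q1 pa2// pa// mulr0 addr0 mulr0 oppr0.
have q1b r : b < r -> q1 r = 0 by move=> ra; rewrite /q1 pb2// pb// mulr0 addr0 mulr0 oppr0.
have z f r : f r = 0 -> f r / r = 0 :> R by move=> ->; rewrite mul0r.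
have d1 := der_div_id q q1 a a0 qa dq.
have d2 := der_div_id _ _ a a0 (fun r h => z _ r (qa r h)) d1.
have d3 := der_div_id _ _ a a0 (fun r h => z (fun r => q r / r) r (z _ r (qa r h))) d2.
have c3 : Cinf (fun r => q r / r / r / r).
  apply: (Cinf_div_id _ a a0); last by move=> r /qa ->; rewrite !mul0r.
  apply: (Cinf_div_id _ a a0); last by move=> r /qa ->; rewrite !mul0r.
  exact: Cinf_div_id qa.
pose k (r : R) := q r / r / r / r.
pose k1 (r : R) := ((q1 r / r - q r / r / r) / r - q r / r / r / r) / r - q r / r / r / r / r.
have dk (r : R) : is_derive r 1 k (k1 r) by exact: d3.
have ka r : r < a -> k r = 0 by move=> /qa h; rewrite /k h !mul0r.
have kb r : b < r -> k r = 0 by move=> /qb h; rewrite /k h !mul0r.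
have ka1 := derive_eq0 _ _ _ ka dk; have kb1 := derive_eq0_gt _ _ _ kb dk.
have := int_divergence k k1 a b a0 b1 dk (Cinf_cont _ (Cinf_derive _ _ dk c3)) ka ka1 kb kb1.
have -> // : (fun x : V => 3 * k (enorm x) + enorm x * k1 (enorm x)) =
   (fun x : V => wave (enorm x) / enorm x * residual (enorm x)).
  apply/funext => x; move: (enorm x) => r.
  have [ra|ar] := ltP r a; first by rewrite residual_near0// ka// ka1// !mulr0 addr0.
  have rn0 : r != 0 by rewrite gt_eqF// (lt_le_trans a0).
  by rewrite /residual /k /k1 /q1 /q; field.
Qed.

Variables (mu : R) (G : V -> R).
Hypotheses (muE : mu = w ^+ 2) (iG : integrable_on_uball G)
  (GP : forall phi, test_function phi ->
        int_uball (fun x => G x * (- laplacian phi x - mu * phi x)) = phi 0).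

(** p(|x|) / |x| is a test function that vanishes near the pole, so the Dirac mass contributes 0. *)
Lemma int_green_residual : int_uball (fun x => G x * residual (enorm x)) = 0.
Proof.
have cP : Cinf (fun r => p r / r) by exact: Cinf_div_id pa.
have Pa r : r < a -> p r / r = 0 by move=> /pa ->; rewrite mul0r.
have Pb r : b < r -> p r / r = 0 by move=> /pb ->; rewrite mul0r.
have := GP _ (test_function_radial _ a b a0 b1 cP Pa Pb).
rewrite enorm0 Pa//.
have -> // : (fun x : V => G x * (- laplacian (fun x => p (enorm x) / enorm x) x
    - mu * (p (enorm x) / enorm x))) = fun x => G x * residual (enorm x).
by apply/funext => x; rewrite (laplacian_radial_comp p p1 p2 a) // /residual muE; ring.
Qed.

Lemma integrable_diff (k : R) : leb3.-integrable ball3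
  (EFin \o (fun p => k * ((G (row3 p) - wave (enorm (row3 p)) / enorm (row3 p)) * residual (enorm (row3 p))))).
Proof.
have i1 := integrableM_radial G _ cont_residual iG.
have i2 := integrable_radial _ cont_wave_residual.
have := integrableZl measurable_uball k (integrableB measurable_uball i1 i2).
congr (_.-integrable _ _); apply/funext => x /=.
by rewrite -EFinB -EFinM; congr (_ * _)%:E; ring.
Qed.

Lemma int_diff (k : R) :
  int_uball (fun x => k * ((G x - wave (enorm x) / enorm x) * residual (enorm x))) = 0.
Proof.
have i1 := integrableM_radial G _ cont_residual iG.
have i2 := integrable_radial _ cont_wave_residual.
have i3 := integrableB measurable_uball i1 i2.
have e1 := RintegralB measurable_uball i1 i2.
have e2 := RintegralZl k measurable_uball i3.
have j1 : \int[leb3]_(p in ball3) (G (row3 p) * residual (enorm (row3 p))) = 0 := int_green_residual.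
have j2 : \int[leb3]_(p in ball3) (wave (enorm (row3 p)) / enorm (row3 p) * residual (enorm (row3 p))) = 0
  := int_wave_residual.
have -> : int_uball (fun x => k * ((G x - wave (enorm x) / enorm x) * residual (enorm x))) =
  int_uball (fun x => k * (G x * residual (enorm x) - wave (enorm x) / enorm x * residual (enorm x))).
  by congr int_uball; apply/funext => x; ring.
apply: (etrans e2); apply/eqP; rewrite mulf_eq0; apply/orP; right; apply/eqP.
by apply: (etrans e1); rewrite j1 j2 subrr.
Qed.

End Profile.
End Annihilation.

(** * Behaviour at the sphere and at the pole *)

Section NearSphere.
Context {R : realType}.
Notation V := 'rV[R]_3.

Lemma compact_usphere : compact (usphere R).
Proof.
have -> : usphere R = ucball R `&` (@enorm R) @^-1` [set t : R | 1 <= t].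
  apply/seteqP; split => x /=; first by move=> h; rewrite /ucball /= h; split.
  by rewrite /ucball /usphere /= => -[h1 h2]; apply/eqP; rewrite eq_le h1 h2.
apply: compact_closedI; first exact: compact_ucball.
by apply: closed_comp; [move=> x _; exact: cont_enorm|exact: closed_ge].
Qed.

(** Points near the sphere are written t x with |x| = 1 and t close to 1; compactness of the sphere
    makes the continuity of G at its points uniform. *)
Lemma near_sphere (G : V -> R) (e : R) : 0 < e ->
  {within ucball R `\ 0, continuous G} -> (forall x, usphere R x -> G x = 0) ->
  exists2 r0, r0 < 1 & forall x, r0 < enorm x < 1 -> `|G x| <= e.
Proof.
move=> e0 cG G0.
have := (compact_near_coveringP _).1 compact_usphere R (at_left 1)
  (fun (t : R) (x : V) => usphere R x -> `|G (t *: x)| <= e) _.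
case=> [x xs|d /= d0 dP].
  have xA : (ucball R `\ 0) x.
    split; first by rewrite /ucball /= xs.
    by move=> x0; move: xs; rewrite /usphere /= x0 enorm0 => /eqP; rewrite eq_sym oner_eq0.
  have /subspace_continuousP/(_ x xA)/cvgrPdist_le/(_ e e0) := cG.
  rewrite near_withinE => /nbhs_ballP[d /= d0 dP].
  have d2 : 0 < d / 2 by rewrite divr_gt0.
  near=> x' t => x's.
  have t1 : t < 1 by near: t; exact: nbhs_left_lt.
  have t0 : 0 < t by near: t; apply: nbhs_left_gt.
  have td : 1 - d / 2 < t by near: t; apply: nbhs_left_gt; rewrite ltrBlDr ltrDl.
  have xd : `|x - x'| < d / 2 by near: x'; apply/nbhs_ballP; exists (d / 2) => //= y; rewrite -ball_normE.
  have x1 : `|x| <= 1 by apply: le_trans (norm_le_enorm x) _; rewrite xs.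
  rewrite -normrN -sub0r -(G0 _ xs); apply: dP.
    rewrite -ball_normE /=.
    have -> : x - t *: x' = (1 - t) *: x + t *: (x - x').
      by rewrite scalerBr scalerBl scale1r addrA subrK.
    apply: le_lt_trans (ler_normD _ _) _; rewrite !normrZ (gtr0_norm t0) gtr0_norm ?subr_gt0//.
    have h1 : (1 - t) * `|x| <= 1 - t by rewrite ler_piMr// subr_ge0 ltW.
    have h2 : t * `|x - x'| <= `|x - x'| by rewrite ler_piMl// ltW.
    by move: h1 h2 xd td; clear; lra.
  split; first by rewrite /ucball /= enormZ (gtr0_norm t0) x's mulr1 ltW.
  move=> /= h; have := congr1 (@enorm R) h.
  by rewrite enormZ (gtr0_norm t0) x's mulr1 enorm0 => h'; move: t0; rewrite h' ltxx.
exists (Num.max 0 (1 - d)); first by rewrite gt_max ltr01 ltrBlDr ltrDl.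
move=> x /andP[]; rewrite gt_max => /andP[xp xd] x1.
have xn := lt0r_neq0 xp.
have xb : `|1 - enorm x| < d by rewrite gtr0_norm ?subr_gt0// ltrBlDr addrC -ltrBlDr.
have xs : usphere R ((enorm x)^-1 *: x).
  by rewrite /usphere /= enormZ gtr0_norm ?invr_gt0// mulVf.
by have := dP (enorm x) xb x1 ((enorm x)^-1 *: x) xs xs; rewrite scalerA mulfV// scale1r.
Unshelve. all: by end_near. Qed.

End NearSphere.

Section RadialProfile.
Context {R : realType}.

(** A normalised primitive of a bump. The common bound on both derivatives yields the powers of
    1/delta after rescaling to chi(r / delta). *)
Lemma smooth_cutoff : exists chi chi1 chi2 : R -> R, exists C : R,
  [/\ Cinf chi, forall s : R, is_derive s 1 chi (chi1 s), forall s : R, is_derive s 1 chi1 (chi2 s),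
    (forall s, s < 1 -> chi s = 0) /\ (forall s, 2 < s -> chi s = 1) &
    0 <= C /\ forall s, `|chi1 s| <= C /\ `|chi2 s| <= C].
Proof.
pose b : R -> R := smooth_bump 1 2.
have cb : Cinf b by exact: Cinf_bump.
have b0 (s : R) : s < 0 -> b s = 0.
  by move=> s0; apply: bump_le; exact: le_trans (ltW s0) ler01.
have [b' db _] := cb 1%N.
have dp := der_prim_supp b (Cinf_cont _ cb) b0.
have cp (s : R) : {for s, continuous (prim b)} := der_continuous _ _ _ (dp s).
pose c0 := prim b 2.
have p1 (s : R) : s <= 1 -> prim b s = 0.
  move=> s1; rewrite -(prim0 b); have [s0|s0] := leP 0 s.
    apply/esym/is_derive0_eq => // t /andP[t0 ts]; rewrite -(bump_le 1 2 t); first exact: dp.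
    exact: le_trans (ltW ts) s1.
  apply: is_derive0_eq; [exact: ltW|by []|move=> t /andP[t0 ts]].
  by rewrite -(b0 t ts); exact: dp.
have c0p : 0 < c0.
  rewrite /c0 -(p1 1 (lexx _)); apply: (deriv_gt0_lt (prim b) b) => //.
  - by rewrite ltr1n.
  - by move=> t /bump_gt0.
have p2 (s : R) : 2 < s -> prim b s = c0.
  move=> s2; apply/esym/is_derive0_eq; [exact: ltW|by []|move=> t /andP[t2 ts]].
  by rewrite -(bump_ge 1 2 t (ltW t2)); exact: dp.
have b'0 := derive_eq0 b b' 1 (fun s h => bump_le 1 2 s (ltW h)) db.
have b'2 := derive_eq0_gt b b' 2 (fun s h => bump_ge 1 2 s (ltW h)) db.
have bnd (f : R -> R) : continuous f -> (forall s, s < 1 -> f s = 0) -> (forall s, 2 < s -> f s = 0) ->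
    exists2 M, 0 <= M & forall s, `|f s| <= M.
  move=> cf f1 f2; have [M M0 MP] := cont_bounded f 1 2 cf.
  exists M => // s; have [s1|s1] := ltP s 1; first by rewrite f1// normr0.
  have [s2|s2] := leP s 2; last by rewrite f2// normr0.
  by apply: MP; rewrite s1.
have [M1 M10 M1P] := bnd b (Cinf_cont _ cb) (fun s h => bump_le 1 2 s (ltW h))
  (fun s h => bump_ge 1 2 s (ltW h)).
have [M2 M20 M2P] := bnd b' (Cinf_cont _ (Cinf_derive _ _ db cb)) b'0 b'2.
exists (fun s => c0^-1 * prim b s), (fun s => c0^-1 * b s), (fun s => c0^-1 * b' s),
  (c0^-1 * (M1 + M2)).
have i0 : 0 <= c0^-1 by rewrite invr_ge0 ltW.
split.
- by apply: CinfM; [exact: Cinf_cst|exact: Cinf_prim_supp].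
- by move=> s; have d := dp s; der; rewrite mulr0 addr0.
- by move=> s; have d := db s; der; rewrite mulr0 addr0.
- split => s h; first by rewrite p1 ?mulr0// ltW.
  by rewrite p2// mulVf// gt_eqF.
- split; first by rewrite mulr_ge0// addr_ge0.
  have h1 : M1 <= M1 + M2 by rewrite lerDl.
  have h2 : M2 <= M1 + M2 by rewrite lerDr.
  move=> s; rewrite (normrM _ (b s)) (normrM _ (b' s)) (ger0_norm i0); split.
    exact: ler_wpM2l i0 _ _ (le_trans (M1P s) h1).
  exact: ler_wpM2l i0 _ _ (le_trans (M2P s) h2).
Qed.

(** Variation of constants for psi'' + w^2 psi = - sg, integrating from the right end, so that psi
    vanishes beyond the support of [sg]. To the left of [r0] it is a combination of sin and cos that
    may be nonzero, hence the need for a cutoff near the origin. *)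
Lemma shell_solution (w : R) (sg : R -> R) (r0 r1 : R) : 0 < w -> 0 < r0 -> r1 < 1 -> Cinf sg ->
  (forall r, r <= r0 -> sg r = 0) -> (forall r, r1 <= r -> sg r = 0) ->
  exists psi psi1 : R -> R,
  [/\ Cinf psi, forall r : R, is_derive r 1 psi (psi1 r),
    forall r : R, is_derive r 1 psi1 (- sg r - w ^+ 2 * psi r) &
    forall r, r1 < r -> psi r = 0].
Proof.
move=> w0 r00 r11 csg sg0 sg1; have wn := lt0r_neq0 w0.
pose sc (r : R) := cos (w * r) * sg r; pose ss (r : R) := sin (w * r) * sg r.
have cw : Cinf (fun r : R => w * r) by apply: CinfM; [exact: Cinf_cst|exact: Cinf_id].
have ccos : Cinf (fun r : R => cos (w * r)) by apply: Cinf_comp cw; exact: Cinf_cos.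
have csin : Cinf (fun r : R => sin (w * r)) by apply: Cinf_comp cw; exact: Cinf_sin.
have csc : Cinf sc by exact: CinfM.
have css : Cinf ss by exact: CinfM.
have neg (f : R -> R) r : r < 0 -> f r * sg r = 0.
  by move=> h; rewrite sg0 ?mulr0// ltW// (lt_trans h).
have dc := der_prim_supp sc (Cinf_cont _ csc) (neg _).
have ds := der_prim_supp ss (Cinf_cont _ css) (neg _).
pose a (r : R) := prim sc 1 - prim sc r; pose b (r : R) := prim ss 1 - prim ss r.
have ca : Cinf a.
  by apply: CinfD; [exact: Cinf_cst|apply: CinfN; exact: (Cinf_prim_supp _ csc (neg _))].
have cb : Cinf b.
  by apply: CinfD; [exact: Cinf_cst|apply: CinfN; exact: (Cinf_prim_supp _ css (neg _))].
have da (r : R) : is_derive r 1 a (- sc r) by have d := dc r; rewrite /a; der; rewrite add0r.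
have db (r : R) : is_derive r 1 b (- ss r) by have d := ds r; rewrite /b; der; rewrite add0r.
exists (fun r => w^-1 * (a r * sin (w * r) + - (b r * cos (w * r)))),
  (fun r => a r * cos (w * r) + b r * sin (w * r)); split.
- apply: CinfM; first exact: Cinf_cst.
  by apply: CinfD; [exact: CinfM|apply: CinfN; exact: CinfM].
- by move=> r; have d1 := da r; have d2 := db r; der; rewrite /sc /ss; field.
- move=> r; have d1 := da r; have d2 := db r; der; rewrite /sc /ss.
  have e := cos2Dsin2 (w * r).
  have -> : - sg r = - (sg r * (cos (w * r) ^+ 2 + sin (w * r) ^+ 2)) by rewrite e mulr1.
  by field.
- move=> r r1r.
  have const (f : R -> R) : (forall x : R, is_derive x 1 (prim (fun r => f r * sg r)) (f x * sg x)) ->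
      prim (fun r => f r * sg r) r = prim (fun r => f r * sg r) 1.
    move=> df; have c (x : R) := der_continuous _ _ _ (df x).
    have e (s t : R) : r1 <= s -> s <= t -> prim (fun r => f r * sg r) s = prim (fun r => f r * sg r) t.
      move=> rs st; apply: is_derive0_eq => // x /andP[sx _].
      by apply: der_eq (df x) _; rewrite sg1 ?mulr0// (le_trans rs)// ltW.
    have [r1'|r1'] := leP r 1; first exact: e (ltW r1r) r1'.
    by apply/esym; apply: e; exact: ltW.
  by rewrite /a /b /sc /ss !const// !subrr !mul0r oppr0 addr0 mulr0.
Qed.

End RadialProfile.

Section GreenValue.
Context {R : realType}.
Notation V := 'rV[R]_3.

Lemma near0_real (f : R -> R) (e : R) : 0 < e -> {for 0, continuous f} ->
  exists2 d, 0 < d & forall r, 0 < r < d -> `|f r - f 0| <= e.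
Proof.
move=> e0 cf; have /nbhs_ballP[d /= d0 dP] := eps_cont _ _ _ cf e e0.
exists d => // r /andP[r0 rd]; rewrite distrC; apply: dP.
by rewrite -ball_normE /= sub0r normrN gtr0_norm.
Qed.

Lemma singular_part_near0 (w A : R) (G h : V -> R) : 0 < w -> {for 0, continuous h} ->
  (forall x, uball R x -> x != 0 -> G x = A / enorm x + h x) ->
  forall e, 0 < e -> exists2 d, 0 < d & forall x, 0 < enorm x < d ->
    `|G x - wave w A (h 0 / w) (enorm x) / enorm x| <= e.
Proof.
move=> w0 ch GE e e0; have wn := lt0r_neq0 w0.
pose h0 := h 0.
have e2 : 0 < e / 2 by rewrite divr_gt0.
have /nbhs_ballP[d1 /= d10 d1P] := eps_cont _ _ _ ch _ e2.
(* The difference is (h(x) - h(0)) + (f(r) - f(0)) / r, and f'(0) = 0: this is where the coefficient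
   B = h(0) / w is forced. *)
pose f (r : R) := - A * (cos (w * r)) - h0 / w * (sin (w * r) - w * r).
pose f1 (r : R) := A * w * sin (w * r) - h0 * (cos (w * r) - 1).
have df (r : R) : is_derive r 1 f (f1 r) by rewrite /f; der; rewrite /f1; field.
have cf1 : {for 0, continuous f1} by rewrite /f1; cont.
have [d2 d20 d2P] := near0_real f1 _ e2 cf1.
have f10 : f1 0 = 0 by rewrite /f1 mulr0 sin0 cos0 subrr !mulr0 subr0.
exists (Num.min 1 (Num.min d1 d2)); first by rewrite !lt_min ltr01 d10 d20.
move=> x /andP[xp]; rewrite !lt_min => /and3P[x1 xd1 xd2].
have xn := lt0r_neq0 xp.
have x0 : x != 0 by apply: contra_neq xn => ->; exact: enorm0.
rewrite GE//.
have -> : A / enorm x + h x - wave w A (h 0 / w) (enorm x) / enorm x =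
    (h x - h0) + (f (enorm x) - f 0) / enorm x.
  have f0 : f 0 = - A by rewrite /f !mulr0 cos0 sin0 subr0 mulr0 mulr1 subr0.
  by rewrite f0 /f /wave -/h0; field; rewrite xn wn.
have hx : `|h x - h0| <= e / 2.
  rewrite distrC; apply: d1P; rewrite -ball_normE /= sub0r normrN.
  exact: le_lt_trans (norm_le_enorm x) xd1.
have cf (r : R) : 0 <= r <= enorm x -> {for r, continuous f}.
  by move=> _; exact: der_continuous (df r).
have df' (r : R) : 0 < r < enorm x -> is_derive r 1 f (f1 r) by move=> _.
have [c /andP[c0 cx] ->] := mean_value f f1 0 (enorm x) xp cf df'.
rewrite subr0 mulfK//; apply: le_trans (ler_normD _ _) _.
have : `|f1 c - f1 0| <= e / 2 by apply: d2P; rewrite c0 (lt_trans cx).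
by rewrite f10 subr0; move: hx; clear; lra.
Qed.

Lemma box3_enorm (c h : R) (p : R * R * R) : 0 < c -> 0 < h -> box3 c (c + h) 0 h p ->
  c <= enorm (row3 p) <= c + 3 * h.
Proof.
move=> c0 h0; case: p => [[x y] z] [[/=]].
rewrite !in_itv /= => /andP[x1 x2] /andP[y1 y2] /andP[z1 z2].
have eE : enorm (row3 ((x, y), z)) ^+ 2 = x ^+ 2 + y ^+ 2 + z ^+ 2.
  by rewrite enorm_sq; apply: etrans (sum3E _) _; rewrite !mxE /= !expr2.
have ch : 0 <= c + 3 * h by move: c0 h0; clear; lra.
suff /andP[k1 k2] : c ^+ 2 <= enorm (row3 ((x, y), z)) ^+ 2 <= (c + 3 * h) ^+ 2.
  apply/andP; split; first by move: k1; rewrite ler_pXn2r// nnegrE ?enorm_ge0// ltW.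
  by move: k2; rewrite ler_pXn2r// nnegrE enorm_ge0.
rewrite eE.
move: c0 h0 x1 x2 y1 y2 z1 z2; clear => c0 h0 x1 x2 y1 y2 z1 z2.
have hx : x ^+ 2 <= (c + h) ^+ 2 by rewrite ler_sqr ?nnegrE; lra.
have hx' : c ^+ 2 <= x ^+ 2 by rewrite ler_sqr ?nnegrE; lra.
have hy : y ^+ 2 <= h ^+ 2 by rewrite ler_sqr ?nnegrE; lra.
have hz : z ^+ 2 <= h ^+ 2 by rewrite ler_sqr ?nnegrE; lra.
have py := sqr_ge0 y; have pz := sqr_ge0 z.
by apply/andP; split; nra.
Qed.

Lemma box3_center (d : R) (p : R * R * R) : enorm (row3 p) <= d -> box3 (- d) d (- d) d p.
Proof.
case: p => [[x y] z] h.
have co (i : 'I_3) : `|row3 ((x, y), z) ord0 i| <= d := le_trans (abs_coord_le _ i) h.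
split; first split; rewrite /= in_itv/= -ler_norml.
- by have := co 0; rewrite mxE.
- by have := co 1; rewrite mxE.
- by have := co 2; rewrite mxE.
Qed.

(** If c = [wave 1] were nonzero, - c (G - wave / r) would exceed c^2 / 2 on a shell below the
    sphere. Tested with the residual of the cut-off solution of [shell_solution], it gives a fixed
    positive amount there, against a cutoff error of size e / dl^3 on a volume of order dl^3, while
    the total integral is 0. *)
Lemma wave_boundary (w A : R) (G h : V -> R) : 0 < w -> {for 0, continuous h} ->
  (forall x, uball R x -> x != 0 -> G x = A / enorm x + h x) ->
  {within ucball R `\ 0, continuous G} -> integrable_on_uball G ->
  (forall phi, test_function phi ->
     int_uball (fun x => G x * (- laplacian phi x - w ^+ 2 * phi x)) = phi 0) ->
  (forall x, usphere R x -> G x = 0) ->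
  wave w A (h 0 / w) 1 = 0.
Proof.
move=> w0 ch GE cG iG GP G0; set B := h 0 / w; set c := wave w A B 1.
apply/eqP; apply/negPn/negP => cn0.
have c2 : 0 < c ^+ 2 by rewrite exprn_even_gt0.
have cp : 0 < `|c| by rewrite normr_gt0.
have cwave (r : R) : 0 < r -> {for r, continuous (fun r => wave w A B r / r)}.
  move=> r0; have cw : {for r, continuous (wave w A B)} := der_continuous _ _ _ (der_wave w A B r).
  by cont; rewrite gt_eqF.
have e4 : 0 < `|c| / 4 by rewrite divr_gt0.
have [t0 t01 tP] := near_sphere G _ e4 cG G0.
have [s0 s01 sP] : exists2 s0, s0 < 1 & forall r, s0 < r < 1 -> `|c - wave w A B r / r| <= `|c| / 4.
  have /nbhs_ballP[d /= d0 dP] := eps_cont _ _ _ (cwave 1 ltr01) _ e4.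
  exists (1 - d); first by rewrite ltrBlDr ltrDl.
  move=> r /andP[r1 r2]; have := dP r; rewrite /c divr1; apply.
  by rewrite -ball_normE /= gtr0_norm ?subr_gt0//; move: r1; clear; lra.
pose r0 := Num.max (1 / 2) (Num.max t0 s0).
have r0h : 1 / 2 <= r0 by rewrite /r0 le_max lexx.
have r01 : r0 < 1 by rewrite /r0 !gt_max t01 s01; apply/andP; split => //; clear; lra.
have shell (x : V) : r0 < enorm x < 1 -> c ^+ 2 / 2 <= - c * (G x - wave w A B (enorm x) / enorm x).
  move=> /andP[]; rewrite /r0 !gt_max => /and3P[_ h1 h2] h3.
  have g1 := tP x (ltac:(by rewrite h1)); have g2 := sP (enorm x) (ltac:(by rewrite h2)).
  have k1 : `|c * G x| <= c ^+ 2 / 4.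
    rewrite normrM -(real_normK (num_real c)); move: g1 (normr_ge0 c); clear; nra.
  have k2 : `|c * (c - wave w A B (enorm x) / enorm x)| <= c ^+ 2 / 4.
    rewrite normrM -(real_normK (num_real c)); move: g2 (normr_ge0 c); clear; nra.
  move: k1 k2; rewrite !ler_norml => /andP[_ k1] /andP[_ k2].
  move: k1 k2; clear; move: (G x) (wave w A B (enorm x) / enorm x) => a b; nra.
pose r1 := (1 + r0) / 2.
have r11 : r1 < 1 by rewrite /r1; move: r01; clear; lra.
have r0r1 : r0 < r1 by rewrite /r1; move: r01; clear; lra.
have r00 : 0 < r0 by move: r0h; clear; lra.
have r10 : 0 < r1 := lt_trans r00 r0r1.
pose sg : R -> R := smooth_bump r0 r1.
have csg : Cinf sg by exact: Cinf_bump.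
have sgz r : r <= r0 -> sg r = 0 by exact: bump_le.
have sgp r : 0 <= sg r by exact: bump_ge0.
have [psi [psi1 [cpsi dpsi dpsi1 psi0]]] := shell_solution w sg r0 r1 w0 r00 r11 csg
  (fun r => bump_le r0 r1 r) (fun r => bump_ge r0 r1 r).
have [chi [chi1 [chi2 [C [cchi dchi dchi1 [chi0 chi2p] [C0 CP]]]]]] := @smooth_cutoff R.
have chi1z := derive_eq0_gt (fun s => chi s - 1) chi1 2.
have {}chi1z s : 2 < s -> chi1 s = 0.
  apply: chi1z => [r /chi2p ->|r]; first exact: subrr.
  by have d := dchi r; der; rewrite addr0.
have chi2z := derive_eq0_gt chi1 chi2 2 chi1z dchi1.
have [M M0 MP] := cont_bounded psi 0 1 (Cinf_cont _ cpsi).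
have [M1 M10 M1P] := cont_bounded psi1 0 1 (Cinf_cont _ (Cinf_derive _ _ dpsi cpsi)).
(* The box with corner (rm, 0, 0) and side [hh] has norms between rm and rm + 3 hh = rm + (r1 - r0)
   / 4 < r1, hence lies in the shell where the bump is positive. *)
pose rm := (r0 + r1) / 2; pose hh := (r1 - r0) / 12.
have hh0 : 0 < hh by rewrite /hh; move: r0r1; clear; lra.
have rm0 : 0 < rm by rewrite /rm; move: r00 r10; clear; lra.
have [m0 m00 m0P] : exists2 m0, 0 < m0 & forall r, rm <= r <= rm + 3 * hh -> m0 <= sg r.
  have le : rm <= rm + 3 * hh by move: hh0; clear; lra.
  have cA : {within `[rm, rm + 3 * hh], continuous sg} by apply: continuous_subspaceT; exact: Cinf_cont csg.
  have [k kab kmin] := EVT_min le cA.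
  exists (sg k); last by move=> r rk; apply: kmin; rewrite in_itv.
  apply: bump_gt0; move: kab; rewrite in_itv /= /rm /hh => /andP[k1 k2].
  by move: k1 k2 r0r1; clear => *; apply/andP; split; lra.
pose m := c ^+ 2 / 2 * m0.
have mpos : 0 < m by rewrite mulr_gt0// divr_gt0.
pose N := `|c| * (C * M + 2 * C * M1).
have N0 : 0 <= N.
  by apply: mulr_ge0 => //; apply: addr_ge0; apply: mulr_ge0 => //; apply: mulr_ge0.
have key e : 0 < e -> m * hh ^+ 3 <= 64 * N * e.
  move=> e0; have [d d0 dP] := singular_part_near0 w A G h w0 ch GE e e0.
  (* With dl <= 1/8 the transition zone dl <= r <= 2 dl stays below 1/2 <= r0, where [sg] vanishes;
     with dl <= d/4 it stays in the region where the difference is at most [e]. *)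
  pose dl := Num.min (1 / 8) (d / 4).
  have dl0 : 0 < dl by rewrite lt_min; apply/andP; split; move: d0; clear; lra.
  have dl8 : dl <= 1 / 8 by rewrite ge_min lexx.
  have dld : dl <= d / 4 by rewrite ge_min lexx orbT.
  have dn := lt0r_neq0 dl0.
  pose p (r : R) := chi (r / dl) * psi r.
  pose p1 (r : R) := chi1 (r / dl) / dl * psi r + chi (r / dl) * psi1 r.
  pose p2 (r : R) := chi2 (r / dl) / dl ^+ 2 * psi r + 2 * (chi1 (r / dl) / dl) * psi1 r
    + chi (r / dl) * (- sg r - w ^+ 2 * psi r).
  have dlin (r : R) : is_derive r 1 (fun r : R => r / dl) dl^-1.
    by der; rewrite mulr0 add0r mulr1.
  have clin : Cinf (fun r : R => r / dl) by apply: CinfM; [exact: Cinf_id|exact: Cinf_cst].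
  have dch (r : R) := der_comp chi _ _ _ _ _ (dlin r) (dchi _).
  have dch1 (r : R) := der_comp chi1 _ _ _ _ _ (dlin r) (dchi1 _).
  have dp (r : R) : is_derive r 1 p (p1 r).
    apply: der_eq (derM _ _ _ _ _ _ (dch r) (dpsi r)) _; rewrite /p1; ring.
  have dp1 (r : R) : is_derive r 1 p1 (p2 r).
    have e1 := derM _ _ _ _ _ _ (dch1 r) (der_cst dl^-1 r 1).
    have e2 := derM _ _ _ _ _ _ e1 (dpsi r).
    have e3 := derM _ _ _ _ _ _ (dch r) (dpsi1 r).
    by apply: der_eq (derD _ _ _ _ _ _ e2 e3) _; rewrite /p2; field.
  have cp' : Cinf p by apply: CinfM => //; exact: Cinf_comp.
  have pa r : r < dl -> p r = 0 by move=> rd; rewrite /p chi0 ?mul0r// ltr_pdivrMr// mul1r.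
  have pb r : r1 < r -> p r = 0 by move=> /psi0 h'; rewrite /p h' mulr0.
  pose f (x : V) := - c * ((G x - wave w A B (enorm x) / enorm x) * residual w p p2 (enorm x)).
  have fi : leb3.-integrable ball3 (EFin \o (fun q => f (row3 q))).
    exact: (integrable_diff w A B p p1 p2 dl dl0 cp' dp dp1 pa G iG (- c)).
  have f0 : int_uball f = 0.
    exact: (int_diff w A B p p1 p2 dl r1 dl0 r11 cp' dp dp1 pa pb (w ^+ 2) G erefl iG GP (- c)).
  (* In the transition zone the residual is at most (C M + 2 C M1) / (dl^2 r) with r >= dl. The cube
     of side 4 dl has volume 64 dl^3, so the cost 64 N e does not depend on dl. *)
  pose E := N * e / dl ^+ 3.
  have E0 : 0 <= E by rewrite divr_ge0 ?exprn_ge0 ?(ltW dl0)// mulr_ge0// ltW.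
  have wf (x : V) : f x = - c * (G x - wave w A B (enorm x) / enorm x) * residual w p p2 (enorm x).
    by rewrite /f mulrA.
  have sub (q : R * R * R) : box3 rm (rm + hh) 0 hh q -> r0 < enorm (row3 q) < r1.
    move=> /(box3_enorm rm hh q rm0 hh0) /andP[]; rewrite /rm /hh; move: (enorm _) => r.
    by move: r0r1; clear => *; apply/andP; split; lra.
  have Qb (q : R * R * R) : box3 rm (rm + hh) 0 hh q -> ball3 q.
    by move=> /sub /andP[_ h1]; exact: lt_trans h1 r11.
  have dl2 : 0 < 2 * dl by rewrite mulr_gt0.
  have f0' : int_uball f <= 0 by rewrite f0.
  suff pw (q : R * R * R) : ball3 q -> m * \1_(box3 rm (rm + hh) 0 hh) q
      - E * \1_(box3 (- (2 * dl)) (2 * dl) (- (2 * dl)) (2 * dl)) q <= f (row3 q).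
    have := box_estimate f rm hh (2 * dl) m E hh0 dl2 E0 fi f0' Qb pw.
    have -> // : E * (2 * (2 * dl)) ^+ 3 = 64 * N * e by rewrite /E; field.
  move=> qb; set x := row3 q; have x1 : enorm x < 1 := qb.
  have i1 : 0 <= E * \1_(box3 (- (2 * dl)) (2 * dl) (- (2 * dl)) (2 * dl)) q by rewrite mulr_ge0.
  have nQ : enorm x <= r0 -> \1_(box3 rm (rm + hh) 0 hh) q = 0 :> R.
    move=> xr; rewrite indicE; case: (boolP (q \in _)) => // /set_mem/sub.
    by rewrite -/x ltNge xr.
  have [xd|dx] := ltP (enorm x) dl.
    rewrite wf (residual_near0 w p p1 p2 dl dp dp1 pa _ xd) mulr0 nQ ?mulr0 ?sub0r ?oppr_le0//.
    by move: xd dl8 r0h; clear; lra.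
  have xp : 0 < enorm x := lt_le_trans dl0 dx.
  have xn := lt0r_neq0 xp.
  have [x2|x2] := leP (enorm x) (2 * dl).
    have xr : enorm x <= r0 by move: x2 dl8 r0h; clear; lra.
    rewrite nQ// mulr0 sub0r indicE mem_set ?mulr1; last exact: box3_center.
    have xd : 0 < enorm x < d by rewrite xp; move: x2 dld dl0; clear; lra.
    have := dP x xd; rewrite -/B => wdle.
    suff : `|f x| <= E by rewrite ler_norml => /andP[].
    rewrite wf /residual /p2 /p (sgz _ xr) oppr0 sub0r.
    have -> : - ((chi2 (enorm x / dl) / dl ^+ 2 * psi (enorm x)
        + 2 * (chi1 (enorm x / dl) / dl) * psi1 (enorm x)
        + chi (enorm x / dl) * - (w ^+ 2 * psi (enorm x))
        + w ^+ 2 * (chi (enorm x / dl) * psi (enorm x))) / enorm x) =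
      - ((chi2 (enorm x / dl) * psi (enorm x)
        + 2 * chi1 (enorm x / dl) * psi1 (enorm x) * dl) / (dl ^+ 2 * enorm x)).
      by field; rewrite xn dn.
    have [C1 C2] := CP (enorm x / dl).
    have xI : 0 <= enorm x <= 1 by rewrite (ltW xp) ltW.
    have b1 : `|chi2 (enorm x / dl) * psi (enorm x)| <= C * M.
      by rewrite normrM; apply: ler_pM => //; exact: MP.
    have b2 : `|2 * chi1 (enorm x / dl) * psi1 (enorm x) * dl| <= 2 * C * M1.
      rewrite -[leRHS]mulr1 normrM; apply: ler_pM => //; last first.
        by rewrite gtr0_norm//; move: dl8; clear; lra.
      rewrite normrM; apply: ler_pM => //; last exact: M1P.
      by rewrite normrM (@ger0_norm _ 2)// ler_wpM2l.
    have b3 : `|chi2 (enorm x / dl) * psi (enorm x)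
        + 2 * chi1 (enorm x / dl) * psi1 (enorm x) * dl| <= C * M + 2 * C * M1.
      by apply: le_trans (ler_normD _ _) _; exact: lerD.
    have q0 : 0 < dl ^+ 2 * enorm x by rewrite mulr_gt0// exprn_gt0.
    rewrite normrM normrN normrM normrN (normrM _ (_^-1)) normfV (gtr0_norm q0) mulrA.
    rewrite ler_pdivrMr// /E /N.
    apply: (@le_trans _ _ (`|c| * e * (C * M + 2 * C * M1))).
      by apply: ler_pM => //; rewrite ler_wpM2l.
    have -> : `|c| * (C * M + 2 * C * M1) * e / dl ^+ 3 * (dl ^+ 2 * enorm x) =
      `|c| * e * (C * M + 2 * C * M1) * (enorm x / dl) by field.
    rewrite ler_peMr//; last by rewrite ler_pdivlMr// mul1r.
    by apply: mulr_ge0; [rewrite mulr_ge0// ltW|rewrite addr_ge0// !mulr_ge0].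
  have sx : 2 < enorm x / dl by rewrite ltr_pdivlMr.
  have srcE : residual w p p2 (enorm x) = sg (enorm x) / enorm x.
    rewrite /residual /p2 /p (chi2p _ sx) (chi1z _ sx) (chi2z _ sx); ring.
  rewrite wf srcE.
  have [xr0|xr0] := leP (enorm x) r0.
    by rewrite nQ// (sgz _ xr0) mul0r mulr0 mulr0 sub0r oppr_le0.
  have sh := shell x (ltac:(by rewrite xr0)).
  apply: (@le_trans _ _ (m * \1_(box3 rm (rm + hh) 0 hh) q)); first by rewrite gerBl.
  have sg0 : 0 <= sg (enorm x) / enorm x by rewrite divr_ge0// ltW.
  apply: le_trans (ler_wpM2r sg0 sh); rewrite /m -mulrA ler_wpM2l ?divr_ge0 ?(ltW c2)//.
  rewrite indicE; case: (boolP (q \in _)) => [/set_mem Qq|_]; last by rewrite mulr0.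
  have := m0P _ (box3_enorm rm hh q rm0 hh0 Qq); rewrite -/x => sgm.
  rewrite mulr1; apply: le_trans sgm _; rewrite ler_pdivlMr//.
  by apply: ler_piMr; [exact: sgp|exact: ltW].
(* For X = m hh^3 and e = X / (128 N + 1) the estimate reads X <= 64 N X / (128 N + 1), impossible
   for X > 0. *)
have NN : 0 < 128 * N + 1 by move: N0; clear; lra.
have mh : 0 < m * hh ^+ 3 by rewrite mulr_gt0// exprn_gt0.
have := key (m * hh ^+ 3 / (128 * N + 1)) (divr_gt0 mh NN).
rewrite [64 * N * _]mulrA ler_pdivlMr//; move: mh N0; move: (m * _) => X; clear; nra.
Qed.

End GreenValue.

Lemma green_regular_part_value {R : realType} (mu : R) (g : 'rV[R]_3 -> 'rV[R]_3 -> R) :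
  0 < mu -> is_green_regular_part mu g ->
  cos (Num.sqrt mu) / (4 * pi) + g 0 0 / Num.sqrt mu * sin (Num.sqrt mu) = 0.
Proof.
move=> mu0 [G [greenG Gg cg]]; set w := Num.sqrt mu.
have w0 : 0 < w by rewrite sqrtr_gt0.
have wE : w ^+ 2 = mu by rewrite sqr_sqrtr// ltW.
have u0 : uball R (0 : 'rV[R]_3) by apply/uballE; rewrite dot0l.
have [cG iG GP G0] := greenG 0 u0.
have ch : {for 0, continuous (fun x : 'rV[R]_3 => g x 0)}.
  have cp : {for 0, continuous (fun x : 'rV[R]_3 => (x, 0 : 'rV[R]_3))}.
    exact: (cvg_pair (@cvg_id _ (nbhs (0 : 'rV[R]_3))) (cvg_cst (0 : 'rV[R]_3))).
  exact: (cont_compT _ (fun p : 'rV[R]_3 * 'rV[R]_3 => g p.1 p.2) _ _ cp (cg 0 u0)).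
have GE (x : 'rV[R]_3) : uball R x -> x != 0 -> G x 0 = (4 * pi)^-1 / enorm x + g x 0.
  by move=> ux x0; rewrite Gg// subr0 invfM.
have GP' (phi : 'rV[R]_3 -> R) : test_function phi ->
    int_uball (fun x => G x 0 * (- laplacian phi x - w ^+ 2 * phi x)) = phi 0.
  by rewrite wE; exact: GP.
have := wave_boundary w (4 * pi)^-1 (fun x => G x 0) (fun x => g x 0) w0 ch GE cG iG GP' G0.
by rewrite /wave mulr1 mulrC.
Qed.

Theorem corollary1p1 (R : realType) (mu K0 eta : R)
    (K : 'rV[R]_3 -> R) (g : 'rV[R]_3 -> 'rV[R]_3 -> R)
    (mu_gt0 : 0 < mu) (mu_lt : mu < pi ^+ 2)
    (K0_gt0 : 0 < K0) (eta_ge0 : 0 <= eta)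
    (KE : forall x, uball R x -> K x = K0 - eta * (enorm x + enorm x ^+ 2))
    (K_ge0 : forall x, uball R x -> 0 <= K x)
    (gP : is_green_regular_part mu g) :
  (exists u : 'rV[R]_3 -> R, is_solution K mu u) <->
  eta / (16 * pi * K0) < g 0 0.
Proof.
have val := green_regular_part_value mu g mu_gt0 gP.
set w := Num.sqrt mu in val.
have w0 : 0 < w by rewrite sqrtr_gt0.
have wpi : w < pi by rewrite -(@ltr_pXn2r _ 2) ?nnegrE ?pi_ge0 ?(ltW w0)// sqr_sqrtr// ltW.
have sn : sin w != 0 by rewrite gt_eqF// sin_gt0_pi// w0.
(* The boundary relation gives 4 pi g(o,o) = - w cot w; multiplying the condition by 16 pi K0 = 4 K0
   . 4 pi turns it into the form used by [existence] and [nonexistence]. *)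
have -> : (eta / (16 * pi * K0) < g 0 0) = (eta < 4 * K0 * (- (w * cos w / sin w))).
  have pp : 0 < pi :> R := pi_gt0 R.
  have := val; move: (pi : R) pp => P pp val'; have Pn := lt0r_neq0 pp.
  have -> : g 0 0 = - (w * cos w / sin w) / (4 * P).
    have -> : g 0 0 = w * (g 0 0 / w * sin w) / sin w by field; rewrite sn gt_eqF.
    by move/eqP: val'; rewrite addrC addr_eq0 => /eqP ->; field; rewrite sn Pn.
  rewrite ltr_pdivrMr; last by rewrite !mulr_gt0.
  by congr (_ < _); field; rewrite sn Pn.
split; last exact: existence.
case=> u su; rewrite ltNge; apply/negP => le.
exact: nonexistence le su.
Qed.
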